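(* Let $u$ be the exact solution of the plate problem, $v=\Delta u$, $u_{ij}^n=u(x_i,y_j,t_n)$, $v_{ij}^n=v(x_i,y_j,t_n)$, and let $\{U_{ij}^n\},\{V_{ij}^n\}$ be the solution of the fully discrete compact difference scheme for the plate problem described in the context. Suppose that, for $(\mathbf x,t)\in[0,1]^2\times[0,T]$ and $k=x,y$, $$|\partial_t^4u(\mathbf x,t)|\le\mathcal Q,\quad|\partial_t^3\partial_k^2u(\mathbf x,t)|\le\mathcal Q,\quad|\partial_k^6u(\mathbf x,t)|\le\mathcal Q,\quad|\partial_t\partial_k^4u(\mathbf x,t)|\le\mathcal Q.$$ Then there is a positive constant $\mathcal Q(T)$, independent of the mesh sizes $\tau,h_1,h_2$, such that $$\sqrt{\|\delta_t(u^{n+1}-U^{n+1})\|^2+\|v^{n+1}-V^{n+1}\|^2+\|v^n-V^n\|^2}\le\mathcal Q(T)\,(\tau^2+h_1^4+h_2^4),\qquad1\le n\le N.$$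
   Context: Plate problem, on $\Gamma=(0,1)^2$, $\mathbf x=(x,y)$: $$\partial_t^2u+\hat q(t)\partial_tu+\Delta^2u=f(\mathbf x,t),\quad(\mathbf x,t)\in\Gamma\times(0,T],\qquad\hat q(t)=P\Big(\int_\Gamma|\Delta u(\mathbf x,t)|^2d\mathbf x\Big),$$ $u(\mathbf x,0)=u_0(\mathbf x)$, $\partial_tu(\mathbf x,0)=u_1(\mathbf x)$ for $\mathbf x\in\Gamma$, and $u=\Delta u=0$ on $\partial\Gamma\times(0,T]$; $u_0,u_1,f$ are given functions. $\mathcal Q$ denotes a generic positive constant independent of the mesh sizes, possibly different in different places. Standing assumptions on $P:\mathbb R^+\to(0,\infty)$: (i) there are positive constants $p_0,p_1$ such that $P(z)\le p_1$ for $0\le z\le\mathcal Q$ and $P(z)\ge p_0$ for all $z\ge0$; (ii) $P$ is continuously differentiable with $0\le P'(z)\le L$ for $z\ge0$. Grid: $J_1,J_2$ positive integers, $h_1=\frac1{2J_1}$, $h_2=\frac1{2J_2}$, $x_i=ih_1$ $(0\le i\le2J_1)$, $y_j=jh_2$ $(0\le j\le2J_2)$; $t_n=n\tau$, $0\le n\le N+1$, a uniform partition of $[0,T]$ with $\tau=T/(N+1)$. For grid functions: $\delta_x\delta_{\bar x}U_{ij}=(U_{i+1,j}-2U_{ij}+U_{i-1,j})/h_1^2$, $\delta_y\delta_{\bar y}U_{ij}=(U_{i,j+1}-2U_{ij}+U_{i,j-1})/h_2^2$; $\mathcal AU_{ij}=\frac1{12}(U_{i+1,j}+10U_{ij}+U_{i-1,j})$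 for $1\le i\le2J_1-1$ and $\mathcal AU_{ij}=U_{ij}$ for $i=0,2J_1$; $\mathcal BU_{ij}=\frac1{12}(U_{i,j+1}+10U_{ij}+U_{i,j-1})$ for $1\le j\le2J_2-1$ and $\mathcal BU_{ij}=U_{ij}$ for $j=0,2J_2$; $\mathcal H=\mathcal A\mathcal B$, $\Phi=\mathcal B\delta_x\delta_{\bar x}+\mathcal A\delta_y\delta_{\bar y}$; $\delta_tU^n=(U^n-U^{n-1})/\tau$, $\delta_t^{(2)}U^n=(U^{n+1}-2U^n+U^{n-1})/\tau^2$, $\bar\delta_tU^n=(U^{n+1}-U^{n-1})/(2\tau)$, $\widetilde U^n=(U^{n+1}+U^{n-1})/2$. Norms: $\|\omega\|^2=h_1h_2\sum_{i=1}^{2J_1-1}\sum_{j=1}^{2J_2-1}\omega_{ij}^2$, $$\|\omega\|_E=\frac23\sqrt{h_1h_2\sum_{i=1}^{J_1}\sum_{j=1}^{J_2}\left(\omega_{2i-2,2j-1}^2+\omega_{2i-1,2j-2}^2+3\omega_{2i-1,2j-1}^2\right)},\qquad\|\omega\|_F=\sqrt{\tfrac49\|\omega\|^2+\|\omega\|_E^2}.$$ Fully discrete scheme, for $1\le i\le2J_1-1$, $1\le j\le2J_2-1$, $1\le n\le N$, with $f^n_{ij}=f(x_i,y_j,t_n)$: $$\mathcal H\delta_t^{(2)}U_{ij}^n+P(\|V^n\|_F^2)\,\mathcal H\bar\delta_tU_{ij}^n+\Phi\widetilde V_{ij}^n=\mathcal Hf_{ij}^n,\qquad\mathcal H\bar\delta_tV_{ij}^n=\Phi\bar\delta_tU_{ij}^n,$$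 with $U_{ij}^n=V_{ij}^n=0$ at all boundary grid points ($i\in\{0,2J_1\}$ or $j\in\{0,2J_2\}$), $0\le n\le N+1$, and initial data at interior grid points $U_{ij}^0=u_0(x_i,y_j)$, $\delta_tU_{ij}^1=u_1(x_i,y_j)+\frac\tau2u_2(x_i,y_j)$, where $u_2=\partial_t^2u(\cdot,0)=-\hat q(0)u_1-\Delta^2u_0+f(\cdot,0)$; and $V_{ij}^0=(\Delta u_0)(x_i,y_j)$, $V_{ij}^1=\Delta\big(u_0+\tau u_1+\frac{\tau^2}2u_2\big)(x_i,y_j)$.
   Formalization: Beyond the printed bounds, all derivatives of u of order a in t, b in x, c in y with 2a+b+c ≤ 8 are assumed to exist and be continuous on [0,1]²×[0,T], and f is assumed continuous there; with the printed bounds alone the O(h⁴) rate fails by aliasing. *)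

(* Defs.v *)
From Stdlib Require Import Reals.
From Coquelicot Require Import Coquelicot.
Open Scope R_scope.

(** * The continuous problem *)

Definition in_Gamma (x y : R) : Prop := 0 < x < 1 /\ 0 < y < 1.

Definition in_closed_Gamma (x y : R) : Prop := 0 <= x <= 1 /\ 0 <= y <= 1.

Definition on_boundary (x y : R) : Prop :=
  in_closed_Gamma x y /\ (x = 0 \/ x = 1 \/ y = 0 \/ y = 1).

Definition in_cylinder (T x y t : R) : Prop :=
  in_closed_Gamma x y /\ 0 <= t <= T.

Definition continuous_cylinder (T : R) (g : R -> R -> R -> R) : Prop :=
  continuous_on
    (fun p : R * R * R => in_cylinder T (fst (fst p)) (snd (fst p)) (snd p))
    (fun p : R * R * R => g (fst (fst p)) (snd (fst p)) (snd p)).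

(** [D a b c] is the partial derivative of order [a] in t, [b] in x, [c] in y
    of [u], on the closed cylinder (derivatives are one-sided at the ends of
    [0,1] and [0,T], hence [D_in]).  As all these derivatives are continuous,
    the order of differentiation is irrelevant, which is why a single [D a b c]
    is the derivative of each of its predecessors.
    A time derivative counts for two space derivatives, as the plate operator
    suggests; order 8 is that of the fourth time derivative of [u], and of the
    sixth space derivatives of the Laplacian of [u], on which the fourth-order
    consistency of the compact operators depends. *)
Definition order (a b c : nat) : nat := (2 * a + b + c)%nat.

Record derivatives (T : R) (u : R -> R -> R -> R)
    (D : nat -> nat -> nat -> R -> R -> R -> R) : Prop := {
  der_0 : forall x y t, in_cylinder T x y t -> D 0%nat 0%nat 0%nat x y t = u x y t;
  der_cont : forall a b c, (order a b c <= 8)%nat ->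
    continuous_cylinder T (D a b c);
  der_t : forall a b c, (order (S a) b c <= 8)%nat ->
    forall x y t, in_cylinder T x y t ->
    D_in (fun s => D a b c x y s) (fun s => D (S a) b c x y s)
         (fun s => 0 <= s <= T) t;
  der_x : forall a b c, (order a (S b) c <= 8)%nat ->
    forall x y t, in_cylinder T x y t ->
    D_in (fun z => D a b c z y t) (fun z => D a (S b) c z y t)
         (fun z => 0 <= z <= 1) x;
  der_y : forall a b c, (order a b (S c) <= 8)%nat ->
    forall x y t, in_cylinder T x y t ->
    D_in (fun z => D a b c x z t) (fun z => D a b (S c) x z t)
         (fun z => 0 <= z <= 1) y }.

Definition Lap (D : nat -> nat -> nat -> R -> R -> R -> R) (x y t : R) : R :=
  D 0%nat 2%nat 0%nat x y t + D 0%nat 0%nat 2%nat x y t.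

Definition BiLap (D : nat -> nat -> nat -> R -> R -> R -> R) (x y t : R) : R :=
  D 0%nat 4%nat 0%nat x y t + 2 * D 0%nat 2%nat 2%nat x y t
  + D 0%nat 0%nat 4%nat x y t.

Definition int_Gamma (g : R -> R -> R) : R :=
  RInt (fun x => RInt (fun y => g x y) 0 1) 0 1.

(** The values of [P] at negative arguments are irrelevant. *)
Record damping (P : R -> R) : Prop := {
  damping_lower : exists p0, 0 < p0 /\ forall z, 0 <= z -> p0 <= P z;
  damping_upper : forall M, 0 < M ->
    exists p1, 0 < p1 /\ forall z, 0 <= z <= M -> P z <= p1;
  damping_C1 : exists (P' : R -> R) (L : R),
    forall z, 0 <= z ->
      D_in P P' (fun w => 0 <= w) z /\
      continue_in P' (fun w => 0 <= w) z /\
      0 <= P' z <= L }.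

Record plate_solution (T : R) (P : R -> R) (f : R -> R -> R -> R)
    (u0 u1 : R -> R -> R) (D : nat -> nat -> nat -> R -> R -> R -> R) : Prop := {
  plate_pde : forall x y t, in_Gamma x y -> 0 < t <= T ->
    D 2%nat 0%nat 0%nat x y t
    + P (int_Gamma (fun x' y' => Lap D x' y' t ^ 2)) * D 1%nat 0%nat 0%nat x y t
    + BiLap D x y t = f x y t;
  plate_init0 : forall x y, in_Gamma x y -> D 0%nat 0%nat 0%nat x y 0 = u0 x y;
  plate_init1 : forall x y, in_Gamma x y -> D 1%nat 0%nat 0%nat x y 0 = u1 x y;
  plate_bc : forall x y t, on_boundary x y -> 0 < t <= T ->
    D 0%nat 0%nat 0%nat x y t = 0 /\ Lap D x y t = 0 }.

(** * The fully discrete scheme *)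

Definition lap (w : R -> R -> R) (x y : R) : R :=
  Derive_n (fun z => w z y) 2 x + Derive_n (fun z => w x z) 2 y.

(** The second time derivative of the solution at time 0, expressed through
    the data by means of the equation. *)
Definition u2 (P : R -> R) (f : R -> R -> R -> R) (u0 u1 : R -> R -> R)
    (x y : R) : R :=
  - P (int_Gamma (fun x' y' => lap u0 x' y' ^ 2)) * u1 x y
  - lap (lap u0) x y + f x y 0.

Definition step (J : nat) : R := / (2 * INR J).
Definition node (J i : nat) : R := INR i * step J.
Definition tstep (T : R) (N : nat) : R := T / INR (N + 1).
Definition tnode (T : R) (N n : nat) : R := INR n * tstep T N.

Definition grid := nat -> nat -> R.

Definition d2x (J1 : nat) (w : grid) : grid := fun i j =>
  (w (i + 1)%nat j - 2 * w i j + w (i - 1)%nat j) / step J1 ^ 2.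

Definition d2y (J2 : nat) (w : grid) : grid := fun i j =>
  (w i (j + 1)%nat - 2 * w i j + w i (j - 1)%nat) / step J2 ^ 2.

Definition opA (J1 : nat) (w : grid) : grid := fun i j =>
  if andb (Nat.ltb 0 i) (Nat.ltb i (2 * J1)) then
    / 12 * (w (i + 1)%nat j + 10 * w i j + w (i - 1)%nat j)
  else w i j.

Definition opB (J2 : nat) (w : grid) : grid := fun i j =>
  if andb (Nat.ltb 0 j) (Nat.ltb j (2 * J2)) then
    / 12 * (w i (j + 1)%nat + 10 * w i j + w i (j - 1)%nat)
  else w i j.

Definition opH (J1 J2 : nat) (w : grid) : grid := opA J1 (opB J2 w).

Definition opPhi (J1 J2 : nat) (w : grid) : grid := fun i j =>
  opB J2 (d2x J1 w) i j + opA J1 (d2y J2 w) i j.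

(** A space-time grid function is indexed as [W n i j]. *)
Definition dt (tau : R) (W : nat -> grid) (n : nat) : grid := fun i j =>
  (W n i j - W (n - 1)%nat i j) / tau.

Definition dtt (tau : R) (W : nat -> grid) (n : nat) : grid := fun i j =>
  (W (n + 1)%nat i j - 2 * W n i j + W (n - 1)%nat i j) / tau ^ 2.

Definition dtbar (tau : R) (W : nat -> grid) (n : nat) : grid := fun i j =>
  (W (n + 1)%nat i j - W (n - 1)%nat i j) / (2 * tau).

Definition tavg (W : nat -> grid) (n : nat) : grid := fun i j =>
  (W (n + 1)%nat i j + W (n - 1)%nat i j) / 2.

Definition norm2 (J1 J2 : nat) (w : grid) : R :=
  sqrt (step J1 * step J2 *
    sum_n_m (fun i => sum_n_m (fun j => w i j ^ 2) 1 (2 * J2 - 1))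
      1 (2 * J1 - 1)).

Definition normE (J1 J2 : nat) (w : grid) : R :=
  2 / 3 * sqrt (step J1 * step J2 *
    sum_n_m (fun i => sum_n_m (fun j =>
        w (2 * i - 2)%nat (2 * j - 1)%nat ^ 2
        + w (2 * i - 1)%nat (2 * j - 2)%nat ^ 2
        + 3 * w (2 * i - 1)%nat (2 * j - 1)%nat ^ 2) 1 J2)
      1 J1).

Definition normF (J1 J2 : nat) (w : grid) : R :=
  sqrt (4 / 9 * norm2 J1 J2 w ^ 2 + normE J1 J2 w ^ 2).

Definition restrict (T : R) (J1 J2 N : nat) (g : R -> R -> R -> R)
    (n : nat) : grid :=
  fun i j => g (node J1 i) (node J2 j) (tnode T N n).

Definition interior (J1 J2 i j : nat) : Prop :=
  (1 <= i <= 2 * J1 - 1)%nat /\ (1 <= j <= 2 * J2 - 1)%nat.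

Definition grid_boundary (J1 J2 i j : nat) : Prop :=
  (i <= 2 * J1)%nat /\ (j <= 2 * J2)%nat /\
  (i = 0%nat \/ i = (2 * J1)%nat \/ j = 0%nat \/ j = (2 * J2)%nat).

Record scheme_solution (T : R) (P : R -> R) (f : R -> R -> R -> R)
    (u0 u1 : R -> R -> R) (J1 J2 N : nat) (U V : nat -> grid) : Prop := {
  scheme_eq1 : forall n i j, (1 <= n <= N)%nat -> interior J1 J2 i j ->
    opH J1 J2 (dtt (tstep T N) U n) i j
    + P (normF J1 J2 (V n) ^ 2) * opH J1 J2 (dtbar (tstep T N) U n) i j
    + opPhi J1 J2 (tavg V n) i j
    = opH J1 J2 (restrict T J1 J2 N f n) i j;
  scheme_eq2 : forall n i j, (1 <= n <= N)%nat -> interior J1 J2 i j ->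
    opH J1 J2 (dtbar (tstep T N) V n) i j
    = opPhi J1 J2 (dtbar (tstep T N) U n) i j;
  scheme_bc : forall n i j, (n <= N + 1)%nat -> grid_boundary J1 J2 i j ->
    U n i j = 0 /\ V n i j = 0;
  scheme_U0 : forall i j, interior J1 J2 i j ->
    U 0%nat i j = u0 (node J1 i) (node J2 j);
  scheme_U1 : forall i j, interior J1 J2 i j ->
    dt (tstep T N) U 1 i j
    = u1 (node J1 i) (node J2 j)
      + tstep T N / 2 * u2 P f u0 u1 (node J1 i) (node J2 j);
  scheme_V0 : forall i j, interior J1 J2 i j ->
    V 0%nat i j = lap u0 (node J1 i) (node J2 j);
  scheme_V1 : forall i j, interior J1 J2 i j ->
    V 1%nat i j
    = lap (fun x y => u0 x y + tstep T N * u1 x y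
                      + tstep T N ^ 2 / 2 * u2 P f u0 u1 x y)
        (node J1 i) (node J2 j) }.

Definition gsub (W Z : nat -> grid) : nat -> grid :=
  fun n i j => W n i j - Z n i j.

(* Main.v *)
Require Import Defs.
From Stdlib Require Import Reals Lra Lia Factorial List ClassicalEpsilon.
From Coquelicot Require Import Coquelicot.
Open Scope R_scope.

(** The proof is the discrete energy method.  Write H, Phi for the two spatial
    operators, e = u - U and g = v - V for the errors, and q for the centred
    time difference of e.  Both operators are nine-point stencils, symmetric on
    grid functions that vanish on the boundary, and H is positive definite
    there ([tens_sym], [stencilH_coercive]).  Test the error equation for e
    with q: the second-difference term telescopes, the damping term is
    coercive, and by symmetry of Phi together with the second scheme equation
    (Phi g~, q) = (g~, Phi q) is a telescoping difference of (H g, g).  Hence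
    the energy |delta_t e|_H^2 + (|g^{n+1}|_H^2 + |g^n|_H^2) / 2 changes in one
    step only through the defects ([energy_identity]).

    Since P >= p0 > 0, the coercive damping term absorbs everything that
    multiplies q, and the rest is handled by a Gronwall argument; no smallness
    of the time step is required ([energy_bound]).  The estimate is used twice.
    Applied to the scheme itself it bounds V ([scheme_stability]).  Applied to
    the errors it gives the theorem, provided the defects are of size
    tau^2 + h1^4 + h2^4 up to a multiple of |g| ([error_estimate]).

    The only nonlinear term is P(|V|_F^2) - P(int |Delta u|^2).  The norm F
    squared is the two-dimensional composite Simpson rule for the squared grid
    function ([normF_sq], [simpson_gsimpson]), so |v|_F^2 differs from the
    integral by O(h1^4 + h2^4) ([normF_quadrature]), while
    | |v|_F^2 - |V|_F^2 | <= C |g| because v and V are bounded ([normF_dist]).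
    As P is Lipschitz this fits the previous paragraph.

    The linear defects are Taylor expansions ([truncation]).  All derivatives
    of order at most eight are bounded, by compactness of the cylinder
    ([derivatives_jet]); the equation is used at boundary nodes and at time
    zero, where it follows by continuity ([pde_closed]).  At time zero it also
    identifies the prescribed u2 with the second time derivative of u
    ([u2_value]), so the starting values are accurate to second order in time
    ([initial_error]). *)

(** * Sums over the grid *)

Definition ssum (m : nat) (a : nat -> R) : R := sum_n_m a 1 m.

Lemma ssum_0 a : ssum 0 a = 0.
Proof. unfold ssum. rewrite sum_n_m_zero; [reflexivity | lia]. Qed.

Lemma ssum_S m a : ssum (S m) a = ssum m a + a (S m).
Proof. unfold ssum. rewrite sum_n_Sm; [reflexivity | lia]. Qed.

Lemma ssum_ext m a b :
  (forall i, (1 <= i <= m)%nat -> a i = b i) -> ssum m a = ssum m b.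
Proof. intros H. apply sum_n_m_ext_loc. exact H. Qed.

Lemma ssum_le m a b :
  (forall i, (1 <= i <= m)%nat -> a i <= b i) -> ssum m a <= ssum m b.
Proof.
  induction m as [|m IH]; intros H; [rewrite !ssum_0; lra|].
  rewrite !ssum_S. apply Rplus_le_compat; [apply IH; intros; apply H; lia | apply H; lia].
Qed.

Lemma ssum_lin m a b x y :
  ssum m (fun i => x * a i + y * b i) = x * ssum m a + y * ssum m b.
Proof.
  induction m as [|m IH]; [rewrite !ssum_0; ring|]. rewrite !ssum_S, IH. ring.
Qed.

Lemma ssum_scal m x a : ssum m (fun i => x * a i) = x * ssum m a.
Proof.
  induction m as [|m IH]; [rewrite !ssum_0; ring|]. rewrite !ssum_S, IH. ring.
Qed.

Lemma ssum_const m x : ssum m (fun _ => x) = INR m * x.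
Proof.
  induction m as [|m IH]; [rewrite !ssum_0; simpl; ring|].
  rewrite ssum_S, IH, S_INR. ring.
Qed.

Lemma ssum_swap m n (w : grid) :
  ssum m (fun i => ssum n (fun j => w i j)) = ssum n (fun j => ssum m (fun i => w i j)).
Proof.
  induction m as [|m IH].
  - rewrite ssum_0. symmetry. transitivity (ssum n (fun _ => 0)).
    + apply ssum_ext; intros; apply ssum_0.
    + rewrite ssum_const; ring.
  - rewrite ssum_S, IH. symmetry.
    transitivity (ssum n (fun j => 1 * ssum m (fun i => w i j) + 1 * w (S m) j)).
    + apply ssum_ext; intros; rewrite ssum_S; ring.
    + rewrite ssum_lin, !Rmult_1_l. reflexivity.
Qed.

Lemma ssum_shift m a : ssum m (fun i => a (i + 1)%nat) = ssum m a - a 1%nat + a (m + 1)%nat.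
Proof.
  induction m as [|m IH]; [rewrite !ssum_0; simpl; ring|].
  rewrite !ssum_S, IH. replace (S m) with (m + 1)%nat by lia. ring.
Qed.

(** Sums over odd and even nodes; listing the even nodes as 2i - 2 matches the
    indexing in the norm E, and brings in the node 0. *)
Lemma ssum_parity J a : a 0%nat = 0 -> (1 <= J)%nat ->
  ssum (2 * J - 1) a = ssum J (fun i => a (2 * i - 2)%nat + a (2 * i - 1)%nat).
Proof.
  intros H0 HJ. induction J as [|J IH]; [lia|].
  destruct J as [|J].
  - rewrite ssum_S, ssum_0. replace (2 * 1 - 1)%nat with 1%nat by lia.
    rewrite ssum_S, ssum_0. simpl. rewrite H0. ring.
  - rewrite ssum_S, <- IH by lia.
    replace (2 * S (S J) - 1)%nat with (S (S (2 * S J - 1))) by lia.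
    rewrite !ssum_S. replace (2 * S (S J) - 2)%nat with (S (2 * S J - 1)) by lia. ring.
Qed.

Definition gsum (m n : nat) (w : grid) : R := ssum m (fun i => ssum n (fun j => w i j)).

Lemma gsum_ext m n w z :
  (forall i j, (1 <= i <= m)%nat -> (1 <= j <= n)%nat -> w i j = z i j) ->
  gsum m n w = gsum m n z.
Proof. intros H. apply ssum_ext; intros. apply ssum_ext; intros. now apply H. Qed.

Lemma gsum_le m n w z :
  (forall i j, (1 <= i <= m)%nat -> (1 <= j <= n)%nat -> w i j <= z i j) ->
  gsum m n w <= gsum m n z.
Proof. intros H. apply ssum_le; intros. apply ssum_le; intros. now apply H. Qed.

Lemma gsum_lin m n w z x y :
  gsum m n (fun i j => x * w i j + y * z i j) = x * gsum m n w + y * gsum m n z.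
Proof.
  unfold gsum. rewrite <- ssum_lin. apply ssum_ext; intros. apply ssum_lin.
Qed.

Lemma gsum_const m n x : gsum m n (fun _ _ => x) = INR m * INR n * x.
Proof.
  unfold gsum. rewrite (ssum_ext m _ (fun _ => INR n * x)).
  - rewrite ssum_const. ring.
  - intros; apply ssum_const.
Qed.

Lemma gsum_swap m n w : gsum m n w = gsum n m (fun j i => w i j).
Proof. apply ssum_swap. Qed.

(** * Tensor products of tridiagonal stencils *)

Definition tri (a b : R) (w : nat -> R) (i : nat) : R :=
  a * w (i - 1)%nat + b * w i + a * w (i + 1)%nat.

(** Summation by parts: shifting the index in one sum moves the neighbour from
    one factor to the other, and the boundary terms vanish. *)
Lemma tri_sym m a b p q :
  p 0%nat = 0 -> q 0%nat = 0 -> p (m + 1)%nat = 0 -> q (m + 1)%nat = 0 ->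
  ssum m (fun i => tri a b p i * q i) = ssum m (fun i => p i * tri a b q i).
Proof.
  intros p0 q0 pm qm.
  pose proof (ssum_shift m (fun i => p i * q (i - 1)%nat)) as H1.
  pose proof (ssum_shift m (fun i => p (i - 1)%nat * q i)) as H2.
  cbv beta in H1, H2. rewrite pm in H1. rewrite qm in H2.
  change (1 - 1)%nat with 0%nat in *. rewrite q0 in H1. rewrite p0 in H2.
  transitivity (a * ssum m (fun i => p (i - 1)%nat * q i)
    + 1 * (b * ssum m (fun i => p i * q i)
    + a * ssum m (fun i => p (i + 1)%nat * q (i + 1 - 1)%nat))).
  { rewrite <- ssum_lin, <- (ssum_lin m _ _ a 1). apply ssum_ext; intros i Hi. unfold tri.
    replace (i + 1 - 1)%nat with i by lia. ring. }
  rewrite H1.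
  transitivity (a * ssum m (fun i => p i * q (i - 1)%nat)
    + 1 * (b * ssum m (fun i => p i * q i)
    + a * ssum m (fun i => p (i + 1 - 1)%nat * q (i + 1)%nat))).
  { rewrite H2. ring. }
  rewrite <- ssum_lin, <- (ssum_lin m _ _ a 1). apply ssum_ext; intros i Hi. unfold tri.
  replace (i + 1 - 1)%nat with i by lia. ring.
Qed.

(** Each interior value is counted at most twice with weight [a] and once with
    weight [b]. *)
Lemma tri_sum_le m a b p :
  0 <= a -> (forall i, 0 <= p i) -> p 0%nat = 0 -> p (m + 1)%nat = 0 ->
  ssum m (fun i => tri a b p i) <= (2 * a + b) * ssum m p.
Proof.
  intros Ha Hp p0 pm.
  destruct m as [|m]; [rewrite !ssum_0; lra|].
  pose proof (ssum_shift (S m) p) as H1.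
  pose proof (ssum_shift (S m) (fun i => p (i - 1)%nat)) as H2. cbv beta in H2.
  replace (S m + 1 - 1)%nat with (S m) in H2 by lia.
  change (1 - 1)%nat with 0%nat in *. rewrite p0 in H2. rewrite pm in H1.
  rewrite (ssum_ext _ (fun i => p (i + 1 - 1)%nat) p) in H2
    by (intros; f_equal; lia).
  transitivity (a * ssum (S m) (fun i => p (i - 1)%nat)
    + 1 * (b * ssum (S m) p + a * ssum (S m) (fun i => p (i + 1)%nat))).
  { right. rewrite <- ssum_lin, <- (ssum_lin (S m) _ _ a 1). apply ssum_ext; intros.
    unfold tri. ring. }
  rewrite H1. pose proof (Hp (S m)). pose proof (Hp 1%nat).
  assert (0 <= a * p (S m)) by now apply Rmult_le_pos.
  assert (0 <= a * p 1%nat) by now apply Rmult_le_pos.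
  nra.
Qed.

Definition tens (a b c d : R) (w : grid) : grid := fun i j =>
  tri a b (fun i' => tri c d (w i') j) i.

(** The interior indices are 1, ..., m and 1, ..., n, so the boundary ones are
    0, m + 1 and 0, n + 1. *)
Definition zbc (m n : nat) (w : grid) : Prop := forall i j,
  (i <= m + 1)%nat -> (j <= n + 1)%nat ->
  (i = 0 \/ i = m + 1 \/ j = 0 \/ j = n + 1)%nat -> w i j = 0.

(** A tensor product of symmetric operators is symmetric: move the stencil in
    the first index across, then the one in the second. *)
Lemma tens_sym m n a b c d w z : zbc m n w -> zbc m n z ->
  gsum m n (fun i j => tens a b c d w i j * z i j)
  = gsum m n (fun i j => w i j * tens a b c d z i j).
Proof.
  intros Hw Hz.
  transitivity (gsum m n (fun i j => tri c d (w i) j * tri a b (fun i' => z i' j) i)).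
  - rewrite gsum_swap. rewrite (gsum_swap m n (fun i j => tri c d (w i) j * _)).
    apply ssum_ext; intros j Hj. unfold tens.
    apply (tri_sym m a b (fun i => tri c d (w i) j) (fun i => z i j));
      unfold tri; rewrite ?(Hw 0%nat), ?(Hw (m + 1)%nat), ?(Hz 0%nat), ?(Hz (m + 1)%nat) by lia; ring.
  - apply ssum_ext; intros i Hi.
    rewrite (tri_sym n c d (w i) (fun j => tri a b (fun i' => z i' j) i));
      [| unfold tri; rewrite ?(fun k => Hw k 0%nat), ?(fun k => Hw k (n+1)%nat),
           ?(fun k => Hz k 0%nat), ?(fun k => Hz k (n+1)%nat) by lia; ring ..].
    apply ssum_ext; intros j Hj. unfold tens, tri. ring.
Qed.

Lemma tens_sum_le m n a b c d w : 0 <= a -> 0 <= b -> 0 <= c -> 0 <= d ->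
  (forall i j, 0 <= w i j) -> zbc m n w ->
  gsum m n (tens a b c d w) <= (2 * a + b) * (2 * c + d) * gsum m n w.
Proof.
  intros Ha Hb Hc Hd Hp Hw.
  transitivity ((2 * a + b) * gsum m n (fun i j => tri c d (w i) j)).
  - rewrite gsum_swap, (gsum_swap m n (fun i j => tri _ _ _ _)). unfold gsum.
    rewrite <- ssum_scal. apply ssum_le; intros j Hj. unfold tens.
    apply (tri_sum_le m a b (fun i => tri c d (w i) j)); [assumption| | |].
    + intros i; unfold tri. pose proof (Hp i (j-1)%nat). pose proof (Hp i (j+1)%nat).
      pose proof (Hp i j). repeat apply Rplus_le_le_0_compat; apply Rmult_le_pos; assumption.
    + unfold tri. rewrite !(Hw 0%nat) by lia. ring.
    + unfold tri. rewrite !(Hw (m+1)%nat) by lia. ring.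
  - rewrite Rmult_assoc. apply Rmult_le_compat_l; [lra|].
    unfold gsum. rewrite <- ssum_scal. apply ssum_le; intros i Hi.
    apply tri_sum_le; [assumption | intros; apply Hp | apply Hw; lia | apply Hw; lia].
Qed.

(** * The discrete inner product and the energy estimate *)

Definition stencilH : grid -> grid := tens (/ 12) (10 / 12) (/ 12) (10 / 12).

Definition stencilPhi (h1 h2 : R) (w : grid) : grid := fun i j =>
  tens (/ h1 ^ 2) (- 2 / h1 ^ 2) (/ 12) (10 / 12) w i j
  + tens (/ 12) (10 / 12) (/ h2 ^ 2) (- 2 / h2 ^ 2) w i j.

Definition ip (J1 J2 : nat) (w z : grid) : R :=
  step J1 * step J2 * gsum (2 * J1 - 1) (2 * J2 - 1) (fun i j => w i j * z i j).

Definition bc (J1 J2 : nat) : grid -> Prop := zbc (2 * J1 - 1) (2 * J2 - 1).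

Lemma step_pos J : (1 <= J)%nat -> 0 < step J.
Proof.
  intros H. unfold step. apply Rinv_0_lt_compat.
  apply (lt_INR 0) in H. simpl in H. lra.
Qed.

Lemma ip_ext J1 J2 w w' z z' :
  (forall i j, Defs.interior J1 J2 i j -> w i j = w' i j) ->
  (forall i j, Defs.interior J1 J2 i j -> z i j = z' i j) ->
  ip J1 J2 w z = ip J1 J2 w' z'.
Proof.
  intros H H'. unfold ip. f_equal. apply gsum_ext; intros.
  rewrite H, H' by (split; assumption). reflexivity.
Qed.

Lemma ip_sym J1 J2 w z : ip J1 J2 w z = ip J1 J2 z w.
Proof. unfold ip. f_equal. apply gsum_ext; intros; ring. Qed.

Lemma ip_lin J1 J2 w w' z x y :
  ip J1 J2 (fun i j => x * w i j + y * w' i j) z = x * ip J1 J2 w z + y * ip J1 J2 w' z.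
Proof.
  unfold ip.
  rewrite (gsum_ext _ _ _ (fun i j => x * (w i j * z i j) + y * (w' i j * z i j)))
    by (intros; ring).
  rewrite gsum_lin. ring.
Qed.

Lemma ip_lin_r J1 J2 w z z' x y :
  ip J1 J2 w (fun i j => x * z i j + y * z' i j) = x * ip J1 J2 w z + y * ip J1 J2 w z'.
Proof. now rewrite ip_sym, ip_lin, (ip_sym _ _ z), (ip_sym _ _ z'). Qed.

Lemma stencilH_lin w z x y i j :
  stencilH (fun i j => x * w i j + y * z i j) i j = x * stencilH w i j + y * stencilH z i j.
Proof. unfold stencilH, tens, tri. ring. Qed.

Lemma stencilH_sym J1 J2 w z : bc J1 J2 w -> bc J1 J2 z ->
  ip J1 J2 (stencilH w) z = ip J1 J2 w (stencilH z).
Proof. intros Hw Hz. unfold ip. f_equal. now apply tens_sym. Qed.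

Lemma stencilPhi_sym J1 J2 h1 h2 w z : bc J1 J2 w -> bc J1 J2 z ->
  ip J1 J2 (stencilPhi h1 h2 w) z = ip J1 J2 w (stencilPhi h1 h2 z).
Proof.
  intros Hw Hz.
  assert (L : forall (w w' z : grid), ip J1 J2 (fun i j => w i j + w' i j) z
     = ip J1 J2 w z + ip J1 J2 w' z).
  { intros a b c. rewrite <- (Rmult_1_l (ip J1 J2 a c)), <- (Rmult_1_l (ip J1 J2 b c)), <- ip_lin.
    apply ip_ext; intros; ring. }
  unfold stencilPhi. rewrite L, (ip_sym _ _ w), L, !(ip_sym _ _ _ w).
  unfold ip. f_equal; f_equal; now apply tens_sym.
Qed.

Lemma bc_lin J1 J2 w z x y : bc J1 J2 w -> bc J1 J2 z ->
  bc J1 J2 (fun i j => x * w i j + y * z i j).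
Proof. intros Hw Hz i j H1 H2 H. rewrite Hw, Hz by assumption. ring. Qed.

(** [dp], [dm] stand for consecutive backward time differences of the first
    unknown, [zp], [zm] for values of the second unknown two time levels
    apart.  With this choice [q] is the centred difference of the first unknown
    and [z] the time average of the second, as in the scheme. *)
Lemma energy_identity J1 J2 h1 h2 tau kappa (dp dm zp zm r s : grid) :
  0 < tau -> bc J1 J2 dp -> bc J1 J2 dm -> bc J1 J2 zp -> bc J1 J2 zm ->
  let q := fun i j => / 2 * dp i j + / 2 * dm i j in
  let z := fun i j => / 2 * zp i j + / 2 * zm i j in
  (forall i j, Defs.interior J1 J2 i j ->
    stencilH (fun i j => / tau * dp i j + - / tau * dm i j) i j + kappa * stencilH q i j
    + stencilPhi h1 h2 z i j = r i j) ->
  (forall i j, Defs.interior J1 J2 i j ->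
    stencilH (fun i j => / (2 * tau) * zp i j + - / (2 * tau) * zm i j) i j
    = stencilPhi h1 h2 q i j + s i j) ->
  ip J1 J2 (stencilH dp) dp - ip J1 J2 (stencilH dm) dm
  + / 2 * (ip J1 J2 (stencilH zp) zp - ip J1 J2 (stencilH zm) zm)
  = 2 * tau * (ip J1 J2 r q - kappa * ip J1 J2 (stencilH q) q + ip J1 J2 s z).
Proof.
  intros Ht Bdp Bdm Bzp Bzm q z E1 E2.
  assert (Bq : bc J1 J2 q) by now apply bc_lin.
  assert (Bz : bc J1 J2 z) by now apply bc_lin.
  assert (I1 : ip J1 J2 r q = / (2 * tau) * (ip J1 J2 (stencilH dp) dp - ip J1 J2 (stencilH dm) dm)
     + kappa * ip J1 J2 (stencilH q) q + ip J1 J2 (stencilPhi h1 h2 z) q).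
  { rewrite (ip_ext J1 J2 r (fun i j =>
       1 * (fun i j => 1 * stencilH (fun i j => / tau * dp i j + - / tau * dm i j) i j + kappa * stencilH q i j) i j
       + 1 * stencilPhi h1 h2 z i j) q q)
      by (intros; try rewrite <- E1 by assumption; ring).
    rewrite ip_lin, ip_lin.
    rewrite (ip_ext J1 J2 (stencilH (fun i j => / tau * dp i j + - / tau * dm i j))
       (fun i j => / tau * stencilH dp i j + - / tau * stencilH dm i j) q q)
      by (intros; rewrite ?stencilH_lin; reflexivity).
    rewrite ip_lin.
    assert (X1 : ip J1 J2 (stencilH dp) q = / 2 * ip J1 J2 (stencilH dp) dp + / 2 * ip J1 J2 (stencilH dp) dm)
      by apply ip_lin_r.
    assert (X2 : ip J1 J2 (stencilH dm) q = / 2 * ip J1 J2 (stencilH dm) dp + / 2 * ip J1 J2 (stencilH dm) dm)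
      by apply ip_lin_r.
    rewrite X1, X2, (stencilH_sym J1 J2 dp dm), (ip_sym J1 J2 dp (stencilH dm)) by assumption. field. lra. }
  assert (I2 : ip J1 J2 (stencilPhi h1 h2 q) z
     = / (4 * tau) * (ip J1 J2 (stencilH zp) zp - ip J1 J2 (stencilH zm) zm) - ip J1 J2 s z).
  { rewrite (ip_ext J1 J2 (stencilPhi h1 h2 q) (fun i j =>
       1 * (fun i j => / (2 * tau) * stencilH zp i j + - / (2 * tau) * stencilH zm i j) i j + (-1) * s i j) z z)
      by (intros; try rewrite <- stencilH_lin, E2 by assumption; ring).
    rewrite ip_lin, ip_lin.
    assert (X1 : ip J1 J2 (stencilH zp) z = / 2 * ip J1 J2 (stencilH zp) zp + / 2 * ip J1 J2 (stencilH zp) zm)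
      by apply ip_lin_r.
    assert (X2 : ip J1 J2 (stencilH zm) z = / 2 * ip J1 J2 (stencilH zm) zp + / 2 * ip J1 J2 (stencilH zm) zm)
      by apply ip_lin_r.
    rewrite X1, X2, (stencilH_sym J1 J2 zp zm), (ip_sym J1 J2 zp (stencilH zm)) by assumption. field. lra. }
  rewrite (stencilPhi_sym J1 J2 h1 h2 z q), (ip_sym J1 J2 z), I2 in I1 by assumption.
  rewrite I1. field. lra.
Qed.

Lemma ip_le J1 J2 w z w' z' : (1 <= J1)%nat -> (1 <= J2)%nat ->
  (forall i j, Defs.interior J1 J2 i j -> w i j * z i j <= w' i j * z' i j) ->
  ip J1 J2 w z <= ip J1 J2 w' z'.
Proof.
  intros H1 H2 H. unfold ip. apply Rmult_le_compat_l.
  - pose proof (step_pos J1 H1). pose proof (step_pos J2 H2). nra.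
  - apply gsum_le; intros; apply H; split; assumption.
Qed.

Lemma ip_pos J1 J2 w : (1 <= J1)%nat -> (1 <= J2)%nat -> 0 <= ip J1 J2 w w.
Proof.
  intros H1 H2. replace 0 with (ip J1 J2 (fun _ _ => 0) (fun _ _ => 0)).
  - apply ip_le; try assumption. intros. nra.
  - unfold ip. rewrite gsum_const. ring.
Qed.

Lemma ip_weighted J1 J2 e w z : (1 <= J1)%nat -> (1 <= J2)%nat -> 0 < e ->
  ip J1 J2 w z <= e * ip J1 J2 w w + / (4 * e) * ip J1 J2 z z.
Proof.
  intros H1 H2 He.
  pose proof (ip_pos J1 J2 (fun i j => (2 * e) * w i j + (-1) * z i j) H1 H2) as H.
  rewrite ip_lin, !ip_lin_r, (ip_sym _ _ z w) in H.
  apply (Rmult_le_reg_l (4 * e)); [lra|].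
  replace (4 * e * (e * ip J1 J2 w w + / (4 * e) * ip J1 J2 z z))
    with (4 * e * e * ip J1 J2 w w + ip J1 J2 z z) by (field; lra). nra.
Qed.

(** Nonnegativity of the quadratic form in two well-chosen points; the first
    case is the degenerate one where [z] has norm zero. *)
Lemma ip_CS J1 J2 w z : (1 <= J1)%nat -> (1 <= J2)%nat ->
  ip J1 J2 w z ^ 2 <= ip J1 J2 w w * ip J1 J2 z z.
Proof.
  intros H1 H2.
  assert (H : forall x y, 0 <= x ^ 2 * ip J1 J2 w w + 2 * x * y * ip J1 J2 w z + y ^ 2 * ip J1 J2 z z).
  { intros x y. pose proof (ip_pos J1 J2 (fun i j => x * w i j + y * z i j) H1 H2) as H.
    rewrite ip_lin, !ip_lin_r, (ip_sym _ _ z w) in H. nra. }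
  pose proof (ip_pos J1 J2 z H1 H2) as Hz.
  destruct (Req_dec (ip J1 J2 z z) 0) as [Z|Z].
  - rewrite Z in *. pose proof (ip_pos J1 J2 w H1 H2) as Hw.
    set (a := ip J1 J2 w w) in *. set (b := ip J1 J2 w z) in *.
    destruct (Req_dec b 0) as [B|B]; [rewrite B; lra|].
    pose proof (H (-1) ((a + 1) / (2 * b))) as K'.
    replace ((-1) ^ 2 * a + 2 * -1 * ((a + 1) / (2 * b)) * b + ((a + 1) / (2 * b)) ^ 2 * 0) with (-1) in K'
      by (field; lra). lra.
  - pose proof (H (ip J1 J2 z z) (- ip J1 J2 w z)) as K.
    set (a := ip J1 J2 w w) in *. set (b := ip J1 J2 w z) in *. set (c := ip J1 J2 z z) in *.
    assert (0 <= c * (a * c - b ^ 2)) by nra.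
    assert (0 < c) by lra.
    assert (0 <= a * c - b ^ 2); [|lra].
    apply (Rmult_le_reg_l c); lra.
Qed.

(** The total weight of the interior nodes is less than the unit area. *)
Lemma ip_sup J1 J2 w c : (1 <= J1)%nat -> (1 <= J2)%nat ->
  (forall i j, Defs.interior J1 J2 i j -> Rabs (w i j) <= c) -> ip J1 J2 w w <= c ^ 2.
Proof.
  intros H1 H2 H.
  transitivity (ip J1 J2 (fun _ _ => c) (fun _ _ => c)).
  - apply ip_le; try assumption. intros i j I. specialize (H i j I).
    rewrite <- (Rabs_pos_eq (w i j * w i j)) by nra. rewrite Rabs_mult.
    pose proof (Rabs_pos (w i j)). nra.
  - unfold ip. rewrite gsum_const.
    assert (A : forall J, (1 <= J)%nat -> 0 <= step J * INR (2 * J - 1) <= 1).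
    { intros J HJ. pose proof (step_pos J HJ) as S. split.
      - apply Rmult_le_pos; [lra | apply pos_INR].
      - replace 1 with (step J * (2 * INR J)).
        + apply Rmult_le_compat_l; [lra|]. rewrite minus_INR, mult_INR by lia. simpl. lra.
        + unfold step. apply (lt_INR 0) in HJ. simpl in HJ. field. lra. }
    pose proof (A J1 H1). pose proof (A J2 H2).
    replace (step J1 * step J2 * (INR (2 * J1 - 1) * INR (2 * J2 - 1) * (c * c)))
      with ((step J1 * INR (2 * J1 - 1)) * (step J2 * INR (2 * J2 - 1)) * c ^ 2) by ring.
    rewrite <- (Rmult_1_l (c ^ 2)) at 2. apply Rmult_le_compat_r; [apply pow2_ge_0|]. nra.
Qed.

Lemma zbc_sq m n w : zbc m n w -> zbc m n (fun i j => w i j ^ 2).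
Proof. intros H i j Hi Hj D. rewrite H by assumption. ring. Qed.

(** The weights of H are nonnegative and sum to 1, so averaging by H does not
    increase the sum of nonnegative values that vanish on the boundary. *)
Lemma stencilH_sq_sum J1 J2 w : (1 <= J1)%nat -> (1 <= J2)%nat -> bc J1 J2 w ->
  ip J1 J2 (stencilH (fun i j => w i j ^ 2)) (fun _ _ => 1) <= ip J1 J2 w w.
Proof.
  intros H1 H2 B. unfold ip. apply Rmult_le_compat_l.
  { pose proof (step_pos J1 H1). pose proof (step_pos J2 H2). nra. }
  rewrite (gsum_ext _ _ _ (stencilH (fun i j => w i j ^ 2))) by (intros; ring).
  rewrite (gsum_ext _ _ (fun i j => w i j * w i j) (fun i j => w i j ^ 2)) by (intros; ring).
  eapply Rle_trans; [apply tens_sum_le; try lra; [intros; apply pow2_ge_0 | now apply zbc_sq]|].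
  right. field.
Qed.

(** Diagonal dominance: the centre has weight 100/144 and the eight neighbours
    44/144 together.  Estimating the mixed products from below by half the
    squares gives (H w) w >= (8/9) w^2 - (1/2) H(w^2) pointwise, and summation
    leaves the constant 7/18 >= 1/3. *)
Lemma stencilH_coercive J1 J2 w : (1 <= J1)%nat -> (1 <= J2)%nat -> bc J1 J2 w ->
  / 3 * ip J1 J2 w w <= ip J1 J2 (stencilH w) w.
Proof.
  intros H1 H2 B. pose proof (stencilH_sq_sum J1 J2 w H1 H2 B) as S.
  assert (K : ip J1 J2 (fun i j => 8 / 9 * w i j ^ 2 + (- / 2) * stencilH (fun i j => w i j ^ 2) i j)
                (fun _ _ => 1) <= ip J1 J2 (stencilH w) w).
  { apply ip_le; try assumption. intros i j I. unfold stencilH, tens, tri.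
    assert (P : forall x y, - (x ^ 2 + y ^ 2) / 2 <= x * y) by (intros x y; pose proof (pow2_ge_0 (x + y)); lra).
    pose proof (P (w (i-1)%nat (j-1)%nat) (w i j)). pose proof (P (w (i-1)%nat j) (w i j)).
    pose proof (P (w (i-1)%nat (j+1)%nat) (w i j)). pose proof (P (w i (j-1)%nat) (w i j)).
    pose proof (P (w i (j+1)%nat) (w i j)). pose proof (P (w (i+1)%nat (j-1)%nat) (w i j)).
    pose proof (P (w (i+1)%nat j) (w i j)). pose proof (P (w (i+1)%nat (j+1)%nat) (w i j)).
    lra. }
  rewrite ip_lin in K.
  replace (ip J1 J2 (fun i j => w i j ^ 2) (fun _ _ => 1)) with (ip J1 J2 w w) in K.
  - pose proof (ip_pos J1 J2 w H1 H2). lra.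
  - unfold ip. f_equal. apply gsum_ext; intros; ring.
Qed.

Lemma stencilH_le J1 J2 w : (1 <= J1)%nat -> (1 <= J2)%nat -> bc J1 J2 w ->
  ip J1 J2 (stencilH w) w <= ip J1 J2 w w.
Proof.
  intros H1 H2 B. pose proof (stencilH_sq_sum J1 J2 w H1 H2 B) as S.
  assert (K : ip J1 J2 (stencilH w) w <=
     ip J1 J2 (fun i j => / 2 * w i j ^ 2 + / 2 * stencilH (fun i j => w i j ^ 2) i j) (fun _ _ => 1)).
  { apply ip_le; try assumption. intros i j I. unfold stencilH, tens, tri.
    assert (P : forall x y, x * y <= (x ^ 2 + y ^ 2) / 2) by (intros x y; pose proof (pow2_ge_0 (x - y)); lra).
    pose proof (P (w (i-1)%nat (j-1)%nat) (w i j)). pose proof (P (w (i-1)%nat j) (w i j)).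
    pose proof (P (w (i-1)%nat (j+1)%nat) (w i j)). pose proof (P (w i (j-1)%nat) (w i j)).
    pose proof (P (w i (j+1)%nat) (w i j)). pose proof (P (w (i+1)%nat (j-1)%nat) (w i j)).
    pose proof (P (w (i+1)%nat j) (w i j)). pose proof (P (w (i+1)%nat (j+1)%nat) (w i j)).
    lra. }
  rewrite ip_lin in K.
  replace (ip J1 J2 (fun i j => w i j ^ 2) (fun _ _ => 1)) with (ip J1 J2 w w) in K.
  - lra.
  - unfold ip. f_equal. apply gsum_ext; intros; ring.
Qed.

(** The increment [tau * K * b] is placed inside the growth factor because the
    exponential bound then propagates without further estimates. *)
Lemma gronwall (tau K b : R) (a : nat -> R) (N : nat) :
  0 <= tau -> 0 <= K -> 0 <= b -> 0 <= a 0%nat ->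
  (forall n, (n < N)%nat -> a (S n) <= (1 + tau * K) * (a n + tau * K * b)) ->
  forall n, (n <= N)%nat ->
    a n <= exp (INR n * tau * K) * (a 0%nat + INR n * tau * K * b).
Proof.
  intros Ht HK Hb H0 H n. assert (0 <= tau * K) by nra. assert (0 <= tau * K * b) by nra.
  induction n as [|n IH]; intros Hn.
  - simpl. rewrite !Rmult_0_l, exp_0. lra.
  - specialize (IH ltac:(lia)). specialize (H n ltac:(lia)).
    rewrite S_INR.
    replace ((INR n + 1) * tau * K) with (tau * K + INR n * tau * K) by ring.
    rewrite exp_plus. set (x := exp (INR n * tau * K)) in *.
    assert (0 <= INR n * (tau * K)) by (apply Rmult_le_pos; [apply pos_INR | assumption]).
    assert (1 <= x).
    { unfold x. pose proof (exp_ineq1_le (INR n * tau * K)). lra. }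
    pose proof (exp_ineq1_le (tau * K)) as Y.
    assert (0 <= INR n * (tau * K) * b) by (apply Rmult_le_pos; assumption).
    set (y := exp (tau * K)) in *. set (t := tau * K * b) in *.
    assert (A : a n + t <= x * (a 0%nat + INR n * tau * K * b + t)) by nra.
    replace ((tau * K + INR n * tau * K) * b) with (INR n * tau * K * b + t) by (unfold t; ring).
    transitivity ((1 + tau * K) * (x * (a 0%nat + INR n * tau * K * b + t))).
    + eapply Rle_trans; [exact H|]. apply Rmult_le_compat_l; lra.
    + rewrite (Rmult_assoc y), <- (Rplus_assoc (a 0%nat)). apply Rmult_le_compat_r; [nra | lra].
Qed.

Lemma stencilH_ext w z i j : (forall i j, w i j = z i j) -> stencilH w i j = stencilH z i j.
Proof. intros H. unfold stencilH, tens, tri. now rewrite !H. Qed.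

Lemma stencilPhi_ext h1 h2 w z i j : (forall i j, w i j = z i j) -> stencilPhi h1 h2 w i j = stencilPhi h1 h2 z i j.
Proof. intros H. unfold stencilPhi, tens, tri. now rewrite !H. Qed.

Definition energy J1 J2 tau (W Z : nat -> grid) (n : nat) : R :=
  ip J1 J2 (stencilH (dt tau W (n + 1))) (dt tau W (n + 1))
  + / 2 * (ip J1 J2 (stencilH (Z (n + 1)%nat)) (Z (n + 1)%nat) + ip J1 J2 (stencilH (Z n)) (Z n)).

(** For the errors [W] and [Z], the square of the quantity to be estimated. *)
Definition state_sq J1 J2 tau (W Z : nat -> grid) (n : nat) : R :=
  ip J1 J2 (dt tau W (n + 1)) (dt tau W (n + 1))
  + ip J1 J2 (Z (n + 1)%nat) (Z (n + 1)%nat) + ip J1 J2 (Z n) (Z n).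

(** The estimate behind both stability and convergence.  The term [lam] allows
    the first defect to depend on the second unknown itself, as the
    linearization of the damping coefficient does.  The defect [r] is paired
    with the time difference of [W] and absorbed by the damping [kappa >= p0];
    the defect [s] is paired with [Z], whose new value is put on the left-hand
    side with a weight proportional to tau / T <= 1/2.  Hence the constant
    depends on [T], [p0] and [lam] only, for every size of the time step. *)
Lemma energy_bound (T p0 lam : R) : 0 < T -> 0 < p0 -> 0 <= lam ->
  exists K, 0 < K /\
  forall (J1 J2 N : nat) (h1 h2 b : R) (W Z r s : nat -> grid) (kappa : nat -> R),
  (1 <= J1)%nat -> (1 <= J2)%nat ->
  let tau := tstep T N in
  (forall n, (n <= N + 1)%nat -> bc J1 J2 (W n) /\ bc J1 J2 (Z n)) ->
  (forall n, (1 <= n <= N)%nat -> p0 <= kappa n) ->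
  (forall n i j, (1 <= n <= N)%nat -> Defs.interior J1 J2 i j ->
     stencilH (dtt tau W n) i j + kappa n * stencilH (dtbar tau W n) i j
     + stencilPhi h1 h2 (tavg Z n) i j = r n i j /\
     stencilH (dtbar tau Z n) i j = stencilPhi h1 h2 (dtbar tau W n) i j + s n i j) ->
  (forall n, (1 <= n <= N)%nat ->
     ip J1 J2 (r n) (r n) <= lam * ip J1 J2 (Z n) (Z n) + b /\
     ip J1 J2 (s n) (s n) <= b) ->
  state_sq J1 J2 tau W Z 0 <= b ->
  forall n, (n <= N)%nat -> state_sq J1 J2 tau W Z n <= K * b.
Proof.
  intros HT Hp Hlam.
  set (A := 9 * lam / p0). set (c := 3 / (2 * p0) + 6 * T).
  set (K0 := 2 * (/ T + A) + c).
  assert (0 < / T) by now apply Rinv_0_lt_compat.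
  assert (0 < / p0) by now apply Rinv_0_lt_compat.
  assert (HA : 0 <= A) by (unfold A, Rdiv; nra).
  assert (Hc : 0 < c) by (unfold c, Rdiv; rewrite Rinv_mult; lra).
  assert (HK : 0 < K0) by (unfold K0; lra).
  exists (6 * (exp (T * K0) * (1 + T * K0))). split.
  { pose proof (exp_pos (T * K0)). assert (0 < T * K0) by nra. nra. }
  intros J1 J2 N h1 h2 b W Z r s kappa HJ1 HJ2 tau Hbc Hkap Heq Hrs Hinit.
  assert (Htau : 0 < tau /\ INR (N + 1) * tau = T).
  { unfold tau, tstep. assert (0 < INR (N + 1)) by (apply (lt_INR 0); lia). split.
    - now apply Rdiv_lt_0_compat.
    - field. lra. }
  destruct Htau as [Htau HNt].
  assert (Bd : forall n, (n <= N)%nat -> bc J1 J2 (dt tau W (n + 1))).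
  { intros n Hn i j I1 I2 I3. unfold dt.
    replace (n + 1 - 1)%nat with n by lia.
    destruct (Hbc n) as [B _]; [lia|]. destruct (Hbc (n + 1)%nat) as [B' _]; [lia|].
    rewrite B, B' by assumption. unfold Rdiv. ring. }
  assert (Hcoer : forall n, (n <= N)%nat -> state_sq J1 J2 tau W Z n <= 6 * energy J1 J2 tau W Z n
     /\ ip J1 J2 (Z n) (Z n) <= 6 * energy J1 J2 tau W Z n
     /\ ip J1 J2 (Z (n + 1)%nat) (Z (n + 1)%nat) <= 6 * energy J1 J2 tau W Z n).
  { intros n Hn. unfold state_sq, energy.
    pose proof (stencilH_coercive J1 J2 _ HJ1 HJ2 (Bd n Hn)).
    pose proof (stencilH_coercive J1 J2 _ HJ1 HJ2 (proj2 (Hbc n ltac:(lia)))).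
    pose proof (stencilH_coercive J1 J2 _ HJ1 HJ2 (proj2 (Hbc (n + 1)%nat ltac:(lia)))).
    pose proof (ip_pos J1 J2 (Z n) HJ1 HJ2). pose proof (ip_pos J1 J2 (Z (n + 1)%nat) HJ1 HJ2).
    pose proof (ip_pos J1 J2 (dt tau W (n + 1)) HJ1 HJ2). lra. }
  assert (HE0 : 0 <= energy J1 J2 tau W Z 0 <= b).
  { split.
    - destruct (Hcoer 0%nat ltac:(lia)) as [_ [P _]]. pose proof (ip_pos J1 J2 (Z 0%nat) HJ1 HJ2). lra.
    - eapply Rle_trans; [|exact Hinit]. unfold energy, state_sq.
      pose proof (stencilH_le J1 J2 _ HJ1 HJ2 (Bd 0%nat ltac:(lia))).
      pose proof (stencilH_le J1 J2 _ HJ1 HJ2 (proj2 (Hbc 0%nat ltac:(lia)))).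
      pose proof (stencilH_le J1 J2 _ HJ1 HJ2 (proj2 (Hbc (0 + 1)%nat ltac:(lia)))).
      pose proof (ip_pos J1 J2 (Z 0%nat) HJ1 HJ2). pose proof (ip_pos J1 J2 (Z (0 + 1)%nat) HJ1 HJ2).
      lra. }
  assert (Hb : 0 <= b) by lra.
  assert (Step : forall n, (n < N)%nat -> energy J1 J2 tau W Z (S n)
     <= (1 + tau * K0) * (energy J1 J2 tau W Z n + tau * K0 * b)).
  { intros n Hn.
    destruct (Hcoer n ltac:(lia)) as [_ [C1 _]].
    destruct (Hcoer (S n) ltac:(lia)) as [_ [_ C2]].
    destruct (Hcoer n ltac:(lia)) as [_ [_ C3]].
    destruct (Hrs (S n) ltac:(lia)) as [Hr Hsb].
    specialize (Hkap (S n) ltac:(lia)).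
    pose proof (energy_identity J1 J2 h1 h2 tau (kappa (S n)) (dt tau W (S n + 1)) (dt tau W (n + 1))
      (Z (S n + 1)%nat) (Z n) (r (S n)) (s (S n)) Htau (Bd (S n) ltac:(lia)) (Bd n ltac:(lia))
      (proj2 (Hbc (S n + 1)%nat ltac:(lia))) (proj2 (Hbc n ltac:(lia)))) as Id.
    cbv zeta in Id.
    set (q := fun i j => / 2 * dt tau W (S n + 1) i j + / 2 * dt tau W (n + 1) i j) in *.
    set (z := fun i j => / 2 * Z (S n + 1)%nat i j + / 2 * Z n i j) in *.
    assert (Eq : forall i j, q i j = dtbar tau W (S n) i j).
    { intros i j. unfold q, dtbar, dt. replace (S n + 1 - 1)%nat with (S n) by lia.
      replace (n + 1)%nat with (S n) by lia. field. lra. }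
    specialize (Id ltac:(intros i j I; destruct (Heq (S n) i j ltac:(lia) I) as [<- _];
      f_equal; [f_equal; [apply stencilH_ext | f_equal; apply stencilH_ext; assumption] | apply stencilPhi_ext];
      intros i' j'; unfold dtt, dt, tavg, z;
      replace (S n + 1 - 1)%nat with (S n) by lia;
      replace (n + 1)%nat with (S n) by lia; replace (S n - 1)%nat with n by lia; field; lra)).
    specialize (Id ltac:(intros i j I; destruct (Heq (S n) i j ltac:(lia) I) as [_ Y];
      rewrite (stencilPhi_ext _ _ q (dtbar tau W (S n))) by assumption; rewrite <- Y; apply stencilH_ext;
      intros i' j'; unfold dtbar; replace (S n - 1)%nat with n by lia; field; lra)).
    (* This weight leaves (p0 / 3) |q|^2, which the damping term dominates. *)
    pose proof (ip_weighted J1 J2 (3 / (4 * p0)) (r (S n)) q HJ1 HJ2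
      ltac:(apply Rdiv_lt_0_compat; lra)) as W1.
    replace (/ (4 * (3 / (4 * p0)))) with (p0 / 3) in W1 by (field; lra).
    pose proof (ip_weighted J1 J2 (3 * T) (s (S n)) z HJ1 HJ2 ltac:(lra)) as W2.
    pose proof (stencilH_coercive J1 J2 q HJ1 HJ2 ltac:(apply bc_lin; apply Bd; lia)) as Cq.
    pose proof (ip_pos J1 J2 q HJ1 HJ2) as Pq.
    assert (Nz : ip J1 J2 z z <= / 2 * ip J1 J2 (Z (S n + 1)%nat) (Z (S n + 1)%nat)
        + / 2 * ip J1 J2 (Z n) (Z n)).
    { pose proof (ip_pos J1 J2 (fun i j => 1 * Z (S n + 1)%nat i j + (-1) * Z n i j) HJ1 HJ2) as X.
      rewrite ip_lin, !ip_lin_r in X. unfold z. rewrite ip_lin, !ip_lin_r.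
      rewrite (ip_sym _ _ (Z n) (Z (S n + 1)%nat)) in *. lra. }
    assert (Zn : ip J1 J2 (Z (S n)) (Z (S n)) <= 6 * energy J1 J2 tau W Z n)
      by (replace (n + 1)%nat with (S n) in C3 by lia; exact C3).
    assert (Kq : p0 / 3 * ip J1 J2 q q <= kappa (S n) * ip J1 J2 (stencilH q) q) by nra.
    set (E1 := energy J1 J2 tau W Z (S n)) in *. set (E := energy J1 J2 tau W Z n) in *.
    assert (Id' : E1 - E = 2 * tau * (ip J1 J2 (r (S n)) q - kappa (S n) * ip J1 J2 (stencilH q) q
        + ip J1 J2 (s (S n)) z)).
    { rewrite <- Id. unfold E1, E, energy. replace (n + 1)%nat with (S n) by lia. ring. }
    assert (PE : 0 <= E) by (pose proof (ip_pos J1 J2 (Z n) HJ1 HJ2); lra).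
    assert (PE1 : 0 <= E1)
      by (pose proof (ip_pos J1 J2 (Z (S n + 1)%nat) HJ1 HJ2); lra).
    assert (Hth : tau <= T / 2).
    { rewrite <- HNt. assert (2 <= INR (N + 1)) by (apply (le_INR 2); lia). nra. }
    (* The share of the new energy that is moved to the left; at most 1/4. *)
    set (th := tau / (2 * T)).
    assert (Tth : th * (2 * T) = tau) by (unfold th; field; lra).
    assert (Hth4 : 0 <= th <= / 4) by (split; nra).
    assert (M1 : ip J1 J2 (r (S n)) q - kappa (S n) * ip J1 J2 (stencilH q) q + ip J1 J2 (s (S n)) z
       <= 3 / (4 * p0) * (lam * (6 * E) + b) + 3 * T * b + / (4 * T) * (E1 + E)).
    { assert (ip J1 J2 (r (S n)) q <= 3 / (4 * p0) * (lam * (6 * E) + b) + p0 / 3 * ip J1 J2 q q).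
      { eapply Rle_trans; [exact W1|]. apply Rplus_le_compat_r, Rmult_le_compat_l.
        - left; apply Rdiv_lt_0_compat; lra.
        - nra. }
      assert (3 * T * ip J1 J2 (s (S n)) (s (S n)) <= 3 * T * b) by nra.
      assert (/ (4 * (3 * T)) * ip J1 J2 z z <= / (4 * T) * (E1 + E)).
      { replace (/ (4 * T)) with (/ (4 * (3 * T)) * 3) by (field; lra).
        rewrite Rmult_assoc. apply Rmult_le_compat_l; [left; apply Rinv_0_lt_compat; lra | lra]. }
      lra. }
    assert (M2 : E1 - E <= tau * A * E + tau * c * b + th * (E1 + E)).
    { rewrite Id'. eapply Rle_trans; [apply Rmult_le_compat_l; [lra | exact M1]|].
      right. unfold A, c, th. field. lra. }
    assert (HthK : 2 * th = tau * / T) by (unfold th; field; lra).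
    assert (tK : tau * K0 = 4 * th + 2 * (tau * A) + tau * c) by (unfold K0; lra).
    assert (0 <= tau * A) by nra. assert (0 <= tau * c) by nra.
    assert (L : (1 - th) * E1 <= (1 - th) * ((1 + tau * K0) * (E + tau * K0 * b))).
    { transitivity ((1 + th + tau * A) * E + tau * c * b); [lra|].
      assert (X : 1 + th + tau * A <= (1 - th) * (1 + tau * K0)) by nra.
      assert (tau * c * b <= tau * K0 * b) by (apply Rmult_le_compat_r; lra).
      assert (0 <= tau * K0 * b) by (apply Rmult_le_pos; lra).
      rewrite <- Rmult_assoc. nra. }
    apply Rmult_le_reg_l in L; lra. }
  intros n Hn.
  pose proof (gronwall tau K0 b (energy J1 J2 tau W Z) N ltac:(lra) ltac:(lra) Hb (proj1 HE0) Step n Hn) as G.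
  destruct (Hcoer n ltac:(lia)) as [C _].
  eapply Rle_trans; [exact C|]. rewrite !Rmult_assoc. apply Rmult_le_compat_l; [lra|].
  eapply Rle_trans; [exact G|].
  assert (NT : 0 <= INR n * tau * K0 <= T * K0).
  { split; [apply Rmult_le_pos; [apply Rmult_le_pos; [apply pos_INR | lra] | lra]|].
    apply Rmult_le_compat_r; [lra|]. rewrite <- HNt. apply Rmult_le_compat_r; [lra|].
    apply le_INR; lia. }
  apply Rmult_le_compat.
  - left; apply exp_pos.
  - nra.
  - destruct (proj2 NT) as [X|X]; [left; now apply exp_increasing | rewrite X; lra].
  - nra.
Qed.

(** * Calculus on a closed interval *)

(** One-sided derivatives at the end points, as for the exact solution. *)
Definition der (T : R) (f f' : R -> R) : Prop := forall x, 0 <= x <= T ->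
  D_in f f' (fun z => 0 <= z <= T) x.

(** Composition with the projection onto the interval extends a function to the
    whole line while keeping it continuous, so that theorems on two-sided
    limits apply. *)
Definition clamp (T z : R) : R := Rmax 0 (Rmin T z).

Lemma clamp_in T z : 0 <= T -> 0 <= clamp T z <= T.
Proof. intros. unfold clamp, Rmax, Rmin. repeat destruct Rle_dec; lra. Qed.

Lemma clamp_id T z : 0 <= z <= T -> clamp T z = z.
Proof. intros. unfold clamp, Rmax, Rmin. repeat destruct Rle_dec; lra. Qed.

Lemma clamp_dist T x y : Rabs (clamp T x - clamp T y) <= Rabs (x - y).
Proof.
  unfold clamp, Rmax, Rmin.
  repeat destruct Rle_dec; unfold Rabs; repeat destruct Rcase_abs; lra.
Qed.

Lemma der_interior T f f' x : der T f f' -> 0 < x < T -> is_derive f x (f' x).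
Proof.
  intros H Hx. apply is_derive_Reals. intros eps Heps.
  destruct (H x ltac:(lra) eps Heps) as [al [Hal H']].
  assert (Hd : 0 < Rmin al (Rmin x (T - x))) by (repeat apply Rmin_glb_lt; lra).
  exists (mkposreal _ Hd). simpl. intros h Hh Hlt.
  assert (Rabs h < al /\ Rabs h < x /\ Rabs h < T - x) as [L1 [L2 L3]].
  { pose proof (Rmin_l al (Rmin x (T - x))). pose proof (Rmin_r al (Rmin x (T - x))).
    pose proof (Rmin_l x (T - x)). pose proof (Rmin_r x (T - x)). lra. }
  apply Rabs_def2 in L2. apply Rabs_def2 in L3.
  specialize (H' (x + h)). simpl in H'. unfold Rdist in H'.
  replace (x + h - x) with h in H' by ring. apply H'.
  repeat split; try lra.
Qed.

Lemma der_clamp_continuous T f f' : 0 <= T -> der T f f' ->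
  forall x, continuity_pt (fun z => f (clamp T z)) x.
Proof.
  intros HT H x eps Heps.
  destruct (cont_deriv _ _ _ _ (H (clamp T x) (clamp_in T x HT)) eps Heps) as [al [Hal H']].
  exists al. split; [assumption|]. intros z [_ Hz]. simpl in *. unfold Rdist in *.
  destruct (Req_dec (clamp T x) (clamp T z)) as [E|E].
  - rewrite E, Rminus_diag, Rabs_R0. exact Heps.
  - apply (H' (clamp T z)). split.
    + split; [now apply clamp_in | assumption].
    + eapply Rle_lt_trans; [apply clamp_dist | exact Hz].
Qed.

Lemma der_mvt T f f' x y : der T f f' -> 0 <= x <= T -> 0 <= y <= T ->
  exists c, Rmin x y <= c <= Rmax x y /\ f y - f x = f' c * (y - x).
Proof.
  intros H Hx Hy.
  destruct (MVT_gen (fun z => f (clamp T z)) x y f') as [c [Hc E]].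
  - intros z Hz.
    assert (0 < z < T) by (unfold Rmin, Rmax in Hz; repeat destruct Rle_dec in Hz; lra).
    apply (is_derive_ext_loc f); [|now apply (der_interior T)].
    assert (Hd : 0 < Rmin z (T - z)) by (apply Rmin_glb_lt; lra).
    exists (mkposreal _ Hd). intros t Ht. apply Rabs_def2 in Ht. simpl in Ht.
    unfold minus, plus, opp in Ht; simpl in Ht.
    pose proof (Rmin_l z (T - z)). pose proof (Rmin_r z (T - z)).
    rewrite clamp_id; [reflexivity | lra].
  - intros z _. apply (der_clamp_continuous T f f'); [lra | assumption].
  - exists c. split; [exact Hc|]. now rewrite !clamp_id in E by assumption.
Qed.

Lemma between_in T x y c : 0 <= x <= T -> 0 <= y <= T -> Rmin x y <= c <= Rmax x y ->
  0 <= c <= T /\ Rabs (c - x) <= Rabs (y - x).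
Proof.
  intros Hx Hy. unfold Rmin, Rmax. destruct Rle_dec; intros Hc; (split; [lra|]);
  unfold Rabs; repeat destruct Rcase_abs; lra.
Qed.

Lemma der_lip T f f' M x y : der T f f' -> (forall z, 0 <= z <= T -> Rabs (f' z) <= M) ->
  0 <= x <= T -> 0 <= y <= T -> Rabs (f y - f x) <= M * Rabs (y - x).
Proof.
  intros H HM Hx Hy. destruct (der_mvt T f f' x y H Hx Hy) as [c [Hc E]].
  rewrite E, Rabs_mult. apply Rmult_le_compat_r; [apply Rabs_pos|].
  apply HM. now apply (between_in T x y).
Qed.

Lemma der_lin T f f' g g' a b : der T f f' -> der T g g' ->
  der T (fun x => a * f x + b * g x) (fun x => a * f' x + b * g' x).
Proof. intros Hf Hg x Hx. apply Dadd; apply Dmult_const; auto. Qed.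

Lemma der_mult T f f' g g' : der T f f' -> der T g g' ->
  der T (fun x => f x * g x) (fun x => f' x * g x + f x * g' x).
Proof. intros Hf Hg x Hx. apply Dmult; auto. Qed.

Lemma der_is T f f' : (forall x, 0 <= x <= T -> is_derive f x (f' x)) -> der T f f'.
Proof.
  intros H x Hx. apply (D_in_imp _ _ no_cond); [intros; exact I|].
  apply derivable_pt_lim_D_in, is_derive_Reals. now apply H.
Qed.

Lemma der_ext T f f' g g' : (forall x, 0 <= x <= T -> f x = g x) ->
  (forall x, 0 <= x <= T -> f' x = g' x) -> der T f f' -> der T g g'.
Proof.
  intros Hf Hf' H x Hx eps Heps. destruct (H x Hx eps Heps) as [al [Hal L]].
  exists al. split; [assumption|]. intros z [[D1 D2] Hz].
  rewrite <- Hf, <- Hf, <- Hf' by assumption. apply L. repeat split; tauto.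
Qed.

Lemma der_ssum T m (f f' : nat -> R -> R) : (forall i, der T (f i) (f' i)) ->
  der T (fun x => ssum m (fun i => f i x)) (fun x => ssum m (fun i => f' i x)).
Proof.
  intros H. induction m as [|m IH].
  - apply (der_ext T (fun _ => 0) (fun _ => 0)); try (intros; now rewrite ssum_0).
    apply der_is. intros. auto_derive; trivial.
  - apply (der_ext T (fun x => 1 * ssum m (fun i => f i x) + 1 * f (S m) x)
      (fun x => 1 * ssum m (fun i => f' i x) + 1 * f' (S m) x));
      try (intros; rewrite ssum_S; ring).
    now apply der_lin.
Qed.

(** * Taylor's formula with a crude remainder *)

Definition chain (T : R) (n : nat) (F : nat -> R -> R) : Prop :=
  forall k, (k < n)%nat -> der T (F k) (F (S k)).

Definition tpoly (F : nat -> R -> R) (n : nat) (x0 x : R) : R :=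
  sum_f_R0 (fun k => F k x0 / INR (fact k) * (x - x0) ^ k) n.

Lemma is_derive_monomial c m x0 x :
  is_derive (fun x => c * (x - x0) ^ S m) x (c * (INR (S m) * (x - x0) ^ m)).
Proof.
  apply is_derive_Reals.
  pose proof (derivable_pt_lim_scal _ c x _
    (derivable_pt_lim_comp _ _ x _ _
      (derivable_pt_lim_minus _ _ x _ _ (derivable_pt_lim_id x) (derivable_pt_lim_const x0 x))
      (derivable_pt_lim_pow (x - x0) (S m)))) as H.
  replace (c * (INR (S m) * (x - x0) ^ m)) with
    (c * (INR (S m) * (x - x0) ^ pred (S m) * (1 - 0))) by (simpl pred; ring).
  exact H.
Qed.

Lemma tpoly_derive F n x0 x :
  is_derive (tpoly F (S n) x0) x (tpoly (fun k => F (S k)) n x0 x).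
Proof.
  induction n as [|n IH].
  - unfold tpoly. simpl. auto_derive; [trivial|]. field.
  - apply (is_derive_ext (fun x => tpoly F (S n) x0 x
       + F (S (S n)) x0 / INR (fact (S (S n))) * (x - x0) ^ (S (S n)))).
    { intros t. reflexivity. }
    change (tpoly (fun k => F (S k)) (S n) x0 x) with
      (plus (tpoly (fun k => F (S k)) n x0 x)
        (F (S (S n)) x0 / INR (fact (S n)) * (x - x0) ^ S n)).
    apply (is_derive_plus (V := R_NormedModule)); [exact IH|].
    replace (F (S (S n)) x0 / INR (fact (S n)) * (x - x0) ^ S n) with
      (F (S (S n)) x0 / INR (fact (S (S n))) * (INR (S (S n)) * (x - x0) ^ S n)).
    + apply is_derive_monomial.
    + rewrite (fact_simpl (S n)), mult_INR. field. split; [apply INR_fact_neq_0|].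
      apply not_0_INR. lia.
Qed.

Lemma tpoly_self F n x : tpoly F n x x = F 0%nat x.
Proof.
  unfold tpoly. induction n as [|n IH]; [simpl; field|].
  change (sum_f_R0 (fun k => F k x / INR (fact k) * (x - x) ^ k) (S n)) with
    (sum_f_R0 (fun k => F k x / INR (fact k) * (x - x) ^ k) n
     + F (S n) x / INR (fact (S n)) * (x - x) ^ (S n)).
  rewrite IH, Rminus_diag, pow_i by lia. ring.
Qed.

(** Induction on the order: the derivative of the remainder is the remainder of
    the derivative, and the mean value theorem costs one factor |x - x0|.  The
    factorial in the classical bound is lost, but only the power matters. *)
Lemma taylor T n F M x0 x : chain T (S n) F ->
  (forall z, 0 <= z <= T -> Rabs (F (S n) z) <= M) -> 0 <= x0 <= T -> 0 <= x <= T ->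
  Rabs (F 0%nat x - tpoly F n x0 x) <= M * Rabs (x - x0) ^ S n.
Proof.
  revert F x. induction n as [|n IH]; intros F x HF HM Hx0 Hx.
  - unfold tpoly. simpl.
    replace (F 0%nat x - F 0%nat x0 / 1 * 1) with (F 0%nat x - F 0%nat x0) by field.
    rewrite Rmult_1_r. apply (der_lip T _ (F 1%nat)); auto.
  - set (phi := fun y => 1 * F 0%nat y + (-1) * tpoly F (S n) x0 y).
    assert (Hd : der T phi (fun y => 1 * F 1%nat y + (-1) * tpoly (fun k => F (S k)) n x0 y)).
    { apply der_lin; [apply HF; lia|]. apply der_is. intros; apply tpoly_derive. }
    destruct (der_mvt T phi _ x0 x Hd Hx0 Hx) as [c [Hc E]].
    destruct (between_in T x0 x c Hx0 Hx Hc) as [Hc' Hcx].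
    assert (B : Rabs (F 1%nat c - tpoly (fun k => F (S k)) n x0 c) <= M * Rabs (c - x0) ^ S n).
    { apply (IH (fun k => F (S k))); auto. intros k Hk. apply HF. lia. }
    assert (E' : F 0%nat x - tpoly F (S n) x0 x
      = (F 1%nat c - tpoly (fun k => F (S k)) n x0 c) * (x - x0)).
    { unfold phi in E. rewrite tpoly_self in E. lra. }
    rewrite E', Rabs_mult.
    change (Rabs (x - x0) ^ S (S n)) with (Rabs (x - x0) * Rabs (x - x0) ^ S n).
    rewrite (Rmult_comm (Rabs (x - x0)) (_ ^ _)), <- Rmult_assoc.
    apply Rmult_le_compat_r; [apply Rabs_pos|].
    eapply Rle_trans; [exact B|]. apply Rmult_le_compat_l.
    + pose proof (HM x0 Hx0). pose proof (Rabs_pos (F (S (S n)) x0)). lra.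
    + apply pow_incr. split; [apply Rabs_pos | assumption].
Qed.

Lemma fact_values : INR (fact 0) = 1 /\ INR (fact 1) = 1 /\ INR (fact 2) = 2 /\
  INR (fact 3) = 6 /\ INR (fact 4) = 24 /\ INR (fact 5) = 120.
Proof. rewrite !INR_IZR_INZ. repeat split. Qed.

Ltac unfold_taylor H :=
  let A := fresh in
  unfold tpoly in H; cbn [sum_f_R0] in H;
  destruct fact_values as [A [? [? [? [? ?]]]]];
  repeat match goal with E : INR (fact _) = _ |- _ => rewrite E in H; clear E end;
  cbn [pow] in H.

(** The compact scheme is fourth-order accurate: by Taylor expansion the second
    difference is F'' + (h^2 / 12) F'''' + O(h^4), and so is the weighted
    average of F'' with weights 1/12, 10/12, 1/12. *)
Lemma compact_consistency F M a h : chain 1 6 F ->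
  (forall z, 0 <= z <= 1 -> Rabs (F 6%nat z) <= M) ->
  0 < h -> 0 <= a - h -> a + h <= 1 ->
  Rabs ((F 0%nat (a + h) - 2 * F 0%nat a + F 0%nat (a - h)) / h ^ 2
        - / 12 * (F 2%nat (a + h) + 10 * F 2%nat a + F 2%nat (a - h))) <= 3 * M * h ^ 4.
Proof.
  intros HF HM Hh Ha1 Ha2.
  pose proof (taylor 1 5 F M a (a + h) HF HM ltac:(lra) ltac:(lra)) as T1.
  pose proof (taylor 1 5 F M a (a - h) HF HM ltac:(lra) ltac:(lra)) as T2.
  assert (HF2 : chain 1 4 (fun k => F (S (S k)))) by (intros k Hk; apply HF; lia).
  pose proof (taylor 1 3 _ M a (a + h) HF2 HM ltac:(lra) ltac:(lra)) as T3.
  pose proof (taylor 1 3 _ M a (a - h) HF2 HM ltac:(lra) ltac:(lra)) as T4.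
  replace (a + h - a) with h in * by ring. replace (a - h - a) with (- h) in * by ring.
  rewrite Rabs_Ropp in *. rewrite (Rabs_pos_eq h) in * by lra.
  unfold_taylor T1. unfold_taylor T2. unfold_taylor T3. unfold_taylor T4.
  set (r1 := F 0%nat (a + h) - _) in *. set (r2 := F 0%nat (a - h) - _) in *.
  set (r3 := F 2%nat (a + h) - _) in *. set (r4 := F 2%nat (a - h) - _) in *.
  replace (_ - _) with ((r1 + r2) * / h ^ 2 - (r3 + r4) / 12)
    by (unfold r1, r2, r3, r4; field; lra).
  assert (B : Rabs ((r1 + r2) * / h ^ 2) <= 2 * M * h ^ 4).
  { rewrite Rabs_mult, (Rabs_pos_eq (/ h ^ 2)) by (left; apply Rinv_0_lt_compat; nra).
    replace (2 * M * h ^ 4) with ((M * h ^ 6 + M * h ^ 6) * / h ^ 2) by (field; lra).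
    apply Rmult_le_compat_r; [left; apply Rinv_0_lt_compat; nra|].
    eapply Rle_trans; [apply Rabs_triang|]. simpl. lra. }
  assert (Hm : 0 <= M * h ^ 4).
  { apply Rmult_le_pos; [|apply pow_le; lra].
    pose proof (HM a ltac:(lra)). pose proof (Rabs_pos (F 6%nat a)). lra. }
  apply Rabs_le_between in B. apply Rabs_le_between in T3. apply Rabs_le_between in T4.
  apply Rabs_le_between. simpl in *. lra.
Qed.

(** Here [F 0] is an antiderivative of the integrand [F 1]. *)
Lemma simpson_panel F M a h : chain 1 5 F ->
  (forall z, 0 <= z <= 1 -> Rabs (F 5%nat z) <= M) ->
  0 < h -> 0 <= a - h -> a + h <= 1 ->
  Rabs (F 0%nat (a + h) - F 0%nat (a - h)
        - h / 3 * (F 1%nat (a - h) + 4 * F 1%nat a + F 1%nat (a + h))) <= 3 * M * h ^ 5.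
Proof.
  intros HF HM Hh Ha1 Ha2.
  pose proof (taylor 1 4 F M a (a + h) HF HM ltac:(lra) ltac:(lra)) as T1.
  pose proof (taylor 1 4 F M a (a - h) HF HM ltac:(lra) ltac:(lra)) as T2.
  assert (HF2 : chain 1 4 (fun k => F (S k))) by (intros k Hk; apply HF; lia).
  pose proof (taylor 1 3 _ M a (a + h) HF2 HM ltac:(lra) ltac:(lra)) as T3.
  pose proof (taylor 1 3 _ M a (a - h) HF2 HM ltac:(lra) ltac:(lra)) as T4.
  replace (a + h - a) with h in * by ring. replace (a - h - a) with (- h) in * by ring.
  rewrite Rabs_Ropp in *. rewrite (Rabs_pos_eq h) in * by lra.
  unfold_taylor T1. unfold_taylor T2. unfold_taylor T3. unfold_taylor T4.
  set (r1 := F 0%nat (a + h) - _) in *. set (r2 := F 0%nat (a - h) - _) in *.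
  set (r3 := F 1%nat (a + h) - _) in *. set (r4 := F 1%nat (a - h) - _) in *.
  replace (_ - _) with (r1 - r2 - h / 3 * (r3 + r4))
    by (unfold r1, r2, r3, r4; field; lra).
  assert (B : Rabs (h / 3 * (r3 + r4)) <= 2 / 3 * (M * h ^ 5)).
  { rewrite Rabs_mult, (Rabs_pos_eq (h / 3)) by lra.
    replace (2 / 3 * (M * h ^ 5)) with (h / 3 * (M * h ^ 4 + M * h ^ 4)) by field.
    apply Rmult_le_compat_l; [lra|].
    eapply Rle_trans; [apply Rabs_triang|]. simpl. lra. }
  assert (Hm : 0 <= M * h ^ 5).
  { apply Rmult_le_pos; [|apply pow_le; lra].
    pose proof (HM a ltac:(lra)). pose proof (Rabs_pos (F 5%nat a)). lra. }
  apply Rabs_le_between in B. apply Rabs_le_between in T1. apply Rabs_le_between in T2.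
  apply Rabs_le_between. simpl in *. lra.
Qed.

(** * Simpson's rule in one and two dimensions *)

Lemma der_antiderivative T f f' : 0 <= T -> der T f f' ->
  (forall x, 0 <= x <= T -> ex_RInt f 0 x) /\ der T (fun x => RInt f 0 x) f.
Proof.
  intros HT H.
  assert (C : forall x, continuous (fun z => f (clamp T z)) x).
  { intros x. apply continuity_pt_filterlim. now apply (der_clamp_continuous T f f'). }
  assert (Ex : forall x, ex_RInt (fun z => f (clamp T z)) 0 x)
    by (intros; apply (ex_RInt_continuous (V := R_CompleteNormedModule)); intros; apply C).
  assert (Eq : forall x, 0 <= x <= T -> forall z, Rmin 0 x < z < Rmax 0 x -> f (clamp T z) = f z).
  { intros x Hx z Hz. rewrite Rmin_left, Rmax_right in Hz by lra. rewrite clamp_id; [reflexivity|lra]. }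
  split.
  - intros x Hx. apply (ex_RInt_ext (fun z => f (clamp T z))); [now apply Eq | apply Ex].
  - apply (der_ext T (fun x => RInt (fun z => f (clamp T z)) 0 x) (fun z => f (clamp T z))).
    + intros x Hx. apply RInt_ext. now apply Eq.
    + intros x Hx. now rewrite clamp_id.
    + apply der_is. intros x Hx.
      apply (is_derive_RInt (fun z => f (clamp T z)) _ 0); [|apply C].
      apply filter_forall. intros y. apply (RInt_correct (V := R_CompleteNormedModule)), Ex.
Qed.

Lemma node_bound J k : (1 <= J)%nat -> (k <= 2 * J)%nat -> 0 <= node J k <= 1.
Proof.
  intros HJ Hk. unfold node, step. assert (0 < INR J) by (apply (lt_INR 0); lia).
  apply le_INR in Hk. rewrite mult_INR in Hk. simpl in Hk. pose proof (pos_INR k).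
  split.
  - apply Rmult_le_pos; [lra | left; apply Rinv_0_lt_compat; lra].
  - apply (Rmult_le_reg_r (2 * INR J)); [lra|]. rewrite Rmult_assoc, Rinv_l by lra. lra.
Qed.

Lemma node_S J k : node J (k + 1) = node J k + step J.
Proof. unfold node. rewrite plus_INR. simpl. ring. Qed.

Lemma node_0 J : node J 0 = 0.
Proof. unfold node. simpl. ring. Qed.

Lemma node_end J : (1 <= J)%nat -> node J (2 * J) = 1.
Proof.
  intros HJ. unfold node, step. rewrite mult_INR. simpl.
  assert (0 < INR J) by (apply (lt_INR 0); lia). field. lra.
Qed.

(** The composite rule for functions that vanish at both ends: the weights
    1, 4, 1 of each panel add up to 2 at interior even nodes and 4 at odd ones,
    and half of this, the weights 1 and 2, is summed. *)
Definition simpson (J : nat) (g : R -> R) : R :=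
  2 * step J / 3 * ssum J (fun i => g (node J (2 * i - 2)) + 2 * g (node J (2 * i - 1))).

(** Panel errors O(h^5) add up over 1/(2h) panels. *)
Lemma simpson_error J (F : nat -> R -> R) M : (1 <= J)%nat -> chain 1 4 F ->
  (forall z, 0 <= z <= 1 -> Rabs (F 4%nat z) <= M) ->
  F 0%nat 0 = 0 -> F 0%nat 1 = 0 ->
  Rabs (RInt (F 0%nat) 0 1 - simpson J (F 0%nat)) <= 2 * M * step J ^ 4.
Proof.
  intros HJ HF HM F0 F1.
  pose proof (step_pos J HJ) as Hh. set (h := step J) in *.
  destruct (der_antiderivative 1 (F 0%nat) (F 1%nat) ltac:(lra) (HF 0%nat ltac:(lia))) as [_ HG].
  (* Prepend an antiderivative to the derivatives of the integrand. *)
  set (G := fun k : nat => match k with O => fun x => (RInt (F 0%nat) 0 x : R) | S k => F k end).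
  assert (CG : chain 1 5 G).
  { intros [|k] Hk; simpl; [exact HG | apply HF; lia]. }
  (* Induction over panels.  The last node of the partial rule has half the
     weight of an interior even node. *)
  assert (K : forall k, (k <= J)%nat ->
    Rabs (G 0%nat (node J (2 * k)) - h / 3 * (2 * ssum k (fun i => F 0%nat (node J (2 * i - 2))
       + 2 * F 0%nat (node J (2 * i - 1))) + F 0%nat (node J (2 * k)))) <= INR k * (3 * M * h ^ 5)).
  { induction k as [|k IH]; intros Hk.
    - rewrite ssum_0. simpl (2 * 0)%nat. rewrite node_0, F0. simpl. rewrite RInt_point.
      unfold zero; simpl. replace (0 - _) with 0 by ring. rewrite Rabs_R0. lra.
    - specialize (IH ltac:(lia)).
      pose proof (simpson_panel G M (node J (2 * k + 1)) h CG HM Hh) as SP.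
      rewrite ssum_S. replace (2 * S k - 2)%nat with (2 * k)%nat by lia.
      replace (2 * S k - 1)%nat with (2 * k + 1)%nat by lia.
      replace (2 * S k)%nat with (2 * k + 1 + 1)%nat by lia.
      replace (node J (2 * k + 1) - h) with (node J (2 * k)) in SP
        by (rewrite node_S; unfold h; ring).
      rewrite (node_S J (2 * k + 1)). fold h.
      specialize (SP ltac:(apply node_bound; lia)).
      specialize (SP ltac:(unfold h; rewrite <- node_S; apply node_bound; lia)).
      change (G 1%nat) with (F 0%nat) in SP.
      set (A := ssum k _) in *. rewrite S_INR.
      replace (_ - _) with
        ((G 0%nat (node J (2 * k)) - h / 3 * (2 * A + F 0%nat (node J (2 * k)))) +
         (G 0%nat (node J (2 * k + 1) + h) - G 0%nat (node J (2 * k)) -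
          h / 3 * (F 0%nat (node J (2 * k)) + 4 * F 0%nat (node J (2 * k + 1)) +
              F 0%nat (node J (2 * k + 1) + h)))) by field.
      eapply Rle_trans; [apply Rabs_triang|]. lra. }
  specialize (K J ltac:(lia)). rewrite node_end, F1, Rplus_0_r in K by assumption.
  unfold simpson. fold h. unfold G in K.
  replace (2 * h / 3 * ssum J _) with (h / 3 * (2 * ssum J (fun i => F 0%nat (node J (2 * i - 2))
       + 2 * F 0%nat (node J (2 * i - 1))))) by field.
  eapply Rle_trans; [exact K|].
  assert (HJ' : INR J * h = / 2).
  { unfold h, step. assert (0 < INR J) by (apply (lt_INR 0); lia). field. lra. }
  replace (INR J * (3 * M * h ^ 5)) with (INR J * h * (3 * M * h ^ 4)) by ring. rewrite HJ'.
  assert (0 <= M * h ^ 4).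
  { apply Rmult_le_pos; [|apply pow_le; lra].
    pose proof (HM 0 ltac:(lra)). pose proof (Rabs_pos (F 4%nat 0)). lra. }
  lra.
Qed.

(** The weights are nonnegative with sum 1. *)
Lemma simpson_bound J g M : (1 <= J)%nat -> (forall z, 0 <= z <= 1 -> Rabs (g z) <= M) ->
  Rabs (simpson J g) <= M.
Proof.
  intros HJ H. pose proof (step_pos J HJ) as Hh.
  assert (B : - (INR J * (3 * M)) <= ssum J (fun i => g (node J (2 * i - 2)) + 2 * g (node J (2 * i - 1)))
    <= INR J * (3 * M)).
  { split.
    - rewrite <- Ropp_mult_distr_r_reverse, <- ssum_const. apply ssum_le. intros i Hi.
      pose proof (H _ (node_bound J (2 * i - 2) HJ ltac:(lia))) as A1.
      pose proof (H _ (node_bound J (2 * i - 1) HJ ltac:(lia))) as A2.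
      apply Rabs_le_between in A1, A2. lra.
    - rewrite <- ssum_const. apply ssum_le. intros i Hi.
      pose proof (H _ (node_bound J (2 * i - 2) HJ ltac:(lia))) as A1.
      pose proof (H _ (node_bound J (2 * i - 1) HJ ltac:(lia))) as A2.
      apply Rabs_le_between in A1, A2. lra. }
  unfold simpson. set (A := ssum J _) in *.
  assert (HJ' : INR J * step J = / 2).
  { unfold step. assert (0 < INR J) by (apply (lt_INR 0); lia). field. lra. }
  apply Rabs_le_between.
  assert (E : M = 2 * step J / 3 * (INR J * (3 * M))) by (transitivity (2 * (INR J * step J) * M); [rewrite HJ'; field | field]).
  rewrite E at 1. rewrite E at 2. rewrite <- Ropp_mult_distr_r_reverse.
  split; apply Rmult_le_compat_l; lra.
Qed.

Lemma ex_RInt_lip f K :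
  (forall x y, 0 <= x <= 1 -> 0 <= y <= 1 -> Rabs (f y - f x) <= K * Rabs (y - x)) ->
  ex_RInt f 0 1.
Proof.
  intros H. apply (ex_RInt_ext (fun z => f (clamp 1 z))).
  { intros x Hx. rewrite Rmin_left, Rmax_right in Hx by lra. rewrite clamp_id; [reflexivity | lra]. }
  apply (ex_RInt_continuous (V := R_CompleteNormedModule)). intros x _.
  apply continuity_pt_filterlim. intros eps Heps.
  assert (HK : 0 <= K).
  { pose proof (H 0 1 ltac:(lra) ltac:(lra)) as L. pose proof (Rabs_pos (f 1 - f 0)).
    replace (1 - 0) with 1 in L by ring. rewrite Rabs_R1 in L. lra. }
  exists (eps / (K + 1)). split; [apply Rdiv_lt_0_compat; lra|].
  intros z [_ Hz]. simpl in *. unfold Rdist in *.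
  eapply Rle_lt_trans; [apply H; apply clamp_in; lra|].
  pose proof (clamp_dist 1 z x) as C.
  assert (E : eps = (K + 1) * (eps / (K + 1))) by (field; lra).
  rewrite E. pose proof (Rabs_pos (clamp 1 z - clamp 1 x)). nra.
Qed.

(** Enough regularity for the iterated integral: continuity in [y] for the inner
    integral, a Lipschitz bound in [x] for the outer one. *)
Definition slices (g gx gy : R -> R -> R) (K : R) : Prop :=
  (forall y, 0 <= y <= 1 -> der 1 (fun x => g x y) (fun x => gx x y)) /\
  (forall x, 0 <= x <= 1 -> der 1 (g x) (gy x)) /\
  (forall x y, 0 <= x <= 1 -> 0 <= y <= 1 -> Rabs (gx x y) <= K).

Lemma RInt_dist f g e : ex_RInt f 0 1 -> ex_RInt g 0 1 ->
  (forall x, 0 <= x <= 1 -> Rabs (f x - g x) <= e) -> Rabs (RInt f 0 1 - RInt g 0 1) <= e.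
Proof.
  intros Hf Hg H.
  pose proof (RInt_minus (V := R_CompleteNormedModule) f g 0 1 Hf Hg) as E.
  change (RInt f 0 1 - RInt g 0 1) with (minus (RInt f 0 1) (RInt g 0 1)). rewrite <- E.
  replace e with ((1 - 0) * e) by ring.
  apply abs_RInt_le_const; [lra | | exact H].
  apply (ex_RInt_minus (V := R_NormedModule)); assumption.
Qed.

Lemma slices_RInt g gx gy K : slices g gx gy K ->
  (forall x, 0 <= x <= 1 -> ex_RInt (g x) 0 1) /\ ex_RInt (fun x => RInt (g x) 0 1) 0 1.
Proof.
  intros [Hx [Hy HK]].
  assert (E : forall x, 0 <= x <= 1 -> ex_RInt (g x) 0 1).
  { intros x Ix. apply (proj1 (der_antiderivative 1 (g x) (gy x) ltac:(lra) (Hy x Ix)) 1). lra. }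
  split; [exact E|]. apply (ex_RInt_lip _ K). intros x x' Ix Ix'.
  apply RInt_dist; auto. intros y Iy.
  apply (der_lip 1 (fun x => g x y) (fun x => gx x y)); auto.
Qed.

Lemma int_Gamma_dist g gx gy K g' gx' gy' K' e : slices g gx gy K -> slices g' gx' gy' K' ->
  (forall x y, 0 <= x <= 1 -> 0 <= y <= 1 -> Rabs (g x y - g' x y) <= e) ->
  Rabs (int_Gamma g - int_Gamma g') <= e.
Proof.
  intros S S' H. destruct (slices_RInt _ _ _ _ S) as [A B]. destruct (slices_RInt _ _ _ _ S') as [A' B'].
  apply RInt_dist; auto. intros x Hx. apply RInt_dist; auto.
Qed.

Lemma der_simpson J (f f' : R -> R -> R) : (1 <= J)%nat ->
  (forall y, 0 <= y <= 1 -> der 1 (fun x => f x y) (fun x => f' x y)) ->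
  der 1 (fun x => simpson J (f x)) (fun x => simpson J (f' x)).
Proof.
  intros HJ H. unfold simpson.
  (* Truncated indices keep the nodes in [0, 1] for every [i]; they agree with
     the original ones in the range of summation. *)
  set (on := fun i => (Nat.min (2 * i - 1) (2 * J))%nat).
  set (en := fun i => (Nat.min (2 * i - 2) (2 * J))%nat).
  assert (Ho : forall i, 0 <= node J (on i) <= 1) by (intros; apply node_bound; unfold on; lia).
  assert (He : forall i, 0 <= node J (en i) <= 1) by (intros; apply node_bound; unfold en; lia).
  set (c := 2 * step J / 3).
  apply (der_ext 1
    (fun x => c * ssum J (fun i => 1 * f x (node J (en i)) + 2 * f x (node J (on i))) + 0 * 0)
    (fun x => c * ssum J (fun i => 1 * f' x (node J (en i)) + 2 * f' x (node J (on i))) + 0 * 0)).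
  1, 2: intros x Hx; rewrite Rmult_0_l, Rplus_0_r; f_equal; apply ssum_ext; intros i Hi;
    unfold on, en; rewrite !Nat.min_l by lia; ring.
  apply (der_lin 1 _ _ (fun _ => 0) (fun _ => 0)).
  - apply (der_ssum 1 J (fun i x => 1 * f x (node J (en i)) + 2 * f x (node J (on i)))
      (fun i x => 1 * f' x (node J (en i)) + 2 * f' x (node J (on i)))).
    intros i. apply (der_lin 1 (fun x => f x (node J (en i))) _ (fun x => f x (node J (on i)))); auto.
  - apply der_is. intros. auto_derive; trivial.
Qed.

(** Replace the inner integral by its quadrature, then apply the rule in the
    other variable to that quadrature, whose derivatives are bounded because
    the weights sum to 1.  [X] and [Y] list the derivatives in [x] and in [y]
    of the same function. *)
Lemma simpson2_error J1 J2 (X Y : nat -> R -> R -> R) M : (1 <= J1)%nat -> (1 <= J2)%nat ->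
  (forall x y, Y 0%nat x y = X 0%nat x y) ->
  (forall y, 0 <= y <= 1 -> chain 1 4 (fun k x => X k x y)) ->
  (forall x, 0 <= x <= 1 -> chain 1 4 (fun k y => Y k x y)) ->
  (forall x y, 0 <= x <= 1 -> 0 <= y <= 1 ->
     Rabs (X 1%nat x y) <= M /\ Rabs (X 4%nat x y) <= M /\ Rabs (Y 4%nat x y) <= M) ->
  (forall x y, on_boundary x y -> X 0%nat x y = 0) ->
  Rabs (int_Gamma (X 0%nat) - simpson J1 (fun x => simpson J2 (fun y => X 0%nat x y)))
    <= 2 * M * (step J1 ^ 4 + step J2 ^ 4).
Proof.
  intros H1 H2 YX CX CY HM HB.
  assert (HY : forall x, 0 <= x <= 1 -> chain 1 4 (fun k y => match k with O => X 0%nat x y | _ => Y k x y end)).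
  { intros x Hx [|k] Hk.
    - apply (der_ext 1 (Y 0%nat x) (Y 1%nat x)); auto. now apply (CY x Hx 0%nat).
    - now apply (CY x Hx (S k)). }
  assert (S : slices (X 0%nat) (X 1%nat) (Y 1%nat) M).
  { split; [|split].
    - intros y Hy. apply (CX y Hy 0%nat). lia.
    - intros x Hx. apply (HY x Hx 0%nat). lia.
    - intros x y Hx Hy. now apply HM. }
  destruct (slices_RInt _ _ _ _ S) as [E1 E2].
  assert (CS : chain 1 4 (fun k x => simpson J2 (X k x))).
  { intros k Hk. apply der_simpson; [assumption|]. intros y Hy. now apply (CX y Hy k). }
  assert (E3 : ex_RInt (fun x => simpson J2 (X 0%nat x)) 0 1).
  { apply (proj1 (der_antiderivative 1 _ _ ltac:(lra) (CS 0%nat ltac:(lia))) 1). lra. }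
  assert (A1 : Rabs (int_Gamma (X 0%nat) - RInt (fun x => simpson J2 (X 0%nat x)) 0 1)
     <= 2 * M * step J2 ^ 4).
  { apply RInt_dist; auto. intros x Hx.
    apply (simpson_error J2 _ M H2 (HY x Hx)); intros; try now apply HM.
    - apply HB. split; [split; lra | auto].
    - apply HB. split; [split; lra | auto]. }
  assert (Z : forall x, (x = 0 \/ x = 1) -> simpson J2 (X 0%nat x) = 0).
  { intros x Hx. assert (Rabs (simpson J2 (X 0%nat x)) <= 0) as L.
    { apply simpson_bound; [assumption|]. intros z Hz. rewrite HB, Rabs_R0; [lra|].
      split; [split; lra | tauto]. }
    pose proof (Rabs_pos (simpson J2 (X 0%nat x))). apply Rabs_eq_0. lra. }
  assert (A2 : Rabs (RInt (fun x => simpson J2 (X 0%nat x)) 0 1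
      - simpson J1 (fun x => simpson J2 (fun y => X 0%nat x y))) <= 2 * M * step J1 ^ 4).
  { apply (simpson_error J1 _ M H1 CS).
    - intros x Hx. apply simpson_bound; [assumption|]. intros y Hy. now apply HM.
    - apply Z; auto.
    - apply Z; auto. }
  replace (_ - _) with ((int_Gamma (X 0%nat) - RInt (fun x => simpson J2 (X 0%nat x)) 0 1)
   + (RInt (fun x => simpson J2 (X 0%nat x)) 0 1
      - simpson J1 (fun x => simpson J2 (fun y => X 0%nat x y)))) by ring.
  eapply Rle_trans; [apply Rabs_triang|]. lra.
Qed.

(** * The norm F as a quadrature rule *)

(** The tensor product of two composite Simpson rules. *)
Definition gsimpson (J1 J2 : nat) (a : grid) : R :=
  4 / 9 * (step J1 * step J2) * gsum J1 J2 (fun i j =>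
    a (2 * i - 2)%nat (2 * j - 2)%nat + 2 * a (2 * i - 2)%nat (2 * j - 1)%nat
    + 2 * a (2 * i - 1)%nat (2 * j - 2)%nat + 4 * a (2 * i - 1)%nat (2 * j - 1)%nat).

Lemma simpson_gsimpson J1 J2 (g : R -> R -> R) :
  simpson J1 (fun x => simpson J2 (fun y => g x y))
  = gsimpson J1 J2 (fun i j => g (node J1 i) (node J2 j)).
Proof.
  unfold simpson, gsimpson, gsum.
  set (c1 := 2 * step J1 / 3). set (c2 := 2 * step J2 / 3).
  transitivity (c1 * (c2 * ssum J1 (fun i => ssum J2 (fun j =>
     1 * (g (node J1 (2 * i - 2)) (node J2 (2 * j - 2)) + 2 * g (node J1 (2 * i - 2)) (node J2 (2 * j - 1)))
     + 2 * (g (node J1 (2 * i - 1)) (node J2 (2 * j - 2)) + 2 * g (node J1 (2 * i - 1)) (node J2 (2 * j - 1))))))).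
  - f_equal. rewrite <- ssum_scal. apply ssum_ext; intros i Hi. rewrite ssum_lin. ring.
  - replace (4 / 9 * (step J1 * step J2)) with (c1 * c2) by (unfold c1, c2; field).
    rewrite Rmult_assoc. f_equal. f_equal.
    apply ssum_ext; intros i Hi. apply ssum_ext; intros j Hj. ring.
Qed.

Lemma gsum_parity J1 J2 (a : grid) : (1 <= J1)%nat -> (1 <= J2)%nat -> bc J1 J2 a ->
  gsum (2 * J1 - 1) (2 * J2 - 1) a = gsum J1 J2 (fun i j =>
    a (2 * i - 2)%nat (2 * j - 2)%nat + a (2 * i - 2)%nat (2 * j - 1)%nat
    + a (2 * i - 1)%nat (2 * j - 2)%nat + a (2 * i - 1)%nat (2 * j - 1)%nat).
Proof.
  intros H1 H2 B. unfold gsum. rewrite ssum_parity; [|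
    | assumption].
  - apply ssum_ext; intros i Hi.
    rewrite !ssum_parity by (assumption || (apply B; lia)).
    rewrite <- (Rmult_1_l (ssum J2 _)), <- (Rmult_1_l (ssum J2 (fun i0 => a (2 * i - 1)%nat _ + _))), <- ssum_lin.
    apply ssum_ext; intros; ring.
  - rewrite (ssum_ext _ _ (fun _ => 0)); [rewrite ssum_const; ring|]. intros; apply B; lia.
Qed.

Lemma norm2_sq J1 J2 w : (1 <= J1)%nat -> (1 <= J2)%nat -> norm2 J1 J2 w ^ 2 = ip J1 J2 w w.
Proof.
  intros H1 H2. unfold norm2.
  change (sum_n_m _ 1 (2 * J1 - 1)) with (gsum (2 * J1 - 1) (2 * J2 - 1) (fun i j => w i j ^ 2)).
  rewrite (gsum_ext _ _ _ (fun i j => w i j * w i j)) by (intros; ring).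
  apply pow2_sqrt. now apply ip_pos.
Qed.

Lemma gsum_pos m n a : (forall i j, 0 <= a i j) -> 0 <= gsum m n a.
Proof.
  intros H. replace 0 with (gsum m n (fun _ _ => 0)).
  - apply gsum_le; auto.
  - rewrite gsum_const. ring.
Qed.

(** Splitting the sum in [norm2] by parity, the weights of the two parts of the
    norm add up to 4/9 of 1, 2, 2, 4 on even-even, mixed and odd-odd nodes. *)
Lemma normF_sq J1 J2 w : (1 <= J1)%nat -> (1 <= J2)%nat -> bc J1 J2 w ->
  normF J1 J2 w ^ 2 = gsimpson J1 J2 (fun i j => w i j ^ 2).
Proof.
  intros H1 H2 B. pose proof (step_pos J1 H1). pose proof (step_pos J2 H2).
  unfold normF. rewrite pow2_sqrt by (pose proof (pow2_ge_0 (norm2 J1 J2 w));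
    pose proof (pow2_ge_0 (normE J1 J2 w)); lra).
  rewrite norm2_sq by assumption. unfold normE.
  change (sum_n_m _ 1 J1) with (gsum J1 J2 (fun i j =>
     w (2 * i - 2)%nat (2 * j - 1)%nat ^ 2 + w (2 * i - 1)%nat (2 * j - 2)%nat ^ 2
     + 3 * w (2 * i - 1)%nat (2 * j - 1)%nat ^ 2)).
  rewrite Rpow_mult_distr, pow2_sqrt.
  2:{ apply Rmult_le_pos; [nra|]. apply gsum_pos. intros i j.
      pose proof (pow2_ge_0 (w (2 * i - 2)%nat (2 * j - 1)%nat)).
      pose proof (pow2_ge_0 (w (2 * i - 1)%nat (2 * j - 2)%nat)).
      pose proof (pow2_ge_0 (w (2 * i - 1)%nat (2 * j - 1)%nat)). lra. }
  unfold ip. rewrite (gsum_ext _ _ (fun i j => w i j * w i j) (fun i j => w i j ^ 2)) by (intros; ring).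
  rewrite gsum_parity by (try assumption; now apply zbc_sq).
  unfold gsimpson.
  set (c := step J1 * step J2).
  match goal with |- 4 / 9 * (c * ?a) + (2 / 3) ^ 2 * (c * ?b) = _ =>
    transitivity (4 / 9 * c * (1 * a + 1 * b)); [field|] end.
  rewrite <- gsum_lin. f_equal. apply gsum_ext; intros. ring.
Qed.

Lemma gsimpson_dist J1 J2 a b : (1 <= J1)%nat -> (1 <= J2)%nat -> bc J1 J2 a -> bc J1 J2 b ->
  Rabs (gsimpson J1 J2 a - gsimpson J1 J2 b)
  <= 16 / 9 * ip J1 J2 (fun i j => Rabs (a i j - b i j)) (fun _ _ => 1).
Proof.
  intros H1 H2 Ba Bb. pose proof (step_pos J1 H1). pose proof (step_pos J2 H2).
  assert (Bd : bc J1 J2 (fun i j => Rabs (a i j - b i j))).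
  { intros i j Hi Hj D. rewrite Ba, Bb, Rminus_0_r by assumption. apply Rabs_R0. }
  assert (HL : forall s, (s = 1 \/ s = -1) -> s * (gsimpson J1 J2 a - gsimpson J1 J2 b)
     <= 16 / 9 * ip J1 J2 (fun i j => Rabs (a i j - b i j)) (fun _ _ => 1)).
  { intros s Hsg. unfold ip.
    rewrite (gsum_ext _ _ _ (fun i j => Rabs (a i j - b i j))) by (intros; ring).
    rewrite gsum_parity by assumption. unfold gsimpson.
    match goal with |- s * (?c * ?x - ?c * ?y) <= 16 / 9 * (?d * ?z) =>
      replace (s * (c * x - c * y)) with (4 / 9 * d * (s * x + (- s) * y)) by field;
      replace (16 / 9 * (d * z)) with (4 / 9 * d * (4 * z + 0 * z)) by field end.
    apply Rmult_le_compat_l; [nra|]. rewrite <- !gsum_lin.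
    apply gsum_le. intros i j _ _.
    assert (Hr : forall p q, s * (a p q - b p q) <= Rabs (a p q - b p q) /\ 0 <= Rabs (a p q - b p q)).
    { intros p q. split; [|apply Rabs_pos].
      pose proof (Rle_abs (a p q - b p q)). pose proof (Rle_abs (- (a p q - b p q))) as X.
      rewrite Rabs_Ropp in X. destruct Hsg as [-> | ->]; lra. }
    pose proof (Hr (2 * i - 2)%nat (2 * j - 2)%nat). pose proof (Hr (2 * i - 2)%nat (2 * j - 1)%nat).
    pose proof (Hr (2 * i - 1)%nat (2 * j - 2)%nat). pose proof (Hr (2 * i - 1)%nat (2 * j - 1)%nat).
    lra. }
  pose proof (HL 1 (or_introl eq_refl)). pose proof (HL (-1) (or_intror eq_refl)).
  apply Rabs_le. lra.
Qed.

(** Since v^2 - V^2 = (v - V)(v + V), the Cauchy-Schwarz inequality gives the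
    bound with the constant (16/9)^2 * 2 <= 8. *)
Lemma normF_dist J1 J2 v V : (1 <= J1)%nat -> (1 <= J2)%nat -> bc J1 J2 v -> bc J1 J2 V ->
  (normF J1 J2 v ^ 2 - normF J1 J2 V ^ 2) ^ 2
  <= 8 * ip J1 J2 (fun i j => v i j - V i j) (fun i j => v i j - V i j)
    * (ip J1 J2 v v + ip J1 J2 V V).
Proof.
  intros H1 H2 Bv BV. rewrite !normF_sq by assumption.
  set (d := fun i j => v i j - V i j).
  pose proof (gsimpson_dist J1 J2 _ _ H1 H2 (zbc_sq _ _ _ Bv) (zbc_sq _ _ _ BV)) as G.
  assert (E : ip J1 J2 (fun i j => Rabs (v i j ^ 2 - V i j ^ 2)) (fun _ _ => 1)
     = ip J1 J2 (fun i j => Rabs (d i j)) (fun i j => Rabs (v i j + V i j))).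
  { unfold ip. f_equal. apply gsum_ext; intros. rewrite <- Rabs_mult. unfold d.
    rewrite Rmult_1_r. f_equal. ring. }
  cbv beta in G. rewrite E in G.
  pose proof (ip_CS J1 J2 (fun i j => Rabs (d i j)) (fun i j => Rabs (v i j + V i j)) H1 H2) as C.
  assert (Sq : forall x, Rabs x * Rabs x = x * x) by (intros; rewrite <- Rabs_mult; apply Rabs_pos_eq; nra).
  assert (E1 : ip J1 J2 (fun i j => Rabs (d i j)) (fun i j => Rabs (d i j)) = ip J1 J2 d d).
  { unfold ip. f_equal. apply gsum_ext; intros. apply Sq. }
  assert (E2 : ip J1 J2 (fun i j => Rabs (v i j + V i j)) (fun i j => Rabs (v i j + V i j))
      <= 2 * (ip J1 J2 v v + ip J1 J2 V V)).
  { pose proof (ip_pos J1 J2 (fun i j => 1 * v i j + (-1) * V i j) H1 H2) as X.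
    rewrite ip_lin, !ip_lin_r in X.
    assert (E3 : ip J1 J2 (fun i j => Rabs (v i j + V i j)) (fun i j => Rabs (v i j + V i j))
       = ip J1 J2 (fun i j => 1 * v i j + 1 * V i j) (fun i j => 1 * v i j + 1 * V i j)).
    { unfold ip. f_equal. apply gsum_ext; intros. rewrite Sq. ring. }
    rewrite E3, ip_lin, !ip_lin_r. rewrite (ip_sym _ _ V v) in *. lra. }
  rewrite E1 in C. pose proof (ip_pos J1 J2 d H1 H2) as Pd.
  set (A := ip J1 J2 (fun i j => Rabs (d i j)) _) in *.
  assert (S : (gsimpson J1 J2 (fun i j => v i j ^ 2) - gsimpson J1 J2 (fun i j => V i j ^ 2)) ^ 2
     <= (16 / 9 * A) ^ 2).
  { rewrite <- (pow2_abs (gsimpson _ _ _ - _)). apply pow_incr. split; [apply Rabs_pos | exact G]. }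
  set (D := gsimpson J1 J2 _ - _) in *.
  assert (ip J1 J2 d d * ip J1 J2 (fun i j => Rabs (v i j + V i j)) (fun i j => Rabs (v i j + V i j))
    <= ip J1 J2 d d * (2 * (ip J1 J2 v v + ip J1 J2 V V))) by (now apply Rmult_le_compat_l).
  assert (0 <= ip J1 J2 d d * (ip J1 J2 v v + ip J1 J2 V V)).
  { apply Rmult_le_pos; [assumption|].
    pose proof (ip_pos J1 J2 v H1 H2). pose proof (ip_pos J1 J2 V H1 H2). lra. }
  fold d. nra.
Qed.

(** * The damping function, and continuous functions on the cylinder *)

(** The mean value theorem with 0 <= P' <= L. *)
Lemma damping_lipschitz P : damping P ->
  exists L, 0 <= L /\ forall a b, 0 <= a -> 0 <= b -> Rabs (P a - P b) <= L * Rabs (a - b).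
Proof.
  intros HP. destruct (damping_C1 P HP) as [P' [L H]]. exists L. split.
  - destruct (H 0 (Rle_refl 0)) as [_ [_ B]]. lra.
  - intros a b Ha Hb. set (T := Rmax a b).
    assert (HT : 0 <= b <= T /\ 0 <= a <= T)
      by (unfold T; pose proof (Rmax_l a b); pose proof (Rmax_r a b); lra).
    apply (der_lip T P P'); try tauto.
    + intros x Hx. apply (D_in_imp _ _ (fun w => 0 <= w)); [tauto | apply H; tauto].
    + intros z Hz. destruct (H z (proj1 Hz)) as [_ [_ B]]. rewrite Rabs_pos_eq; tauto.
Qed.

Lemma cylinder_eps T g x y t : continuous_cylinder T g -> in_cylinder T x y t ->
  forall eps, 0 < eps -> exists d : posreal, forall x' y' t', in_cylinder T x' y' t' ->
    Rabs (x' - x) < d -> Rabs (y' - y) < d -> Rabs (t' - t) < d ->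
    Rabs (g x' y' t' - g x y t) < eps.
Proof.
  intros Hg Hp eps Heps.
  specialize (Hg (x, y, t) Hp).
  assert (Hl : locally (g x y t) (fun z => Rabs (z - g x y t) < eps)).
  { exists (mkposreal eps Heps). intros z Hz. exact Hz. }
  destruct (Hg _ Hl) as [d Hd]. exists d. intros x' y' t' Hin Hx Hy Ht.
  apply (Hd (x', y', t')).
  - repeat split; assumption.
  - exact Hin.
Qed.

(** Compactness: finitely many boxes on which the function varies by less than
    one cover the cylinder. *)
Lemma cylinder_bounded T g : continuous_cylinder T g ->
  exists M, forall x y t, in_cylinder T x y t -> Rabs (g x y t) <= M.
Proof.
  intros Hg.
  assert (Hd : forall p : Compactness.Tn 3 R, exists d : posreal,
    in_cylinder T (fst p) (fst (snd p)) (fst (snd (snd p))) ->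
    forall x' y' t', in_cylinder T x' y' t' ->
    Rabs (x' - fst p) < d -> Rabs (y' - fst (snd p)) < d -> Rabs (t' - fst (snd (snd p))) < d ->
    Rabs (g x' y' t' - g (fst p) (fst (snd p)) (fst (snd (snd p)))) < 1).
  { intros [x [y [t []]]]. simpl. destruct (classic (in_cylinder T x y t)) as [I | NI].
    - destruct (cylinder_eps T g x y t Hg I 1 Rlt_0_1) as [d H]. exists d. auto.
    - exists (mkposreal 1 Rlt_0_1). tauto. }
  set (delta := fun p => proj1_sig (constructive_indefinite_description _ (Hd p))).
  assert (Hdelta := fun p => proj2_sig (constructive_indefinite_description _ (Hd p))).
  apply NNPP. intros N.
  (* The covering lemma holds only up to double negation. *)
  apply (compactness_list 3 (0, (0, (0, tt))) (1, (1, (T, tt))) delta).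
  intros [l Hl]. apply N.
  assert (Hmax : exists M, forall p, In p l ->
    Rabs (g (fst p) (fst (snd p)) (fst (snd (snd p)))) <= M).
  { clear. induction l as [|a l [M IH]].
    - exists 0. intros p [].
    - exists (Rmax M (Rabs (g (fst a) (fst (snd a)) (fst (snd (snd a)))))).
      intros p [-> | Hp]; [apply Rmax_r|]. eapply Rle_trans; [now apply IH | apply Rmax_l]. }
  destruct Hmax as [M HM]. exists (M + 1). intros x y t I.
  destruct (Hl (x, (y, (t, tt)))) as [[x0 [y0 [t0 []]]] [Hin [Hb Hc]]].
  { destruct I as [[I1 I2] I3]. simpl. tauto. }
  simpl in Hb, Hc.
  assert (C : Rabs (g x y t - g x0 y0 t0) < 1).
  { apply (Hdelta (x0, (y0, (t0, tt)))); simpl; try tauto.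
    unfold in_cylinder, in_closed_Gamma. tauto. }
  specialize (HM _ Hin). simpl in HM.
  replace (g x y t) with ((g x y t - g x0 y0 t0) + g x0 y0 t0) by ring.
  eapply Rle_trans; [apply Rabs_triang|]. lra.
Qed.

(** The sequence runs along the segment from [a] to [b], of which [a] is the
    limit and never a term when [b] differs from it. *)
Definition approach (a b : R) (k : nat) : R := a + / (INR k + 2) * (b - a).

Lemma approach_lim a b : is_lim_seq (approach a b) a.
Proof.
  unfold approach.
  apply (is_lim_seq_ext (fun k => a + / INR (k + 2) * (b - a))).
  { intros n. rewrite plus_INR. reflexivity. }
  replace a with (a + 0 * (b - a)) at 1 by ring.
  apply is_lim_seq_plus'; [apply is_lim_seq_const|].
  apply is_lim_seq_mult'; [|apply is_lim_seq_const].
  apply (is_lim_seq_incr_n (fun n => / INR n) 2).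
  apply (is_lim_seq_inv INR p_infty); [apply is_lim_seq_INR | discriminate].
Qed.

Lemma approach_between a b k : exists l, 0 < l < 1 /\ approach a b k = (1 - l) * a + l * b.
Proof.
  exists (/ (INR k + 2)). pose proof (pos_INR k). repeat split.
  - apply Rinv_0_lt_compat. lra.
  - rewrite <- Rinv_1. apply Rinv_lt_contravar; lra.
  - unfold approach. ring.
Qed.

Lemma approach_in T x y t k : 0 < T -> in_cylinder T x y t ->
  in_Gamma (approach x (/ 2) k) (approach y (/ 2) k) /\ 0 < approach t T k <= T.
Proof.
  intros HT [[Hx Hy] Ht].
  destruct (approach_between x (/ 2) k) as [l1 [L1 E1]].
  destruct (approach_between y (/ 2) k) as [l2 [L2 E2]].
  destruct (approach_between t T k) as [l3 [L3 E3]].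
  rewrite E1, E2, E3. clear E1 E2 E3.
  assert (W : forall l z c, 0 < l < 1 -> 0 <= z <= c -> 0 <= (1 - l) * z <= (1 - l) * c)
    by (intros; split; [apply Rmult_le_pos | apply Rmult_le_compat_l]; lra).
  pose proof (W l1 x 1 L1 Hx). pose proof (W l2 y 1 L2 Hy). pose proof (W l3 t T L3 Ht).
  assert (0 < l3 * T) by (apply Rmult_lt_0_compat; lra).
  unfold in_Gamma. lra.
Qed.

Lemma cylinder_lim T g x y t : 0 < T -> continuous_cylinder T g -> in_cylinder T x y t ->
  is_lim_seq (fun k => g (approach x (/ 2) k) (approach y (/ 2) k) (approach t T k)) (g x y t).
Proof.
  intros HT Hg I. apply is_lim_seq_spec. intros eps.
  destruct (cylinder_eps T g x y t Hg I eps (cond_pos eps)) as [d Hd].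
  assert (L : forall a b, eventually (fun k => Rabs (approach a b k - a) < d)).
  { intros a b. pose proof (approach_lim a b) as H. apply is_lim_seq_spec in H. apply H. }
  assert (L3 := filter_and _ _ (L x (/ 2)) (filter_and _ _ (L y (/ 2)) (L t T))).
  revert L3. apply filter_imp. intros k [K1 [K2 K3]].
  apply Hd; try assumption.
  destruct (approach_in T x y t k HT I) as [[G1 G2] G3]. split; [split|]; lra.
Qed.

(** * Families of partial derivatives with a common bound *)

(** The order is counted as for the exact solution.  The predicate is closed
    under applying the Laplacian, at the cost of two orders and a factor two in
    the bound, and this is what makes it convenient: the Laplacian of the
    solution and its bilaplacian are treated like the solution. *)
Definition jet (T : R) (m : nat) (E : nat -> nat -> nat -> R -> R -> R -> R) (M : R) : Prop :=
  (forall a b c, (order (S a) b c <= m)%nat -> forall x y, in_closed_Gamma x y ->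
     der T (E a b c x y) (E (S a) b c x y)) /\
  (forall a b c, (order a (S b) c <= m)%nat -> forall y t, 0 <= y <= 1 -> 0 <= t <= T ->
     der 1 (fun x => E a b c x y t) (fun x => E a (S b) c x y t)) /\
  (forall a b c, (order a b (S c) <= m)%nat -> forall x t, 0 <= x <= 1 -> 0 <= t <= T ->
     der 1 (fun y => E a b c x y t) (fun y => E a b (S c) x y t)) /\
  (forall a b c, (order a b c <= m)%nat -> forall x y t, in_cylinder T x y t ->
     Rabs (E a b c x y t) <= M).

Definition laplacian (E : nat -> nat -> nat -> R -> R -> R -> R) a b c x y t : R :=
  E a (S (S b)) c x y t + E a b (S (S c)) x y t.

Lemma jet_laplacian T m E M : jet T (S (S m)) E M -> jet T m (laplacian E) (2 * M).
Proof.
  intros [Ht [Hx [Hy HM]]]. unfold jet, laplacian, order in *. split; [|split; [|split]].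
  - intros a b c H x y I t It.
    apply (Dadd _ (E (S a) (S (S b)) c x y) (E (S a) b (S (S c)) x y)
      (E a (S (S b)) c x y) (E a b (S (S c)) x y)); apply Ht; trivial; lia.
  - intros a b c H y t I1 I2 x Ix.
    apply (Dadd _ (fun x => E a (S (S (S b))) c x y t) (fun x => E a (S b) (S (S c)) x y t)
      (fun x => E a (S (S b)) c x y t) (fun x => E a b (S (S c)) x y t)); apply Hx; trivial; lia.
  - intros a b c H x t I1 I2 y Iy.
    apply (Dadd _ (fun y => E a (S (S b)) (S c) x y t) (fun y => E a b (S (S (S c))) x y t)
      (fun y => E a (S (S b)) c x y t) (fun y => E a b (S (S c)) x y t)); apply Hy; trivial; lia.
  - intros a b c H x y t I. eapply Rle_trans; [apply Rabs_triang|].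
    pose proof (HM a (S (S b)) c ltac:(lia) x y t I).
    pose proof (HM a b (S (S c)) ltac:(lia) x y t I). lra.
Qed.

Lemma finite_bound n (Pk : nat -> R -> Prop) :
  (forall k M M', Pk k M -> M <= M' -> Pk k M') ->
  (forall k, (k <= n)%nat -> exists M, Pk k M) ->
  exists M, 0 < M /\ forall k, (k <= n)%nat -> Pk k M.
Proof.
  intros Mono H. induction n as [|n IH].
  - destruct (H 0%nat ltac:(lia)) as [M HM]. exists (Rmax 1 M).
    split; [pose proof (Rmax_l 1 M); lra|]. intros k Hk. replace k with 0%nat by lia.
    apply (Mono _ _ _ HM), Rmax_r.
  - destruct IH as [M [M0 HM]]; [intros; apply H; lia|].
    destruct (H (S n) ltac:(lia)) as [M' HM']. exists (Rmax M M').
    split; [pose proof (Rmax_l M M'); lra|]. intros k Hk.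
    destruct (Nat.eq_dec k (S n)) as [->|Ne].
    + apply (Mono _ _ _ HM'), Rmax_r.
    + apply (Mono _ M); [apply HM; lia | apply Rmax_l].
Qed.

(** A common bound exists because only finitely many indices have order at most
    eight; each of them is at most eight. *)
Lemma derivatives_jet T u D : derivatives T u D -> exists M, 0 < M /\ jet T 8 D M.
Proof.
  intros H.
  set (B := fun a b c M => (order a b c <= 8)%nat -> forall x y t, in_cylinder T x y t ->
     Rabs (D a b c x y t) <= M).
  assert (Mono : forall a b c M M', B a b c M -> M <= M' -> B a b c M').
  { intros a b c M M' HB HM Ho x y t I. specialize (HB Ho x y t I). lra. }
  destruct (finite_bound 8 (fun a M => forall b, (b <= 8)%nat -> forall c, (c <= 8)%nat -> B a b c M))
    as [M [HM0 HM]].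
  { intros a M M' K L b Hb c Hc. apply (Mono _ _ _ M); auto. }
  { intros a Ha.
    destruct (finite_bound 8 (fun b M => forall c, (c <= 8)%nat -> B a b c M)) as [M [_ HM]].
    { intros b M M' K L c Hc. apply (Mono _ _ _ M); auto. }
    { intros b Hb. destruct (finite_bound 8 (fun c M => B a b c M)) as [M [_ HM]].
      { intros c. apply Mono. }
      { intros c Hc. destruct (Nat.le_gt_cases (order a b c) 8) as [Ho | No].
        - destruct (cylinder_bounded T (D a b c) (der_cont T u D H a b c Ho)) as [M HM].
          exists M. intros _. exact HM.
        - exists 0. intros Ho. lia. }
      exists M. exact HM. }
    exists M. exact HM. }
  exists M. split; [exact HM0|]. unfold in_cylinder, in_closed_Gamma in *. split; [|split; [|split]].
  - intros a b c Ho x y I t It. apply (der_t T u D H); trivial. now split.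
  - intros a b c Ho y t Iy It x Ix. apply (der_x T u D H); trivial. repeat split; tauto.
  - intros a b c Ho x t Ix It y Iy. apply (der_y T u D H); trivial. repeat split; tauto.
  - intros a b c Ho. assert (Ho' := Ho). unfold order in Ho'.
    apply (HM a ltac:(lia) b ltac:(lia) c ltac:(lia) Ho).
Qed.

(** * The damping coefficient and the equation on the closed cylinder *)

Definition square_at (E : nat -> nat -> nat -> R -> R -> R -> R) (t x y : R) : R := E 0%nat 0%nat 0%nat x y t ^ 2.

Lemma jet_slices T m E M t : jet T (S m) E M -> 0 <= t <= T ->
  slices (square_at E t)
    (fun x y => 2 * E 0%nat 0%nat 0%nat x y t * E 0%nat 1%nat 0%nat x y t)
    (fun x y => 2 * E 0%nat 0%nat 0%nat x y t * E 0%nat 0%nat 1%nat x y t) (2 * M * M).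
Proof.
  intros [_ [Hx [Hy HM]]] It. unfold square_at, order in *.
  assert (Hsq : forall f f', der 1 f f' -> der 1 (fun x => f x ^ 2) (fun x => 2 * f x * f' x)).
  { intros f f' Hf. apply (der_ext 1 (fun x => f x * f x) (fun x => f' x * f x + f x * f' x));
      try (intros; ring). now apply der_mult. }
  split; [|split].
  - intros y Iy. apply (Hsq (fun x => E 0%nat 0%nat 0%nat x y t)). apply Hx; trivial; lia.
  - intros x Ix. apply (Hsq (fun y => E 0%nat 0%nat 0%nat x y t)). apply Hy; trivial; lia.
  - intros x y Ix Iy. rewrite !Rabs_mult, (Rabs_pos_eq 2) by lra.
    assert (I : in_cylinder T x y t) by (repeat split; tauto).
    pose proof (HM 0%nat 0%nat 0%nat ltac:(lia) x y t I).
    pose proof (HM 0%nat 1%nat 0%nat ltac:(lia) x y t I).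
    pose proof (Rabs_pos (E 0%nat 0%nat 0%nat x y t)). pose proof (Rabs_pos (E 0%nat 1%nat 0%nat x y t)).
    nra.
Qed.

Lemma int_Gamma_bound g gx gy K e : slices g gx gy K ->
  (forall x y, 0 <= x <= 1 -> 0 <= y <= 1 -> 0 <= g x y <= e) -> 0 <= int_Gamma g <= e.
Proof.
  intros S H. destruct (slices_RInt _ _ _ _ S) as [A B].
  assert (P : forall x, 0 <= x <= 1 -> 0 <= RInt (g x) 0 1 <= e).
  { intros x Hx. split.
    - apply RInt_ge_0; [lra | auto |]. intros y Hy. apply H; lra.
    - pose proof (abs_RInt_le_const (g x) 0 1 e ltac:(lra) (A x Hx)) as K'.
      specialize (K' ltac:(intros y Hy; rewrite Rabs_pos_eq; apply H; lra)).
      apply Rabs_le_between in K'. lra. }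
  split.
  - apply RInt_ge_0; [lra | exact B |]. intros x Hx. apply P. lra.
  - pose proof (abs_RInt_le_const (fun x => RInt (g x) 0 1) 0 1 e ltac:(lra) B) as K'.
    specialize (K' ltac:(intros x Hx; cbv beta; rewrite Rabs_pos_eq; apply (P x Hx))).
    apply Rabs_le_between in K'.
    change (int_Gamma g) with (RInt (fun x => RInt (g x) 0 1) 0 1). lra.
Qed.

Lemma square_at_integral T m E M : jet T (S (S m)) E M ->
  (forall t, 0 <= t <= T -> 0 <= int_Gamma (square_at E t) <= M ^ 2) /\
  (forall t s, 0 <= t <= T -> 0 <= s <= T ->
     Rabs (int_Gamma (square_at E t) - int_Gamma (square_at E s)) <= 2 * M * M * Rabs (t - s)).
Proof.
  intros J. assert (J' := J). destruct J' as [Ht [_ [_ HM]]]. split.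
  - intros t It. apply (int_Gamma_bound _ _ _ _ _ (jet_slices T _ E M t J It)).
    intros x y Ix Iy. unfold square_at.
    assert (I : in_cylinder T x y t) by (repeat split; tauto).
    pose proof (HM 0%nat 0%nat 0%nat ltac:(unfold order; lia) x y t I) as B.
    split; [apply pow2_ge_0|]. rewrite <- pow2_abs. apply pow_incr. split; [apply Rabs_pos | exact B].
  - intros t s It Is.
    apply (int_Gamma_dist _ _ _ _ _ _ _ _ _ (jet_slices T _ E M t J It) (jet_slices T _ E M s J Is)).
    intros x y Ix Iy. unfold square_at.
    assert (I : in_cylinder T x y t) by (repeat split; tauto).
    assert (I' : in_cylinder T x y s) by (repeat split; tauto).
    pose proof (HM 0%nat 0%nat 0%nat ltac:(unfold order; lia) x y t I) as B.
    pose proof (HM 0%nat 0%nat 0%nat ltac:(unfold order; lia) x y s I') as B'.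
    pose proof (der_lip T (E 0%nat 0%nat 0%nat x y) (E 1%nat 0%nat 0%nat x y) M s t
      (Ht 0%nat 0%nat 0%nat ltac:(unfold order; lia) x y (proj1 I))) as Lp.
    specialize (Lp ltac:(intros; apply HM; [unfold order; lia | split; [apply I | assumption]]) Is It).
    set (p := E 0%nat 0%nat 0%nat x y t) in *. set (q := E 0%nat 0%nat 0%nat x y s) in *.
    replace (p ^ 2 - q ^ 2) with ((p + q) * (p - q)) by ring. rewrite Rabs_mult.
    pose proof (Rabs_triang p q). pose proof (Rabs_pos (p - q)). pose proof (Rabs_pos (p + q)).
    rewrite Rmult_assoc. apply Rmult_le_compat; try assumption; lra.
Qed.

Definition qhat (P : R -> R) D (t : R) : R := P (int_Gamma (fun x y => Lap D x y t ^ 2)).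

Lemma Lap_square_at D t : (fun x y => Lap D x y t ^ 2) = square_at (laplacian D) t.
Proof. reflexivity. Qed.

(** Both [P] and the integral as a function of time are Lipschitz. *)
Lemma qhat_lipschitz T P D M : damping P -> jet T 8 D M ->
  exists K, 0 <= K /\ forall t s, 0 <= t <= T -> 0 <= s <= T ->
     Rabs (qhat P D t - qhat P D s) <= K * Rabs (t - s).
Proof.
  intros HP J. destruct (damping_lipschitz P HP) as [L [HL Lip]].
  pose proof (jet_laplacian T 6 D M J) as J2.
  destruct (square_at_integral T 4 _ _ J2) as [I1 I2].
  exists (L * (2 * (2 * M) * (2 * M))). split; [nra|].
  intros t s Ht It. unfold qhat. rewrite !Lap_square_at.
  eapply Rle_trans; [apply Lip; apply I1; assumption|].
  rewrite Rmult_assoc. apply Rmult_le_compat_l; [assumption|]. now apply I2.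
Qed.

(** Every term is continuous up to the boundary, and each point of the closed
    cylinder is a limit of points where the equation holds. *)
Lemma pde_closed T P f u0 u1 u D M : 0 < T -> damping P -> continuous_cylinder T f ->
  derivatives T u D -> jet T 8 D M -> plate_solution T P f u0 u1 D ->
  forall x y t, in_cylinder T x y t ->
    D 2%nat 0%nat 0%nat x y t + qhat P D t * D 1%nat 0%nat 0%nat x y t + BiLap D x y t = f x y t.
Proof.
  intros HT HP Hf HD J Hsol x y t I.
  destruct (qhat_lipschitz T P D M HP J) as [K [HK Lip]].
  assert (C : forall a b c, (order a b c <= 8)%nat -> is_lim_seq (fun k =>
     D a b c (approach x (/ 2) k) (approach y (/ 2) k) (approach t T k)) (D a b c x y t)).
  { intros a b c Ho. apply cylinder_lim; trivial. now apply (der_cont T u D HD). }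
  assert (Cq : is_lim_seq (fun k => qhat P D (approach t T k)) (qhat P D t)).
  { apply is_lim_seq_spec. intros eps.
    pose proof (approach_lim t T) as A. apply is_lim_seq_spec in A.
    assert (He : 0 < eps / (K + 1)) by (apply Rdiv_lt_0_compat; [apply cond_pos | lra]).
    specialize (A (mkposreal _ He)). revert A. apply filter_imp. intros k Hk. simpl in Hk.
    destruct (approach_in T x y t k HT I) as [_ Hin].
    eapply Rle_lt_trans; [apply Lip; [lra | apply I]|].
    assert (E : pos eps = (K + 1) * (eps / (K + 1))) by (field; lra). rewrite E.
    pose proof (Rabs_pos (approach t T k - t)). nra. }
  set (LHS := fun k => D 2%nat 0%nat 0%nat (approach x (/ 2) k) (approach y (/ 2) k) (approach t T k)
    + qhat P D (approach t T k) * D 1%nat 0%nat 0%nat (approach x (/ 2) k) (approach y (/ 2) k) (approach t T k)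
    + BiLap D (approach x (/ 2) k) (approach y (/ 2) k) (approach t T k)).
  assert (L1 : is_lim_seq LHS (D 2%nat 0%nat 0%nat x y t + qhat P D t * D 1%nat 0%nat 0%nat x y t
      + BiLap D x y t)).
  { unfold LHS. apply is_lim_seq_plus'; [apply is_lim_seq_plus'|].
    - apply C. unfold order; lia.
    - apply is_lim_seq_mult'; [exact Cq | apply C; unfold order; lia].
    - unfold BiLap. apply is_lim_seq_plus'; [apply is_lim_seq_plus'|];
        [apply C; unfold order; lia | | apply C; unfold order; lia].
      apply is_lim_seq_mult'; [apply is_lim_seq_const | apply C; unfold order; lia]. }
  assert (L2 : is_lim_seq LHS (f x y t)).
  { apply (is_lim_seq_ext (fun k => f (approach x (/ 2) k) (approach y (/ 2) k) (approach t T k))).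
    - intros k. destruct (approach_in T x y t k HT I) as [G1 G2].
      symmetry. now apply (plate_pde T P f u0 u1 D Hsol).
    - now apply cylinder_lim. }
  apply is_lim_seq_unique in L1. apply is_lim_seq_unique in L2. rewrite L1 in L2.
  now injection L2.
Qed.

(** The boundary values vanish for positive times, hence by continuity also at
    time zero. *)
Lemma plate_bc_closed T P f u0 u1 u D : 0 < T -> derivatives T u D ->
  plate_solution T P f u0 u1 D -> forall x y t, on_boundary x y -> 0 <= t <= T ->
    D 0%nat 0%nat 0%nat x y t = 0 /\ Lap D x y t = 0.
Proof.
  intros HT HD Hsol x y t Hb It.
  assert (Z : forall a b c, (order a b c <= 6)%nat -> der T (D a b c x y) (D (S a) b c x y)).
  { intros a b c Ho s Is. apply (der_t T u D HD); [unfold order in *; lia|]. split; [apply Hb | exact Is]. }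
  assert (K : forall g g', der T g g' -> (forall s, 0 < s <= T -> g s = 0) -> g t = 0).
  { intros g g' Hg H0. destruct (Req_dec t 0) as [->|Ne]; [|apply H0; lra].
    destruct (Req_dec (g 0) 0) as [|Ng]; [assumption|]. exfalso.
    assert (He : 0 < Rabs (g 0)) by now apply Rabs_pos_lt.
    destruct (cont_deriv _ _ _ _ (Hg 0 It) (Rabs (g 0)) He) as [al [Hal L]].
    (* A positive time at which g vanishes, too close to 0 for g(0) to differ
       from 0. *)
    set (s := Rmin (al / 2) T).
    assert (0 < s /\ s <= al / 2 /\ s <= T).
    { unfold s. pose proof (Rmin_l (al / 2) T). pose proof (Rmin_r (al / 2) T). repeat split; trivial.
      apply Rmin_glb_lt; lra. }
    specialize (L s). simpl in L. unfold Rdist in L. rewrite (H0 s) in L by lra.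
    replace (0 - g 0) with (- g 0) in L by ring. rewrite Rabs_Ropp in L.
    assert (X : Rabs (g 0) < Rabs (g 0)); [|lra].
    apply L. split; [repeat split; lra|]. rewrite Rminus_0_r, Rabs_pos_eq; lra. }
  split.
  - apply (K (D 0%nat 0%nat 0%nat x y) (D 1%nat 0%nat 0%nat x y)).
    + apply Z. unfold order; lia.
    + intros s Is. now apply (plate_bc T P f u0 u1 D Hsol).
  - apply (K (Lap D x y) (fun s => 1 * D 1%nat 2%nat 0%nat x y s + 1 * D 1%nat 0%nat 2%nat x y s)).
    + apply (der_ext T (fun s => 1 * D 0%nat 2%nat 0%nat x y s + 1 * D 0%nat 0%nat 2%nat x y s)
        (fun s => 1 * D 1%nat 2%nat 0%nat x y s + 1 * D 1%nat 0%nat 2%nat x y s));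
        try (intros; unfold Lap; ring).
      apply der_lin; apply Z; unfold order; lia.
    + intros s Is. now apply (plate_bc T P f u0 u1 D Hsol).
Qed.

(** * Consistency in space and time *)

Lemma opH_interior J1 J2 w i j : Defs.interior J1 J2 i j -> opH J1 J2 w i j = stencilH w i j.
Proof.
  intros [Hi Hj].
  assert (E1 : andb (Nat.ltb 0 i) (Nat.ltb i (2 * J1)) = true)
    by (apply andb_true_intro; split; apply Nat.ltb_lt; lia).
  assert (E2 : andb (Nat.ltb 0 j) (Nat.ltb j (2 * J2)) = true)
    by (apply andb_true_intro; split; apply Nat.ltb_lt; lia).
  unfold opH, opA, opB. rewrite E1, E2. unfold stencilH, tens, tri. field.
Qed.

Lemma opPhi_interior J1 J2 w i j : (1 <= J1)%nat -> (1 <= J2)%nat -> Defs.interior J1 J2 i j ->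
  opPhi J1 J2 w i j = stencilPhi (step J1) (step J2) w i j.
Proof.
  intros H1 H2 [Hi Hj]. pose proof (step_pos J1 H1). pose proof (step_pos J2 H2).
  assert (E1 : andb (Nat.ltb 0 i) (Nat.ltb i (2 * J1)) = true)
    by (apply andb_true_intro; split; apply Nat.ltb_lt; lia).
  assert (E2 : andb (Nat.ltb 0 j) (Nat.ltb j (2 * J2)) = true)
    by (apply andb_true_intro; split; apply Nat.ltb_lt; lia).
  unfold opPhi, opA, opB, d2x, d2y. rewrite E1, E2. unfold stencilPhi, tens, tri. field. lra.
Qed.

(** The weights of H are nonnegative with sum 1. *)
Lemma stencilH_bound J1 J2 w e i j : Defs.interior J1 J2 i j ->
  (forall i j, (i <= 2 * J1)%nat -> (j <= 2 * J2)%nat -> Rabs (w i j) <= e) ->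
  Rabs (stencilH w i j) <= e.
Proof.
  intros [Hi Hj] H.
  assert (B : forall i' j', (i' <= 2 * J1)%nat -> (j' <= 2 * J2)%nat -> - e <= w i' j' <= e)
    by (intros; apply Rabs_le_between; now apply H).
  pose proof (B (i - 1)%nat (j - 1)%nat ltac:(lia) ltac:(lia)).
  pose proof (B (i - 1)%nat j ltac:(lia) ltac:(lia)).
  pose proof (B (i - 1)%nat (j + 1)%nat ltac:(lia) ltac:(lia)).
  pose proof (B i (j - 1)%nat ltac:(lia) ltac:(lia)).
  pose proof (B i j ltac:(lia) ltac:(lia)).
  pose proof (B i (j + 1)%nat ltac:(lia) ltac:(lia)).
  pose proof (B (i + 1)%nat (j - 1)%nat ltac:(lia) ltac:(lia)).
  pose proof (B (i + 1)%nat j ltac:(lia) ltac:(lia)).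
  pose proof (B (i + 1)%nat (j + 1)%nat ltac:(lia) ltac:(lia)).
  apply Rabs_le_between. unfold stencilH, tens, tri. lra.
Qed.

Lemma node_pred J i : (1 <= i)%nat -> node J (i - 1) = node J i - step J.
Proof.
  intros Hi. replace (node J i) with (node J (i - 1 + 1)) by (f_equal; lia).
  rewrite node_S. ring.
Qed.

(** Phi phi - H (Laplacian of phi) is the average in [y] of the one-dimensional
    defects in [x] plus the average in [x] of those in [y]. *)
Lemma consistency J1 J2 (X Y : nat -> R -> R -> R) M i j : (1 <= J1)%nat -> (1 <= J2)%nat ->
  (forall x y, Y 0%nat x y = X 0%nat x y) ->
  (forall y, 0 <= y <= 1 -> chain 1 6 (fun k x => X k x y)) ->
  (forall x, 0 <= x <= 1 -> chain 1 6 (fun k y => Y k x y)) ->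
  (forall x y, 0 <= x <= 1 -> 0 <= y <= 1 -> Rabs (X 6%nat x y) <= M /\ Rabs (Y 6%nat x y) <= M) ->
  Defs.interior J1 J2 i j ->
  Rabs (stencilPhi (step J1) (step J2) (fun i j => X 0%nat (node J1 i) (node J2 j)) i j
    - stencilH (fun i j => X 2%nat (node J1 i) (node J2 j) + Y 2%nat (node J1 i) (node J2 j)) i j)
  <= 3 * M * (step J1 ^ 4 + step J2 ^ 4).
Proof.
  intros H1 H2 YX CX CY HM [Hi Hj].
  pose proof (step_pos J1 H1) as P1. pose proof (step_pos J2 H2) as P2.
  set (x := node J1 i). set (y := node J2 j). set (h1 := step J1) in *. set (h2 := step J2) in *.
  assert (Nx : 0 <= x - h1 /\ x + h1 <= 1).
  { unfold x, h1. rewrite <- node_pred, <- node_S by lia.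
    split; apply node_bound; lia. }
  assert (Ny : 0 <= y - h2 /\ y + h2 <= 1).
  { unfold y, h2. rewrite <- node_pred, <- node_S by lia.
    split; apply node_bound; lia. }
  assert (Ex : forall z, 0 <= z <= 1 -> Rabs ((X 0%nat (x + h1) z - 2 * X 0%nat x z + X 0%nat (x - h1) z) / h1 ^ 2
        - / 12 * (X 2%nat (x + h1) z + 10 * X 2%nat x z + X 2%nat (x - h1) z)) <= 3 * M * h1 ^ 4).
  { intros z Hz. apply (compact_consistency (fun k x => X k x z)); try tauto; [now apply CX|].
    intros; now apply HM. }
  assert (Ey : forall z, 0 <= z <= 1 -> Rabs ((Y 0%nat z (y + h2) - 2 * Y 0%nat z y + Y 0%nat z (y - h2)) / h2 ^ 2
        - / 12 * (Y 2%nat z (y + h2) + 10 * Y 2%nat z y + Y 2%nat z (y - h2))) <= 3 * M * h2 ^ 4).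
  { intros z Hz. apply (compact_consistency (fun k y => Y k z y)); try tauto; [now apply CY|].
    intros; now apply HM. }
  unfold stencilPhi, stencilH, tens, tri.
  rewrite !node_S, !node_pred by lia. fold x y h1 h2.
  pose proof (Ex (y - h2) ltac:(lra)) as A1. pose proof (Ex y ltac:(lra)) as A2.
  pose proof (Ex (y + h2) ltac:(lra)) as A3.
  pose proof (Ey (x - h1) ltac:(lra)) as B1. pose proof (Ey x ltac:(lra)) as B2.
  pose proof (Ey (x + h1) ltac:(lra)) as B3.
  rewrite !YX in B1, B2, B3.
  apply Rabs_le_between in A1, A2, A3, B1, B2, B3. apply Rabs_le_between.
  match type of A1 with _ <= ?a <= _ => set (a1 := a) in * end.
  match type of A2 with _ <= ?a <= _ => set (a2 := a) in * end.
  match type of A3 with _ <= ?a <= _ => set (a3 := a) in * end.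
  match type of B1 with _ <= ?a <= _ => set (b1 := a) in * end.
  match type of B2 with _ <= ?a <= _ => set (b2 := a) in * end.
  match type of B3 with _ <= ?a <= _ => set (b3 := a) in * end.
  match goal with |- _ <= ?e <= _ => replace e with
    (/ 12 * a1 + 10 / 12 * a2 + / 12 * a3 + (/ 12 * b1 + 10 / 12 * b2 + / 12 * b3)) end.
  - lra.
  - unfold a1, a2, a3, b1, b2, b3. field. lra.
Qed.

(** Linear combinations of two time levels cover both the time average and the
    centred time difference of the solution. *)
Lemma consistency_jet T m E M a b tp tm K J1 J2 i j : (6 <= m)%nat -> jet T m E M ->
  (1 <= J1)%nat -> (1 <= J2)%nat -> 0 <= tp <= T -> 0 <= tm <= T ->
  (forall x y, in_closed_Gamma x y ->
     Rabs (a * E 0%nat 6%nat 0%nat x y tp + b * E 0%nat 6%nat 0%nat x y tm) <= K /\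
     Rabs (a * E 0%nat 0%nat 6%nat x y tp + b * E 0%nat 0%nat 6%nat x y tm) <= K) ->
  Defs.interior J1 J2 i j ->
  Rabs (stencilPhi (step J1) (step J2) (fun i j => a * E 0%nat 0%nat 0%nat (node J1 i) (node J2 j) tp
          + b * E 0%nat 0%nat 0%nat (node J1 i) (node J2 j) tm) i j
    - stencilH (fun i j => a * laplacian E 0%nat 0%nat 0%nat (node J1 i) (node J2 j) tp
          + b * laplacian E 0%nat 0%nat 0%nat (node J1 i) (node J2 j) tm) i j)
  <= 3 * K * (step J1 ^ 4 + step J2 ^ 4).
Proof.
  intros Hm [_ [Hx [Hy _]]] H1 H2 Ip Im HK I.
  pose proof (consistency J1 J2
    (fun k x y => a * E 0%nat k 0%nat x y tp + b * E 0%nat k 0%nat x y tm)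
    (fun k x y => a * E 0%nat 0%nat k x y tp + b * E 0%nat 0%nat k x y tm) K i j H1 H2) as C.
  rewrite (stencilH_ext _ (fun i j => a * E 0%nat 2%nat 0%nat (node J1 i) (node J2 j) tp
       + b * E 0%nat 2%nat 0%nat (node J1 i) (node J2 j) tm
       + (a * E 0%nat 0%nat 2%nat (node J1 i) (node J2 j) tp
       + b * E 0%nat 0%nat 2%nat (node J1 i) (node J2 j) tm)))
    by (intros; unfold laplacian; ring).
  apply C; try assumption.
  - reflexivity.
  - intros y Iy k Hk.
    apply (der_lin 1 (fun x => E 0%nat k 0%nat x y tp) _ (fun x => E 0%nat k 0%nat x y tm));
      apply Hx; trivial; unfold order; lia.
  - intros x Ix k Hk.
    apply (der_lin 1 (fun y => E 0%nat 0%nat k x y tp) _ (fun y => E 0%nat 0%nat k x y tm));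
      apply Hy; trivial; unfold order; lia.
  - intros x y Ix Iy. apply HK. split; assumption.
Qed.

(** Odd powers cancel in the second difference, even ones in the centred first
    difference. *)
Lemma time_differences T F M t tau : chain T 4 F ->
  (forall k z, (k <= 4)%nat -> 0 <= z <= T -> Rabs (F k z) <= M) ->
  0 < tau -> 0 <= t - tau -> t + tau <= T ->
  Rabs ((F 0%nat (t + tau) - 2 * F 0%nat t + F 0%nat (t - tau)) / tau ^ 2 - F 2%nat t) <= 2 * M * tau ^ 2 /\
  Rabs ((F 0%nat (t + tau) - F 0%nat (t - tau)) / (2 * tau) - F 1%nat t) <= M * tau ^ 2.
Proof.
  intros HF HM Ht I1 I2.
  pose proof (taylor T 3 F M t (t + tau) HF ltac:(intros; apply HM; trivial) ltac:(lra) ltac:(lra)) as T1.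
  pose proof (taylor T 3 F M t (t - tau) HF ltac:(intros; apply HM; trivial) ltac:(lra) ltac:(lra)) as T2.
  assert (HF3 : chain T 3 F) by (intros k Hk; apply HF; lia).
  pose proof (taylor T 2 F M t (t + tau) HF3 ltac:(intros; apply HM; trivial; lia) ltac:(lra) ltac:(lra)) as T3.
  pose proof (taylor T 2 F M t (t - tau) HF3 ltac:(intros; apply HM; trivial; lia) ltac:(lra) ltac:(lra)) as T4.
  replace (t + tau - t) with tau in * by ring. replace (t - tau - t) with (- tau) in * by ring.
  rewrite Rabs_Ropp in *. rewrite (Rabs_pos_eq tau) in * by lra.
  unfold_taylor T1. unfold_taylor T2. unfold_taylor T3. unfold_taylor T4.
  assert (Ht2 : 0 < tau ^ 2) by nra.
  split.
  - set (r1 := F 0%nat (t + tau) - _) in T1. set (r2 := F 0%nat (t - tau) - _) in T2.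
    replace (_ - _) with ((r1 + r2) * / tau ^ 2) by (unfold r1, r2; field; lra).
    rewrite Rabs_mult, (Rabs_pos_eq (/ tau ^ 2)) by (left; now apply Rinv_0_lt_compat).
    replace (2 * M * tau ^ 2) with ((M * tau ^ 4 + M * tau ^ 4) * / tau ^ 2) by (field; lra).
    apply Rmult_le_compat_r; [left; now apply Rinv_0_lt_compat|].
    eapply Rle_trans; [apply Rabs_triang|]. simpl. lra.
  - set (r1 := F 0%nat (t + tau) - _) in T3. set (r2 := F 0%nat (t - tau) - _) in T4.
    replace (_ - _) with ((r1 - r2) * / (2 * tau)) by (unfold r1, r2; field; lra).
    rewrite Rabs_mult, (Rabs_pos_eq (/ (2 * tau))) by (left; apply Rinv_0_lt_compat; lra).
    replace (M * tau ^ 2) with ((M * tau ^ 3 + M * tau ^ 3) * / (2 * tau)) by (field; lra).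
    apply Rmult_le_compat_r; [left; apply Rinv_0_lt_compat; lra|].
    eapply Rle_trans; [apply Rabs_triang|]. rewrite Rabs_Ropp. simpl. lra.
Qed.

Lemma time_average T F M t tau : chain T 2 F ->
  (forall k z, (k <= 2)%nat -> 0 <= z <= T -> Rabs (F k z) <= M) ->
  0 < tau -> 0 <= t - tau -> t + tau <= T ->
  Rabs (/ 2 * F 0%nat (t + tau) + / 2 * F 0%nat (t - tau) - F 0%nat t) <= M * tau ^ 2.
Proof.
  intros HF HM Ht I1 I2.
  pose proof (taylor T 1 F M t (t + tau) HF ltac:(intros; apply HM; trivial) ltac:(lra) ltac:(lra)) as T1.
  pose proof (taylor T 1 F M t (t - tau) HF ltac:(intros; apply HM; trivial) ltac:(lra) ltac:(lra)) as T2.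
  replace (t + tau - t) with tau in * by ring. replace (t - tau - t) with (- tau) in * by ring.
  rewrite Rabs_Ropp in *. rewrite (Rabs_pos_eq tau) in * by lra.
  unfold_taylor T1. unfold_taylor T2.
  apply Rabs_le_between in T1, T2. apply Rabs_le_between. simpl in *. lra.
Qed.

Lemma time_quotient T F F' M t tau : der T F F' ->
  (forall z, 0 <= z <= T -> Rabs (F' z) <= M) ->
  0 < tau -> 0 <= t - tau -> t + tau <= T ->
  Rabs (/ (2 * tau) * F (t + tau) + - / (2 * tau) * F (t - tau)) <= M.
Proof.
  intros HF HM Ht I1 I2.
  pose proof (der_lip T F F' M (t - tau) (t + tau) HF HM ltac:(lra) ltac:(lra)) as L.
  replace (t + tau - (t - tau)) with (2 * tau) in L by ring.
  rewrite (Rabs_pos_eq (2 * tau)) in L by lra.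
  replace (_ + _) with ((F (t + tau) - F (t - tau)) * / (2 * tau)) by ring.
  rewrite Rabs_mult, (Rabs_pos_eq (/ (2 * tau))) by (left; apply Rinv_0_lt_compat; lra).
  apply (Rmult_le_reg_r (2 * tau)); [lra|]. rewrite Rmult_assoc, Rinv_l by lra. lra.
Qed.

Lemma jet_weaken T m m' E M : (m' <= m)%nat -> jet T m E M -> jet T m' E M.
Proof.
  intros Hm [Ht [Hx [Hy HM]]]. split; [|split; [|split]]; intros.
  - apply Ht; trivial; lia.
  - apply Hx; trivial; lia.
  - apply Hy; trivial; lia.
  - apply HM; trivial; lia.
Qed.

(** Leibniz' rule for the square of [F 0]. *)
Definition sq_derivative (F : nat -> R -> R) (k : nat) (x : R) : R :=
  match k with
  | 0%nat => F 0%nat x ^ 2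
  | 1%nat => 2 * (F 0%nat x * F 1%nat x)
  | 2%nat => 2 * F 1%nat x ^ 2 + 2 * (F 0%nat x * F 2%nat x)
  | 3%nat => 6 * (F 1%nat x * F 2%nat x) + 2 * (F 0%nat x * F 3%nat x)
  | _ => 6 * F 2%nat x ^ 2 + 8 * (F 1%nat x * F 3%nat x) + 2 * (F 0%nat x * F 4%nat x)
  end.

Lemma chain_sq T F : chain T 4 F -> chain T 4 (sq_derivative F).
Proof.
  intros HF.
  assert (Pr : forall a b, (a < 4)%nat -> (b < 4)%nat -> der T (fun x => F a x * F b x)
     (fun x => F (S a) x * F b x + F a x * F (S b) x)) by (intros; apply der_mult; apply HF; trivial).
  intros [|[|[|[|k]]]] Hk; [| | | | lia].
  - apply (der_ext T (fun x => F 0%nat x * F 0%nat x) (fun x => F 1%nat x * F 0%nat x + F 0%nat x * F 1%nat x));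
      [intros; simpl; ring | intros; simpl; ring | apply Pr; lia].
  - refine (der_ext T _ _ _ _ _ _ (der_lin T _ _ _ _ 2 0 (Pr 0%nat 1%nat ltac:(lia) ltac:(lia)) (Pr 0%nat 1%nat ltac:(lia) ltac:(lia)))); intros; simpl; ring.
  - refine (der_ext T _ _ _ _ _ _ (der_lin T _ _ _ _ 2 2 (Pr 1%nat 1%nat ltac:(lia) ltac:(lia)) (Pr 0%nat 2%nat ltac:(lia) ltac:(lia)))); intros; simpl; ring.
  - refine (der_ext T _ _ _ _ _ _ (der_lin T _ _ _ _ 6 2 (Pr 1%nat 2%nat ltac:(lia) ltac:(lia)) (Pr 0%nat 3%nat ltac:(lia) ltac:(lia)))); intros; simpl; ring.
Qed.

Lemma sq_derivative_bound F M x : (forall k, (k <= 4)%nat -> Rabs (F k x) <= M) ->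
  Rabs (sq_derivative F 1 x) <= 16 * M ^ 2 /\ Rabs (sq_derivative F 4 x) <= 16 * M ^ 2.
Proof.
  intros H.
  assert (B : forall a b, (a <= 4)%nat -> (b <= 4)%nat -> - M ^ 2 <= F a x * F b x <= M ^ 2).
  { intros a b Ha Hb. apply Rabs_le_between. rewrite Rabs_mult. simpl. rewrite Rmult_1_r.
    apply Rmult_le_compat; try apply Rabs_pos; now apply H. }
  pose proof (B 0%nat 1%nat ltac:(lia) ltac:(lia)). pose proof (B 2%nat 2%nat ltac:(lia) ltac:(lia)).
  pose proof (B 1%nat 3%nat ltac:(lia) ltac:(lia)). pose proof (B 0%nat 4%nat ltac:(lia) ltac:(lia)).
  pose proof (pow2_ge_0 M). split; apply Rabs_le_between; simpl in *; lra.
Qed.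

Lemma normF_quadrature T E M J1 J2 t : jet T 4 E M -> 0 <= t <= T ->
  (1 <= J1)%nat -> (1 <= J2)%nat ->
  (forall x y, on_boundary x y -> E 0%nat 0%nat 0%nat x y t = 0) ->
  bc J1 J2 (fun i j => E 0%nat 0%nat 0%nat (node J1 i) (node J2 j) t) ->
  Rabs (int_Gamma (square_at E t)
    - normF J1 J2 (fun i j => E 0%nat 0%nat 0%nat (node J1 i) (node J2 j) t) ^ 2)
  <= 32 * M ^ 2 * (step J1 ^ 4 + step J2 ^ 4).
Proof.
  intros [_ [Hx [Hy HM]]] It H1 H2 HB B.
  rewrite normF_sq by assumption.
  change (fun i j : nat => E 0%nat 0%nat 0%nat (node J1 i) (node J2 j) t ^ 2) with
    (fun i j : nat => square_at E t (node J1 i) (node J2 j)).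
  rewrite <- simpson_gsimpson.
  replace (32 * M ^ 2) with (2 * (16 * M ^ 2)) by ring.
  apply (simpson2_error J1 J2
    (fun k x y => sq_derivative (fun k x => E 0%nat k 0%nat x y t) k x)
    (fun k x y => sq_derivative (fun k y => E 0%nat 0%nat k x y t) k y)); trivial.
  - intros y Iy. apply (chain_sq 1 (fun k x => E 0%nat k 0%nat x y t)).
    intros k Hk. apply Hx; trivial; unfold order; lia.
  - intros x Ix. apply (chain_sq 1 (fun k y => E 0%nat 0%nat k x y t)).
    intros k Hk. apply Hy; trivial; unfold order; lia.
  - intros x y Ix Iy.
    assert (I : in_cylinder T x y t) by (repeat split; tauto).
    destruct (sq_derivative_bound (fun k x => E 0%nat k 0%nat x y t) M x) as [A1 A2].
    { intros k Hk. apply HM; trivial; unfold order; lia. }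
    destruct (sq_derivative_bound (fun k y => E 0%nat 0%nat k x y t) M y) as [A3 A4].
    { intros k Hk. apply HM; trivial; unfold order; lia. }
    tauto.
  - intros x y Hb. simpl. rewrite HB by assumption. ring.
Qed.

(** * The initial data *)

Lemma locally_01 x : 0 < x < 1 -> locally x (fun z => 0 < z < 1).
Proof.
  intros Hx. assert (Hd : 0 < Rmin x (1 - x)) by (apply Rmin_glb_lt; lra).
  exists (mkposreal _ Hd). intros z Hz. apply Rabs_def2 in Hz. simpl in Hz.
  unfold minus, plus, opp in Hz; simpl in Hz.
  pose proof (Rmin_l x (1 - x)). pose proof (Rmin_r x (1 - x)). lra.
Qed.

(** The total derivative operator is local, so in the interior it agrees with
    the one-sided derivatives. *)
Lemma derive2_chain F w x : chain 1 2 F -> (forall z, 0 < z < 1 -> w z = F 0%nat z) ->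
  0 < x < 1 -> Derive_n w 2 x = F 2%nat x.
Proof.
  intros HF Hw Hx.
  rewrite (Derive_n_ext_loc w (F 0%nat)).
  - change (Derive (fun z => Derive (fun y => F 0%nat y) z) x = F 2%nat x).
    rewrite (Derive_ext_loc _ (F 1%nat)).
    + apply is_derive_unique. apply (der_interior 1); [apply (HF 1%nat); lia | assumption].
    + apply (filter_imp (fun z => 0 < z < 1)); [|now apply locally_01].
      intros z Hz. apply is_derive_unique. apply (der_interior 1); [apply (HF 0%nat); lia | assumption].
  - apply (filter_imp (fun z => 0 < z < 1)); [exact Hw | now apply locally_01].
Qed.

Lemma lap_jet T E M t w : jet T 2 E M -> 0 <= t <= T ->
  (forall x y, in_Gamma x y -> w x y = E 0%nat 0%nat 0%nat x y t) ->
  forall x y, in_Gamma x y -> lap w x y = laplacian E 0%nat 0%nat 0%nat x y t.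
Proof.
  intros [_ [Hx [Hy _]]] It Hw x y [Ix Iy]. unfold lap, laplacian. f_equal.
  - apply (derive2_chain (fun k z => E 0%nat k 0%nat z y t)); trivial.
    + intros k Hk. apply Hx; try lra; unfold order; lia.
    + intros z Hz. apply Hw. now split.
  - apply (derive2_chain (fun k z => E 0%nat 0%nat k x z t)); trivial.
    + intros k Hk. apply Hy; try lra; unfold order; lia.
    + intros z Hz. apply Hw. now split.
Qed.

(** The expression from which the starting value of the second unknown is
    computed, together with all its derivatives. *)
Definition time_taylor (tau : R) (E : nat -> nat -> nat -> R -> R -> R -> R) a b c x y t : R :=
  E a b c x y t + (tau * E (S a) b c x y t + tau ^ 2 / 2 * E (S (S a)) b c x y t).

Lemma jet_time_taylor T m E M tau : jet T (4 + m) E M ->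
  jet T m (time_taylor tau E) (M + (Rabs tau * M + tau ^ 2 / 2 * M)).
Proof.
  intros [Ht [Hx [Hy HM]]]. unfold jet, time_taylor, order in *. split; [|split; [|split]].
  - intros a b c H x y I t It.
    apply (Dadd _ (E (S a) b c x y) (fun t => tau * E (S (S a)) b c x y t + tau ^ 2 / 2 * E (S (S (S a))) b c x y t)
      (E a b c x y) (fun t => tau * E (S a) b c x y t + tau ^ 2 / 2 * E (S (S a)) b c x y t));
      [apply Ht; trivial; lia|].
    apply (Dadd _ (fun t => tau * E (S (S a)) b c x y t) (fun t => tau ^ 2 / 2 * E (S (S (S a))) b c x y t)
      (fun t => tau * E (S a) b c x y t) (fun t => tau ^ 2 / 2 * E (S (S a)) b c x y t));
      apply Dmult_const; apply Ht; trivial; lia.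
  - intros a b c H y t I1 I2 x Ix.
    apply (Dadd _ (fun x => E a (S b) c x y t) (fun x => tau * E (S a) (S b) c x y t + tau ^ 2 / 2 * E (S (S a)) (S b) c x y t)
      (fun x => E a b c x y t) (fun x => tau * E (S a) b c x y t + tau ^ 2 / 2 * E (S (S a)) b c x y t));
      [apply Hx; trivial; lia|].
    apply (Dadd _ (fun x => tau * E (S a) (S b) c x y t) (fun x => tau ^ 2 / 2 * E (S (S a)) (S b) c x y t)
      (fun x => tau * E (S a) b c x y t) (fun x => tau ^ 2 / 2 * E (S (S a)) b c x y t)).
    + apply (Dmult_const _ (fun x => E (S a) b c x y t) (fun x => E (S a) (S b) c x y t)).
      apply Hx; trivial; lia.
    + apply (Dmult_const _ (fun x => E (S (S a)) b c x y t) (fun x => E (S (S a)) (S b) c x y t)).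
      apply Hx; trivial; lia.
  - intros a b c H x t I1 I2 y Iy.
    apply (Dadd _ (fun y => E a b (S c) x y t) (fun y => tau * E (S a) b (S c) x y t + tau ^ 2 / 2 * E (S (S a)) b (S c) x y t)
      (fun y => E a b c x y t) (fun y => tau * E (S a) b c x y t + tau ^ 2 / 2 * E (S (S a)) b c x y t));
      [apply Hy; trivial; lia|].
    apply (Dadd _ (fun y => tau * E (S a) b (S c) x y t) (fun y => tau ^ 2 / 2 * E (S (S a)) b (S c) x y t)
      (fun y => tau * E (S a) b c x y t) (fun y => tau ^ 2 / 2 * E (S (S a)) b c x y t)).
    + apply (Dmult_const _ (fun y => E (S a) b c x y t) (fun y => E (S a) b (S c) x y t)).
      apply Hy; trivial; lia.
    + apply (Dmult_const _ (fun y => E (S (S a)) b c x y t) (fun y => E (S (S a)) b (S c) x y t)).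
      apply Hy; trivial; lia.
  - intros a b c H x y t I.
    pose proof (HM a b c ltac:(lia) x y t I). pose proof (HM (S a) b c ltac:(lia) x y t I).
    pose proof (HM (S (S a)) b c ltac:(lia) x y t I).
    eapply Rle_trans; [apply Rabs_triang|]. apply Rplus_le_compat; [assumption|].
    eapply Rle_trans; [apply Rabs_triang|]. rewrite !Rabs_mult.
    rewrite (Rabs_pos_eq (tau ^ 2 / 2)) by (pose proof (pow2_ge_0 tau); lra).
    apply Rplus_le_compat; apply Rmult_le_compat_l; trivial; [apply Rabs_pos | pose proof (pow2_ge_0 tau); lra].
Qed.

(** The definition of [u2] is the equation at time zero solved for the second
    time derivative. *)
Lemma u2_value T P f u0 u1 u D M : 0 < T -> damping P -> continuous_cylinder T f ->
  derivatives T u D -> jet T 8 D M -> plate_solution T P f u0 u1 D ->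
  forall x y, in_Gamma x y -> u2 P f u0 u1 x y = D 2%nat 0%nat 0%nat x y 0.
Proof.
  intros HT HP Hf HD J Hsol x y I. unfold u2.
  assert (L0 : forall x y, in_Gamma x y -> lap u0 x y = Lap D x y 0).
  { apply (lap_jet T D M 0); [apply (jet_weaken T 8 2); [lia | exact J] | lra|].
    intros x' y' I'. symmetry. now apply (plate_init0 T P f u0 u1 D Hsol). }
  assert (L1 : lap (lap u0) x y = BiLap D x y 0).
  { rewrite (lap_jet T (laplacian D) (2 * M) 0 (lap u0)); trivial; try lra.
    - unfold laplacian, BiLap. ring.
    - apply (jet_weaken T 6 2); [lia | now apply jet_laplacian]. }
  assert (Q : int_Gamma (fun x' y' => lap u0 x' y' ^ 2) = int_Gamma (fun x' y' => Lap D x' y' 0 ^ 2)).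
  { apply RInt_ext. intros x' Hx'. apply RInt_ext. intros y' Hy'.
    rewrite Rmin_left, Rmax_right in Hx', Hy' by lra. rewrite L0; [reflexivity | now split]. }
  rewrite L1, Q.
  assert (I' : in_cylinder T x y 0).
  { destruct I. repeat split; lra. }
  pose proof (pde_closed T P f u0 u1 u D M HT HP Hf HD J Hsol x y 0 I') as E.
  rewrite <- (plate_init1 T P f u0 u1 D Hsol x y I). unfold qhat in E. lra.
Qed.

Lemma node_interior J i : (1 <= J)%nat -> (1 <= i <= 2 * J - 1)%nat -> 0 < node J i < 1.
Proof.
  intros HJ Hi. pose proof (step_pos J HJ).
  pose proof (node_bound J (i + 1) HJ ltac:(lia)) as B1.
  pose proof (node_bound J (i - 1) HJ ltac:(lia)) as B2.
  rewrite node_S in B1. rewrite node_pred in B2 by lia. lra.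
Qed.

Lemma initial_values T P f u0 u1 u D M J1 J2 N U V : 0 < T -> damping P ->
  continuous_cylinder T f -> derivatives T u D -> jet T 8 D M -> plate_solution T P f u0 u1 D ->
  (1 <= J1)%nat -> (1 <= J2)%nat -> scheme_solution T P f u0 u1 J1 J2 N U V ->
  forall i j, Defs.interior J1 J2 i j ->
  let x := node J1 i in let y := node J2 j in let tau := tstep T N in
  U 0%nat i j = D 0%nat 0%nat 0%nat x y 0 /\
  dt tau U 1 i j = D 1%nat 0%nat 0%nat x y 0 + tau / 2 * D 2%nat 0%nat 0%nat x y 0 /\
  V 0%nat i j = Lap D x y 0 /\
  V 1%nat i j = time_taylor tau (laplacian D) 0%nat 0%nat 0%nat x y 0.
Proof.
  intros HT HP Hf HD J Hsol H1 H2 S i j I x y tau.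
  assert (G : in_Gamma x y).
  { destruct I as [Hi Hj]. split; now apply node_interior. }
  assert (Eu2 := u2_value T P f u0 u1 u D M HT HP Hf HD J Hsol).
  split; [|split; [|split]].
  - rewrite (scheme_U0 T P f u0 u1 J1 J2 N U V S i j I). symmetry.
    now apply (plate_init0 T P f u0 u1 D Hsol).
  - unfold tau at 1. rewrite (scheme_U1 T P f u0 u1 J1 J2 N U V S i j I). fold x y tau.
    rewrite Eu2 by assumption. now rewrite (plate_init1 T P f u0 u1 D Hsol).
  - rewrite (scheme_V0 T P f u0 u1 J1 J2 N U V S i j I). fold x y.
    apply (lap_jet T D M 0); [apply (jet_weaken T 8 2); [lia | exact J] | lra | | assumption].
    intros x' y' I'. symmetry. now apply (plate_init0 T P f u0 u1 D Hsol).
  - rewrite (scheme_V1 T P f u0 u1 J1 J2 N U V S i j I). fold x y tau.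
    erewrite (lap_jet T (time_taylor tau D) _ 0); [ | apply (jet_weaken T 4 2); [lia | apply jet_time_taylor; exact J] | lra | | assumption].
    + unfold time_taylor, laplacian. ring.
    + intros x' y' I'. unfold time_taylor.
      rewrite Eu2 by assumption. rewrite <- (plate_init0 T P f u0 u1 D Hsol), <- (plate_init1 T P f u0 u1 D Hsol) by assumption.
      ring.
Qed.

(** * Truncation errors *)

Lemma tnode_facts T N : 0 < T ->
  0 < tstep T N /\ (forall n, tnode T N (n + 1) = tnode T N n + tstep T N) /\
  (forall n, (1 <= n)%nat -> tnode T N (n - 1) = tnode T N n - tstep T N) /\
  (forall n, (n <= N + 1)%nat -> 0 <= tnode T N n <= T) /\ tstep T N <= T.
Proof.
  intros HT. assert (HN : 0 < INR (N + 1)) by (apply (lt_INR 0); lia).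
  assert (Ht : 0 < tstep T N) by (unfold tstep; now apply Rdiv_lt_0_compat).
  assert (E : INR (N + 1) * tstep T N = T) by (unfold tstep; field; lra).
  split; [exact Ht|]. split; [|split; [|split]].
  - intros n. unfold tnode. rewrite plus_INR. simpl. ring.
  - intros n Hn. unfold tnode. rewrite minus_INR by lia. simpl. ring.
  - intros n Hn. unfold tnode. split; [apply Rmult_le_pos; [apply pos_INR | lra]|].
    apply Rle_trans with (INR (N + 1) * tstep T N); [|lra].
    apply Rmult_le_compat_r; [lra | now apply le_INR].
  - assert (1 <= INR (N + 1)) by (apply (le_INR 1); lia). nra.
Qed.

Definition defect1 J1 J2 T N f (kappa : R) (U V : nat -> grid) (n : nat) : grid := fun i j =>
  stencilH (dtt (tstep T N) U n) i j + kappa * stencilH (dtbar (tstep T N) U n) i j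
  + stencilPhi (step J1) (step J2) (tavg V n) i j - stencilH (restrict T J1 J2 N f n) i j.

Definition defect2 J1 J2 T N (U V : nat -> grid) (n : nat) : grid := fun i j =>
  stencilH (dtbar (tstep T N) V n) i j - stencilPhi (step J1) (step J2) (dtbar (tstep T N) U n) i j.

Definition rho T J1 J2 N : R := tstep T N ^ 2 + step J1 ^ 4 + step J2 ^ 4.

(** With the time-averaged Laplacian in place of Phi, the first defect is H
    applied to a grid function that the equation makes O(tau^2) at every node,
    boundary nodes included; the replacement costs O(h1^4 + h2^4).  The second
    defect is a pure space error of the centred time difference of [u]. *)
Lemma truncation T P f u0 u1 u D M : 0 < T -> damping P -> continuous_cylinder T f ->
  derivatives T u D -> 0 < M -> jet T 8 D M -> plate_solution T P f u0 u1 D ->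
  exists C, 0 < C /\ forall J1 J2 N n i j, (1 <= J1)%nat -> (1 <= J2)%nat -> (1 <= n <= N)%nat ->
  Defs.interior J1 J2 i j ->
  let EU := restrict T J1 J2 N (D 0%nat 0%nat 0%nat) in
  let EV := restrict T J1 J2 N (Lap D) in
  Rabs (defect1 J1 J2 T N f (qhat P D (tnode T N n)) EU EV n i j) <= C * rho T J1 J2 N /\
  Rabs (defect2 J1 J2 T N EU EV n i j) <= C * rho T J1 J2 N /\
  Rabs (stencilH (dtbar (tstep T N) EU n) i j) <= C.
Proof.
  intros HT HP Hf HD HM J Hsol.
  pose proof (jet_laplacian T 6 D M J) as JL.
  pose proof (jet_laplacian T 4 (laplacian D) (2 * M) JL) as JLL.
  assert (Hq : exists p1, 0 < p1 /\ forall t, 0 <= t <= T -> Rabs (qhat P D t) <= p1).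
  { destruct (square_at_integral T 4 _ _ JL) as [I1 _].
    destruct (damping_upper P HP ((2 * M) ^ 2) ltac:(nra)) as [p1 [Hp1 Up]].
    destruct (damping_lower P HP) as [p0 [Hp0 Lo]].
    exists p1. split; [assumption|]. intros t It. unfold qhat. rewrite Lap_square_at.
    rewrite Rabs_pos_eq; [now apply Up, I1|].
    specialize (Lo _ (proj1 (I1 t It))). lra. }
  destruct Hq as [p1 [Hp1 Hq]].
  exists (12 * M + p1 * M). split; [nra|].
  intros J1 J2 N n i j H1 H2 Hn I EU EV.
  destruct (tnode_facts T N HT) as [Htau [Tp [Tm [Tb _]]]].
  set (tau := tstep T N) in *. set (t := tnode T N n) in *.
  assert (It : 0 <= t <= T) by (apply Tb; lia).
  assert (Itp : 0 <= t + tau <= T) by (unfold t; rewrite <- Tp; apply Tb; lia).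
  assert (Itm : 0 <= t - tau <= T) by (unfold t; rewrite <- Tm by lia; apply Tb; lia).
  pose proof (step_pos J1 H1) as P1. pose proof (step_pos J2 H2) as P2.
  assert (Hrho : 0 <= tau ^ 2 /\ 0 <= step J1 ^ 4 /\ 0 <= step J2 ^ 4)
    by (repeat split; apply pow_le; lra).
  assert (Hr : rho T J1 J2 N = tau ^ 2 + (step J1 ^ 4 + step J2 ^ 4)) by (unfold rho; fold tau; ring).
  assert (Ch : forall m E K x y, jet T m E K -> in_closed_Gamma x y -> forall k, (2 * k <= m)%nat ->
     chain T k (fun k => E k 0%nat 0%nat x y) /\
     forall l z, (l <= k)%nat -> 0 <= z <= T -> Rabs (E l 0%nat 0%nat x y z) <= K).
  { intros m E K x y [Jt [_ [_ JM]]] Ixy k Hk. split.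
    - intros l Hl. apply Jt; trivial; unfold order; lia.
    - intros l z Hl Iz. apply JM; [unfold order; lia | now split]. }
  assert (Nd : forall i j, (i <= 2 * J1)%nat -> (j <= 2 * J2)%nat -> in_closed_Gamma (node J1 i) (node J2 j)).
  { intros i' j' Hi' Hj'. split; now apply node_bound. }
  split; [|split].
  - set (G := fun i j => dtt tau EU n i j + qhat P D t * dtbar tau EU n i j
      + (/ 2 * laplacian (laplacian D) 0%nat 0%nat 0%nat (node J1 i) (node J2 j) (t + tau)
         + / 2 * laplacian (laplacian D) 0%nat 0%nat 0%nat (node J1 i) (node J2 j) (t - tau))
      - restrict T J1 J2 N f n i j).
    assert (BG : Rabs (stencilH G i j) <= (6 * M + p1 * M) * tau ^ 2).
    { apply (stencilH_bound J1 J2); [assumption|]. intros i' j' Hi' Hj'. unfold G.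
      unfold dtt, dtbar, EU, restrict. rewrite Tp, Tm by lia. fold t.
      specialize (Nd i' j' Hi' Hj'). set (x := node J1 i') in *. set (y := node J2 j') in *.
      rewrite <- (pde_closed T P f u0 u1 u D M HT HP Hf HD J Hsol x y t (conj Nd It)).
      replace (BiLap D x y t) with (laplacian (laplacian D) 0%nat 0%nat 0%nat x y t)
        by (unfold laplacian, BiLap; ring).
      destruct (Ch 8%nat D M x y J Nd 4%nat ltac:(lia)) as [C1 B1].
      destruct (time_differences T _ M t tau C1 B1 Htau ltac:(lra) ltac:(lra)) as [D1 D2].
      destruct (Ch 4%nat _ _ x y JLL Nd 2%nat ltac:(lia)) as [C3 B3].
      pose proof (time_average T _ _ t tau C3 B3 Htau ltac:(lra) ltac:(lra)) as D3.
      cbv beta in D1, D2, D3.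
      assert (D2' : Rabs (qhat P D t * ((D 0%nat 0%nat 0%nat x y (t + tau) - D 0%nat 0%nat 0%nat x y (t - tau)) / (2 * tau)
          - D 1%nat 0%nat 0%nat x y t)) <= p1 * (M * tau ^ 2)).
      { rewrite Rabs_mult. apply Rmult_le_compat; try apply Rabs_pos; auto. }
      apply Rabs_le_between in D1, D2', D3. apply Rabs_le_between. lra. }
    assert (BC := consistency_jet T 6 (laplacian D) (2 * M) (/ 2) (/ 2) (t + tau) (t - tau) (2 * M)
       J1 J2 i j ltac:(lia) JL H1 H2 Itp Itm).
    specialize (BC ltac:(intros x y Ixy; destruct JL as [_ [_ [_ JM]]];
      pose proof (JM 0%nat 6%nat 0%nat ltac:(unfold order; lia) x y _ (conj Ixy Itp)) as A1;
      pose proof (JM 0%nat 6%nat 0%nat ltac:(unfold order; lia) x y _ (conj Ixy Itm)) as A2;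
      pose proof (JM 0%nat 0%nat 6%nat ltac:(unfold order; lia) x y _ (conj Ixy Itp)) as A3;
      pose proof (JM 0%nat 0%nat 6%nat ltac:(unfold order; lia) x y _ (conj Ixy Itm)) as A4;
      apply Rabs_le_between in A1, A2, A3, A4; split; apply Rabs_le_between; lra) I).
    assert (E : defect1 J1 J2 T N f (qhat P D t) EU EV n i j = stencilH G i j +
      (stencilPhi (step J1) (step J2) (fun i j => / 2 * laplacian D 0%nat 0%nat 0%nat (node J1 i) (node J2 j) (t + tau)
          + / 2 * laplacian D 0%nat 0%nat 0%nat (node J1 i) (node J2 j) (t - tau)) i j
       - stencilH (fun i j => / 2 * laplacian (laplacian D) 0%nat 0%nat 0%nat (node J1 i) (node J2 j) (t + tau)
          + / 2 * laplacian (laplacian D) 0%nat 0%nat 0%nat (node J1 i) (node J2 j) (t - tau)) i j)).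
    { unfold defect1. fold tau.
      rewrite (stencilPhi_ext _ _ (tavg EV n) (fun i j => / 2 * laplacian D 0%nat 0%nat 0%nat (node J1 i) (node J2 j) (t + tau)
          + / 2 * laplacian D 0%nat 0%nat 0%nat (node J1 i) (node J2 j) (t - tau))).
      - unfold G, stencilH, tens, tri. ring.
      - intros i' j'. unfold tavg, EV, restrict. rewrite Tp, Tm by lia.
        unfold Lap, laplacian. fold t. field. }
    rewrite E, Hr. apply Rabs_le_between in BG, BC. apply Rabs_le_between.
    assert (0 <= p1 * M * (step J1 ^ 4 + step J2 ^ 4)) by (apply Rmult_le_pos; nra).
    assert (0 <= M * tau ^ 2) by (apply Rmult_le_pos; lra).
    assert (0 <= M * (step J1 ^ 4 + step J2 ^ 4)) by (apply Rmult_le_pos; lra).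
    lra.
  - assert (BC := consistency_jet T 8 D M (/ (2 * tau)) (- / (2 * tau)) (t + tau) (t - tau) M
       J1 J2 i j ltac:(lia) J H1 H2 Itp Itm).
    specialize (BC ltac:(intros x y Ixy; destruct J as [Jt [_ [_ JM]]]; split;
      [apply (time_quotient T (D 0%nat 6%nat 0%nat x y) (D 1%nat 6%nat 0%nat x y))
      |apply (time_quotient T (D 0%nat 0%nat 6%nat x y) (D 1%nat 0%nat 6%nat x y))];
      try lra; try (apply Jt; [unfold order; lia | assumption]);
      intros z Iz; apply JM; [unfold order; lia | now split | unfold order; lia | now split]) I).
    unfold defect2. fold tau.
    rewrite (stencilPhi_ext _ _ (dtbar tau EU n) (fun i j => / (2 * tau) * D 0%nat 0%nat 0%nat (node J1 i) (node J2 j) (t + tau)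
          + - / (2 * tau) * D 0%nat 0%nat 0%nat (node J1 i) (node J2 j) (t - tau))).
    2:{ intros i' j'. unfold dtbar, EU, restrict. rewrite Tp, Tm by lia. fold t. field. lra. }
    rewrite (stencilH_ext (dtbar tau EV n) (fun i j => / (2 * tau) * laplacian D 0%nat 0%nat 0%nat (node J1 i) (node J2 j) (t + tau)
          + - / (2 * tau) * laplacian D 0%nat 0%nat 0%nat (node J1 i) (node J2 j) (t - tau))).
    2:{ intros i' j'. unfold dtbar, EV, restrict. rewrite Tp, Tm by lia. fold t.
        unfold Lap, laplacian. field. lra. }
    rewrite Rabs_minus_sym. eapply Rle_trans; [exact BC|]. rewrite Hr.
    assert (0 <= p1 * M * (tau ^ 2 + (step J1 ^ 4 + step J2 ^ 4))) by (apply Rmult_le_pos; nra).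
    assert (0 <= M * tau ^ 2) by (apply Rmult_le_pos; lra).
    assert (0 <= M * (step J1 ^ 4 + step J2 ^ 4)) by (apply Rmult_le_pos; lra).
    lra.
  - apply Rle_trans with M; [|nra]. apply (stencilH_bound J1 J2); [assumption|]. intros i' j' Hi' Hj'.
    specialize (Nd i' j' Hi' Hj').
    destruct (Ch 8%nat D M (node J1 i') (node J2 j') J Nd 1%nat ltac:(lia)) as [C1 B1].
    pose proof (time_quotient T _ _ M t tau (C1 0%nat ltac:(lia)) (fun z => B1 1%nat z (le_n 1)) Htau ltac:(lra) ltac:(lra)) as K.
    cbv beta in K. unfold dtbar, EU, restrict. rewrite Tp, Tm by lia. fold t.
    replace (_ / _) with (/ (2 * tau) * D 0%nat 0%nat 0%nat (node J1 i') (node J2 j') (t + tau)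
     + - / (2 * tau) * D 0%nat 0%nat 0%nat (node J1 i') (node J2 j') (t - tau)) by (field; lra).
    exact K.
Qed.

(** * Stability and convergence of the scheme *)

Lemma stencilPhi_lin h1 h2 w z x y i j :
  stencilPhi h1 h2 (fun i j => x * w i j + y * z i j) i j = x * stencilPhi h1 h2 w i j + y * stencilPhi h1 h2 z i j.
Proof. unfold stencilPhi, tens, tri. ring. Qed.

Lemma scheme_bc_zero T P f u0 u1 J1 J2 N U V : (1 <= J1)%nat -> (1 <= J2)%nat ->
  scheme_solution T P f u0 u1 J1 J2 N U V ->
  forall n, (n <= N + 1)%nat -> bc J1 J2 (U n) /\ bc J1 J2 (V n).
Proof.
  intros H1 H2 S n Hn.
  split; intros i j Hi Hj Hb;
    apply (scheme_bc T P f u0 u1 J1 J2 N U V S n i j Hn); unfold grid_boundary; lia.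
Qed.

Lemma exact_bc_zero T P f u0 u1 u D J1 J2 N : 0 < T -> derivatives T u D ->
  plate_solution T P f u0 u1 D -> (1 <= J1)%nat -> (1 <= J2)%nat ->
  forall n, (n <= N + 1)%nat -> bc J1 J2 (restrict T J1 J2 N (D 0%nat 0%nat 0%nat) n)
    /\ bc J1 J2 (restrict T J1 J2 N (Lap D) n).
Proof.
  intros HT HD Hsol H1 H2 n Hn.
  destruct (tnode_facts T N HT) as [_ [_ [_ [Tb _]]]].
  assert (B : forall i j, (i <= 2 * J1 - 1 + 1)%nat -> (j <= 2 * J2 - 1 + 1)%nat ->
    (i = 0 \/ i = 2 * J1 - 1 + 1 \/ j = 0 \/ j = 2 * J2 - 1 + 1)%nat ->
    on_boundary (node J1 i) (node J2 j)).
  { intros i j Hi Hj Hb. split.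
    - split; apply node_bound; lia.
    - replace (2 * J1 - 1 + 1)%nat with (2 * J1)%nat in Hb by lia.
      replace (2 * J2 - 1 + 1)%nat with (2 * J2)%nat in Hb by lia.
      destruct Hb as [-> | [-> | [-> | ->]]]; rewrite ?node_0, ?node_end by assumption; auto. }
  split; intros i j Hi Hj Hb;
    now apply (plate_bc_closed T P f u0 u1 u D HT HD Hsol); auto.
Qed.

Lemma interior_cylinder T J1 J2 i j : 0 < T -> (1 <= J1)%nat -> (1 <= J2)%nat ->
  Defs.interior J1 J2 i j -> in_closed_Gamma (node J1 i) (node J2 j) /\
  in_cylinder T (node J1 i) (node J2 j) 0.
Proof.
  intros HT H1 H2 [Hi Hj].
  assert (in_closed_Gamma (node J1 i) (node J2 j)) by (split; apply node_bound; lia).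
  split; [assumption | split; [assumption | lra]].
Qed.

(** The scheme fits [energy_bound] with H f as the first defect and no second
    one. *)
Lemma scheme_stability T P f u0 u1 u D M : 0 < T -> damping P -> continuous_cylinder T f ->
  derivatives T u D -> 0 < M -> jet T 8 D M -> plate_solution T P f u0 u1 D ->
  exists K, 0 < K /\ forall J1 J2 N U V, (1 <= J1)%nat -> (1 <= J2)%nat ->
  scheme_solution T P f u0 u1 J1 J2 N U V ->
  forall n, (n <= N)%nat -> ip J1 J2 (V n) (V n) <= K.
Proof.
  intros HT HP Hf HD HM J Hsol.
  destruct (damping_lower P HP) as [p0 [Hp0 Lo]].
  destruct (cylinder_bounded T f Hf) as [F HF].
  destruct (energy_bound T p0 0 HT Hp0 (Rle_refl 0)) as [K [HK EB]].
  pose proof (jet_laplacian T 6 D M J) as JL.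
  set (m1 := M + T * M). set (m2 := 2 * M + (T * (2 * M) + T ^ 2 * (2 * M))).
  set (b := 1 + F ^ 2 + m1 ^ 2 + 2 * m2 ^ 2).
  assert (Hb : 0 < b).
  { unfold b. pose proof (pow2_ge_0 F). pose proof (pow2_ge_0 m1). pose proof (pow2_ge_0 m2). lra. }
  exists (K * b). split; [now apply Rmult_lt_0_compat|].
  intros J1 J2 N U V H1 H2 S n Hn.
  destruct (tnode_facts T N HT) as [Htau [_ [_ [Tb TT]]]].
  set (tau := tstep T N) in *.
  assert (Ht2 : 0 <= tau ^ 2 <= T ^ 2) by (split; [apply pow2_ge_0 | apply pow_incr; lra]).
  assert (Hsz : state_sq J1 J2 tau U V n <= K * b).
  { apply (EB J1 J2 N (step J1) (step J2) b U V
      (fun n => stencilH (restrict T J1 J2 N f n)) (fun _ _ _ => 0) (fun n => P (normF J1 J2 (V n) ^ 2)));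
      trivial.
    - now apply (scheme_bc_zero T P f u0 u1 J1 J2 N).
    - intros k _. apply Lo, pow2_ge_0.
    - intros k i j Hk I. fold tau. split.
      + rewrite <- (opH_interior J1 J2 (restrict T J1 J2 N f k)), <- (opH_interior J1 J2 (dtt tau U k)),
          <- (opH_interior J1 J2 (dtbar tau U k)), <- opPhi_interior by assumption.
        now apply (scheme_eq1 T P f u0 u1 J1 J2 N U V S).
      + rewrite <- (opH_interior J1 J2 (dtbar tau V k)), <- opPhi_interior, Rplus_0_r by assumption.
        now apply (scheme_eq2 T P f u0 u1 J1 J2 N U V S).
    - intros k Hk. split.
      + rewrite Rmult_0_l, Rplus_0_l. apply Rle_trans with (F ^ 2).
        * apply ip_sup; trivial. intros i j I. apply (stencilH_bound J1 J2); [assumption|].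
          intros i' j' Hi' Hj'. apply HF. split; [split; now apply node_bound | apply Tb; lia].
        * unfold b. pose proof (pow2_ge_0 m1). pose proof (pow2_ge_0 m2). lra.
      + apply Rle_trans with (0 ^ 2); [|lra]. apply ip_sup; trivial. intros. rewrite Rabs_R0. lra.
    - fold tau. unfold state_sq. change (0 + 1)%nat with 1%nat.
      assert (IV := initial_values T P f u0 u1 u D M J1 J2 N U V HT HP Hf HD J Hsol H1 H2 S).
      assert (A1 : ip J1 J2 (dt tau U 1) (dt tau U 1) <= m1 ^ 2).
      { apply ip_sup; trivial. intros i j I. destruct (IV i j I) as [_ [E _]].
        destruct (interior_cylinder T J1 J2 i j HT H1 H2 I) as [_ I'].
        fold tau in E. rewrite E. destruct J as [_ [_ [_ JM]]].
        pose proof (JM 1%nat 0%nat 0%nat ltac:(unfold order; lia) _ _ _ I') as B1.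
        pose proof (JM 2%nat 0%nat 0%nat ltac:(unfold order; lia) _ _ _ I') as B2.
        eapply Rle_trans; [apply Rabs_triang|]. rewrite Rabs_mult, (Rabs_pos_eq (tau / 2)) by lra.
        unfold m1. apply Rplus_le_compat; [assumption|].
        apply Rmult_le_compat; trivial; try apply Rabs_pos; lra. }
      assert (A2 : ip J1 J2 (V 0%nat) (V 0%nat) <= m2 ^ 2).
      { apply ip_sup; trivial. intros i j I. destruct (IV i j I) as [_ [_ [E _]]].
        destruct (interior_cylinder T J1 J2 i j HT H1 H2 I) as [_ I'].
        rewrite E. destruct JL as [_ [_ [_ JM]]].
        pose proof (JM 0%nat 0%nat 0%nat ltac:(unfold order; lia) _ _ _ I') as B1.
        change (Rabs (Lap D (node J1 i) (node J2 j) 0) <= 2 * M) in B1.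
        assert (0 <= T * (2 * M)) by nra. assert (0 <= T ^ 2 * (2 * M)) by nra.
        unfold m2. lra. }
      assert (A3 : ip J1 J2 (V 1%nat) (V 1%nat) <= m2 ^ 2).
      { apply ip_sup; trivial. intros i j I. destruct (IV i j I) as [_ [_ [_ E]]].
        destruct (interior_cylinder T J1 J2 i j HT H1 H2 I) as [_ I'].
        rewrite E. destruct (jet_time_taylor T 2 _ _ (tstep T N) JL) as [_ [_ [_ JM]]].
        eapply Rle_trans; [apply JM; [unfold order; lia | exact I']|]. fold tau.
        rewrite Rabs_pos_eq by lra. unfold m2. apply Rplus_le_compat_l, Rplus_le_compat;
          apply Rmult_le_compat_r; lra. }
      unfold b. pose proof (pow2_ge_0 F). lra. }
  eapply Rle_trans; [|exact Hsz]. unfold state_sq.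
  pose proof (ip_pos J1 J2 (dt tau U (n + 1)) H1 H2). pose proof (ip_pos J1 J2 (V (n + 1)%nat) H1 H2). lra.
Qed.

(** The start has no error in V^0; the other two quantities are Taylor
    remainders of third order in time, divided by tau in the case of the
    difference quotient. *)
Lemma initial_error T P f u0 u1 u D M : 0 < T -> damping P -> continuous_cylinder T f ->
  derivatives T u D -> 0 < M -> jet T 8 D M -> plate_solution T P f u0 u1 D ->
  exists C, 0 < C /\ forall J1 J2 N U V, (1 <= J1)%nat -> (1 <= J2)%nat ->
  scheme_solution T P f u0 u1 J1 J2 N U V ->
  state_sq J1 J2 (tstep T N) (gsub (restrict T J1 J2 N (D 0%nat 0%nat 0%nat)) U)
    (gsub (restrict T J1 J2 N (Lap D)) V) 0 <= C * rho T J1 J2 N ^ 2.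
Proof.
  intros HT HP Hf HD HM J Hsol.
  pose proof (jet_laplacian T 6 D M J) as JL.
  exists (M ^ 2 + (2 * M * T) ^ 2). split.
  { pose proof (pow2_ge_0 (2 * M * T)). nra. }
  intros J1 J2 N U V H1 H2 S.
  destruct (tnode_facts T N HT) as [Htau [Tp [_ [Tb TT]]]].
  assert (IV := initial_values T P f u0 u1 u D M J1 J2 N U V HT HP Hf HD J Hsol H1 H2 S).
  assert (T0 : tnode T N 0 = 0) by (unfold tnode; simpl; ring).
  assert (T1 : tnode T N 1 = tstep T N) by (rewrite <- (Rplus_0_l (tstep T N)), <- T0; apply (Tp 0%nat)).
  set (tau := tstep T N) in *.
  assert (Hrho : 0 <= tau ^ 2 <= rho T J1 J2 N).
  { unfold rho. fold tau. pose proof (pow2_ge_0 tau).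
    assert (0 <= step J1 ^ 4) by (apply pow_le; left; now apply step_pos).
    assert (0 <= step J2 ^ 4) by (apply pow_le; left; now apply step_pos). lra. }
  assert (Tay : forall m E K x y, jet T m E K -> (6 <= m)%nat -> in_closed_Gamma x y ->
    Rabs (E 0%nat 0%nat 0%nat x y tau - (E 0%nat 0%nat 0%nat x y 0 +
      (tau * E 1%nat 0%nat 0%nat x y 0 + tau ^ 2 / 2 * E 2%nat 0%nat 0%nat x y 0))) <= K * tau ^ 3).
  { intros m E K x y [Jt [_ [_ JM]]] Hm I.
    pose proof (taylor T 2 (fun k => E k 0%nat 0%nat x y) K 0 tau
      ltac:(intros k Hk; apply Jt; [unfold order; lia | assumption])
      ltac:(intros z Hz; apply JM; [unfold order; lia | now split]) ltac:(lra) ltac:(lra)) as Ty.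
    rewrite Rminus_0_r, (Rabs_pos_eq tau) in Ty by lra.
    unfold_taylor Ty. apply Rabs_le_between in Ty. apply Rabs_le_between. simpl in *. lra. }
  unfold state_sq. change (0 + 1)%nat with 1%nat.
  assert (A1 : ip J1 J2 (dt tau (gsub (restrict T J1 J2 N (D 0%nat 0%nat 0%nat)) U) 1)
     (dt tau (gsub (restrict T J1 J2 N (D 0%nat 0%nat 0%nat)) U) 1) <= (M * tau ^ 2) ^ 2).
  { apply ip_sup; trivial. intros i j I. destruct (IV i j I) as [_ [E _]].
    destruct (interior_cylinder T J1 J2 i j HT H1 H2 I) as [I' _].
    pose proof (Tay 8%nat D M _ _ J ltac:(lia) I') as Ty.
    replace (dt tau (gsub (restrict T J1 J2 N (D 0%nat 0%nat 0%nat)) U) 1 i j) with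
      (dt tau (restrict T J1 J2 N (D 0%nat 0%nat 0%nat)) 1 i j - dt tau U 1 i j)
      by (unfold dt, gsub; field; lra).
    rewrite E. unfold dt, restrict. change (1 - 1)%nat with 0%nat. rewrite T0, T1.
    match type of Ty with Rabs ?a <= _ => match goal with |- Rabs ?c <= _ =>
      replace c with (a * / tau) by (field; lra) end end.
    rewrite Rabs_mult, (Rabs_pos_eq (/ tau)) by (left; now apply Rinv_0_lt_compat).
    replace (M * tau ^ 2) with (M * tau ^ 3 * / tau) by (field; lra).
    apply Rmult_le_compat_r; [left; now apply Rinv_0_lt_compat | exact Ty]. }
  assert (A2 : ip J1 J2 (gsub (restrict T J1 J2 N (Lap D)) V 1%nat)
     (gsub (restrict T J1 J2 N (Lap D)) V 1%nat) <= (2 * M * T * tau ^ 2) ^ 2).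
  { apply ip_sup; trivial. intros i j I. destruct (IV i j I) as [_ [_ [_ E]]].
    destruct (interior_cylinder T J1 J2 i j HT H1 H2 I) as [I' _].
    pose proof (Tay 6%nat _ _ _ _ JL ltac:(lia) I') as Ty.
    unfold gsub. rewrite E. unfold restrict. rewrite T1.
    eapply Rle_trans; [exact Ty|].
    replace (2 * M * tau ^ 3) with (2 * M * tau * tau ^ 2) by ring.
    apply Rmult_le_compat_r; [apply Hrho|]. apply Rmult_le_compat_l; lra. }
  assert (A3 : ip J1 J2 (gsub (restrict T J1 J2 N (Lap D)) V 0%nat)
     (gsub (restrict T J1 J2 N (Lap D)) V 0%nat) <= 0 ^ 2).
  { apply ip_sup; trivial. intros i j I. destruct (IV i j I) as [_ [_ [E _]]].
    unfold gsub. rewrite E. unfold restrict. rewrite T0, Rminus_diag, Rabs_R0. lra. }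
  assert (R2 : (tau ^ 2) ^ 2 <= rho T J1 J2 N ^ 2) by (now apply pow_incr).
  pose proof (pow2_ge_0 M). pose proof (pow2_ge_0 (2 * M * T)).
  rewrite Rpow_mult_distr in A1, A2.
  assert (M ^ 2 * (tau ^ 2) ^ 2 <= M ^ 2 * rho T J1 J2 N ^ 2) by (now apply Rmult_le_compat_l).
  assert ((2 * M * T) ^ 2 * (tau ^ 2) ^ 2 <= (2 * M * T) ^ 2 * rho T J1 J2 N ^ 2)
    by (now apply Rmult_le_compat_l).
  lra.
Qed.

(** The first defect of the errors is the truncation error plus the error in
    the damping coefficient, which is at most a multiple of the mesh error plus
    a multiple of the norm of v - V; the latter is the term governed by [lam] in
    [energy_bound]. *)
Lemma error_estimate T P f u0 u1 u D M : 0 < T -> damping P -> continuous_cylinder T f ->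
  derivatives T u D -> 0 < M -> jet T 8 D M -> plate_solution T P f u0 u1 D ->
  exists C, 0 < C /\ forall J1 J2 N U V, (1 <= J1)%nat -> (1 <= J2)%nat ->
  scheme_solution T P f u0 u1 J1 J2 N U V -> forall n, (n <= N)%nat ->
  state_sq J1 J2 (tstep T N) (gsub (restrict T J1 J2 N (D 0%nat 0%nat 0%nat)) U)
    (gsub (restrict T J1 J2 N (Lap D)) V) n <= C * rho T J1 J2 N ^ 2.
Proof.
  intros HT HP Hf HD HM J Hsol.
  pose proof (jet_laplacian T 6 D M J) as JL.
  destruct (damping_lower P HP) as [p0 [Hp0 Lo]].
  destruct (damping_lipschitz P HP) as [L [HL Lip]].
  destruct (scheme_stability T P f u0 u1 u D M HT HP Hf HD HM J Hsol) as [KV [HKV Stab]].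
  destruct (truncation T P f u0 u1 u D M HT HP Hf HD HM J Hsol) as [C [HC Tr]].
  destruct (initial_error T P f u0 u1 u D M HT HP Hf HD HM J Hsol) as [C0 [HC0 Init]].
  set (A1 := C + C * L * (32 * (2 * M) ^ 2)). set (A2 := C * L).
  set (B := (2 * M) ^ 2 + KV). set (lam := 16 * A2 ^ 2 * B).
  assert (HB : 0 <= B) by (unfold B; nra).
  assert (Hlam : 0 <= lam) by (unfold lam; pose proof (pow2_ge_0 A2); apply Rmult_le_pos; lra).
  destruct (energy_bound T p0 lam HT Hp0 Hlam) as [K [HK EB]].
  set (c := 2 * A1 ^ 2 + C ^ 2 + C0).
  assert (Hc : 0 < c) by (unfold c; pose proof (pow2_ge_0 A1); pose proof (pow2_ge_0 C); lra).
  exists (K * c). split; [now apply Rmult_lt_0_compat|].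
  intros J1 J2 N U V H1 H2 S n Hn.
  set (EU := restrict T J1 J2 N (D 0%nat 0%nat 0%nat)). set (EV := restrict T J1 J2 N (Lap D)).
  set (tau := tstep T N). set (rh := rho T J1 J2 N).
  destruct (tnode_facts T N HT) as [Htau [_ [_ [Tb _]]]]. fold tau in Htau.
  assert (Hrho : 0 <= rh /\ step J1 ^ 4 + step J2 ^ 4 <= rh).
  { unfold rh, rho. pose proof (pow2_ge_0 (tstep T N)).
    assert (0 <= step J1 ^ 4) by (apply pow_le; left; now apply step_pos).
    assert (0 <= step J2 ^ 4) by (apply pow_le; left; now apply step_pos). lra. }
  pose proof (pow2_ge_0 rh) as Hr2.
  set (kappa := fun n => P (normF J1 J2 (V n) ^ 2)).
  set (W := gsub EU U). set (Z := gsub EV V).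
  assert (BE := exact_bc_zero T P f u0 u1 u D J1 J2 N HT HD Hsol H1 H2). fold EU EV in BE.
  assert (BS := scheme_bc_zero T P f u0 u1 J1 J2 N U V H1 H2 S).
  rewrite Rmult_assoc.
  apply (EB J1 J2 N (step J1) (step J2) (c * rh ^ 2) W Z
    (fun n i j => stencilH (dtt tau W n) i j + kappa n * stencilH (dtbar tau W n) i j
       + stencilPhi (step J1) (step J2) (tavg Z n) i j)
    (fun n => defect2 J1 J2 T N W Z n) kappa); trivial.
  - intros k Hk. split; intros i j Hi Hj Hb; unfold W, Z, gsub.
    + rewrite (proj1 (BE k Hk) i j), (proj1 (BS k Hk) i j) by assumption. ring.
    + rewrite (proj2 (BE k Hk) i j), (proj2 (BS k Hk) i j) by assumption. ring.
  - intros k _. apply Lo, pow2_ge_0.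
  - intros k i j Hk I. split; [reflexivity|]. unfold defect2. fold tau. ring.
  - intros k Hk.
    assert (Itk : 0 <= tnode T N k <= T) by (apply Tb; lia).
    split.
    + (* The damping coefficient: delta is controlled by v - V. *)
 set (delta := Rabs (normF J1 J2 (EV k) ^ 2 - normF J1 J2 (V k) ^ 2)).
      assert (Hd : delta ^ 2 <= 8 * ip J1 J2 (Z k) (Z k) * B).
      { unfold delta. rewrite pow2_abs.
        eapply Rle_trans; [apply normF_dist; trivial; [apply BE; lia | apply BS; lia]|].
        apply Rmult_le_compat_l.
        - apply Rmult_le_pos; [lra | exact (ip_pos J1 J2 (Z k) H1 H2)].
        - unfold B. apply Rplus_le_compat; [|apply (Stab J1 J2 N U V); trivial; lia].
          apply ip_sup; trivial. intros i j I. destruct JL as [_ [_ [_ JM]]].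
          apply (JM 0%nat 0%nat 0%nat); [unfold order; lia|]. split; [|exact Itk].
          now apply (interior_cylinder T). }
      assert (Hk' : Rabs (kappa k - qhat P D (tnode T N k)) <= L * (delta + 32 * (2 * M) ^ 2 * rh)).
      { unfold kappa, qhat. rewrite Lap_square_at.
        destruct (square_at_integral T 4 _ _ JL) as [I1 _].
        eapply Rle_trans; [apply Lip; [apply pow2_ge_0 | now apply I1]|].
        apply Rmult_le_compat_l; [assumption|].
        assert (Qd := normF_quadrature T (laplacian D) (2 * M) J1 J2 (tnode T N k)
          (jet_weaken T 6 4 _ _ ltac:(lia) JL) Itk H1 H2).
        specialize (Qd ltac:(intros x y Hb;
          apply (plate_bc_closed T P f u0 u1 u D HT HD Hsol x y _ Hb Itk))
          (proj2 (BE k ltac:(lia)))).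
        change (fun i j : nat => laplacian D 0%nat 0%nat 0%nat (node J1 i) (node J2 j) (tnode T N k))
          with (EV k) in Qd.
        set (a := normF J1 J2 (V k) ^ 2) in *. set (e := normF J1 J2 (EV k) ^ 2) in *.
        set (q := int_Gamma _) in *.
        replace (a - q) with (- (e - a) - (q - e)) by ring.
        eapply Rle_trans; [apply Rabs_triang|]. rewrite !Rabs_Ropp. apply Rplus_le_compat.
        - unfold delta. lra.
        - eapply Rle_trans; [exact Qd|]. apply Rmult_le_compat_l; [nra | tauto]. }
      assert (Hr : forall i j, Defs.interior J1 J2 i j ->
        Rabs (stencilH (dtt tau W k) i j + kappa k * stencilH (dtbar tau W k) i j
          + stencilPhi (step J1) (step J2) (tavg Z k) i j) <= A1 * rh + A2 * delta).
      { intros i j I. destruct (Tr J1 J2 N k i j H1 H2 Hk I) as [D1 [_ D3]].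
        fold EU EV tau rh in D1, D3.
        pose proof (scheme_eq1 T P f u0 u1 J1 J2 N U V S k i j Hk I) as Eq.
        rewrite !opH_interior, opPhi_interior in Eq by assumption. fold tau in Eq. fold (kappa k) in Eq.
        assert (E : stencilH (dtt tau W k) i j + kappa k * stencilH (dtbar tau W k) i j
          + stencilPhi (step J1) (step J2) (tavg Z k) i j
          = defect1 J1 J2 T N f (qhat P D (tnode T N k)) EU EV k i j
          + (kappa k - qhat P D (tnode T N k)) * stencilH (dtbar tau EU k) i j).
        { unfold defect1. fold tau. rewrite <- Eq.
          rewrite (stencilH_ext (dtt tau W k) (fun i j => 1 * dtt tau EU k i j + (-1) * dtt tau U k i j))
            by (intros; unfold dtt, W, gsub; field; lra).
          rewrite (stencilH_ext (dtbar tau W k) (fun i j => 1 * dtbar tau EU k i j + (-1) * dtbar tau U k i j))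
            by (intros; unfold dtbar, W, gsub; field; lra).
          rewrite (stencilPhi_ext _ _ (tavg Z k) (fun i j => 1 * tavg EV k i j + (-1) * tavg V k i j))
            by (intros; unfold tavg, Z, gsub; field).
          rewrite stencilPhi_lin, !stencilH_lin. ring. }
        rewrite E. eapply Rle_trans; [apply Rabs_triang|]. rewrite Rabs_mult.
        assert (X : Rabs (kappa k - qhat P D (tnode T N k)) * Rabs (stencilH (dtbar tau EU k) i j)
          <= L * (delta + 32 * (2 * M) ^ 2 * rh) * C)
          by (apply Rmult_le_compat; trivial; apply Rabs_pos).
        unfold A1, A2. lra. }
      eapply Rle_trans; [apply ip_sup; [exact H1 | exact H2 | exact Hr]|].
      pose proof (pow2_ge_0 (A1 * rh - A2 * delta)).
      assert (A2 ^ 2 * delta ^ 2 <= A2 ^ 2 * (8 * ip J1 J2 (Z k) (Z k) * B))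
        by (apply Rmult_le_compat_l; [apply pow2_ge_0 | assumption]).
      assert (0 <= (C ^ 2 + C0) * rh ^ 2) by (apply Rmult_le_pos; [nra | assumption]).
      unfold lam, c. lra.
    + assert (Hs2 : forall i j, Defs.interior J1 J2 i j ->
        Rabs (defect2 J1 J2 T N W Z k i j) <= C * rh).
      { intros i j I. destruct (Tr J1 J2 N k i j H1 H2 Hk I) as [_ [D2 _]].
        fold EU EV tau rh in D2.
        pose proof (scheme_eq2 T P f u0 u1 J1 J2 N U V S k i j Hk I) as Eq.
        rewrite !opH_interior, opPhi_interior in Eq by assumption. fold tau in Eq.
        replace (defect2 J1 J2 T N W Z k i j) with (defect2 J1 J2 T N EU EV k i j); [exact D2|].
        unfold defect2. fold tau.
        rewrite (stencilH_ext (dtbar tau Z k) (fun i j => 1 * dtbar tau EV k i j + (-1) * dtbar tau V k i j))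
          by (intros; unfold dtbar, Z, gsub; field; lra).
        rewrite (stencilPhi_ext _ _ (dtbar tau W k) (fun i j => 1 * dtbar tau EU k i j + (-1) * dtbar tau U k i j))
          by (intros; unfold dtbar, W, gsub; field; lra).
        rewrite stencilPhi_lin, stencilH_lin, Eq. ring. }
      eapply Rle_trans; [apply ip_sup; [exact H1 | exact H2 | exact Hs2]|].
      assert (0 <= (2 * A1 ^ 2 + C0) * rh ^ 2)
        by (apply Rmult_le_pos; [pose proof (pow2_ge_0 A1); lra | assumption]).
      unfold c. lra.
  - eapply Rle_trans; [apply (Init J1 J2 N U V H1 H2 S)|]. fold rh.
    assert (0 <= (2 * A1 ^ 2 + C ^ 2) * rh ^ 2)
      by (apply Rmult_le_pos; [pose proof (pow2_ge_0 A1); pose proof (pow2_ge_0 C); lra | assumption]).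
    unfold c. lra.
Qed.

Theorem theorem4p4 :
  forall (T : R) (P : R -> R) (f : R -> R -> R -> R) (u0 u1 : R -> R -> R)
    (u : R -> R -> R -> R) (D : nat -> nat -> nat -> R -> R -> R -> R) (Q : R),
  0 < T ->
  damping P ->
  continuous_cylinder T f ->
  derivatives T u D ->
  plate_solution T P f u0 u1 D ->
  0 < Q ->
  (forall x y t, in_cylinder T x y t ->
    Rabs (D 4%nat 0%nat 0%nat x y t) <= Q /\
    Rabs (D 3%nat 2%nat 0%nat x y t) <= Q /\
    Rabs (D 3%nat 0%nat 2%nat x y t) <= Q /\
    Rabs (D 0%nat 6%nat 0%nat x y t) <= Q /\
    Rabs (D 0%nat 0%nat 6%nat x y t) <= Q /\
    Rabs (D 1%nat 4%nat 0%nat x y t) <= Q /\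
    Rabs (D 1%nat 0%nat 4%nat x y t) <= Q) ->
  exists QT : R, 0 < QT /\
    forall (J1 J2 N : nat) (U V : nat -> grid),
    (1 <= J1)%nat -> (1 <= J2)%nat ->
    scheme_solution T P f u0 u1 J1 J2 N U V ->
    forall n : nat, (1 <= n <= N)%nat ->
    let eu := gsub (restrict T J1 J2 N u) U in
    let ev := gsub (restrict T J1 J2 N (Lap D)) V in
    sqrt (norm2 J1 J2 (dt (tstep T N) eu (n + 1)%nat) ^ 2
          + norm2 J1 J2 (ev (n + 1)%nat) ^ 2
          + norm2 J1 J2 (ev n) ^ 2)
    <= QT * (tstep T N ^ 2 + step J1 ^ 4 + step J2 ^ 4).
Proof.
  intros T P f u0 u1 u D Q HT HP Hf HD Hsol _ _.
  destruct (derivatives_jet T u D HD) as [M [HM J]].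
  destruct (error_estimate T P f u0 u1 u D M HT HP Hf HD HM J Hsol) as [C [HC Est]].
  exists (sqrt C). split; [now apply sqrt_lt_R0|].
  intros J1 J2 N U V H1 H2 S n Hn eu ev.
  destruct (tnode_facts T N HT) as [Htau [_ [_ [Tb _]]]].
  specialize (Est J1 J2 N U V H1 H2 S n ltac:(lia)). unfold state_sq in Est. fold ev in Est.
  assert (Eu : forall k i j, (k <= N + 1)%nat -> Defs.interior J1 J2 i j ->
     restrict T J1 J2 N (D 0%nat 0%nat 0%nat) k i j = restrict T J1 J2 N u k i j).
  { intros k i j Hk I. apply (der_0 T u D HD). split; [|now apply Tb].
    now apply (interior_cylinder T). }
  set (w := dt (tstep T N) (gsub (restrict T J1 J2 N (D 0%nat 0%nat 0%nat)) U) (n + 1)) in *.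
  assert (Ew : forall i j, Defs.interior J1 J2 i j -> w i j = dt (tstep T N) eu (n + 1) i j).
  { intros i j I. unfold w, dt, eu, gsub. rewrite !Eu by (trivial; lia). reflexivity. }
  rewrite (ip_ext J1 J2 w (dt (tstep T N) eu (n + 1)) w (dt (tstep T N) eu (n + 1)) Ew Ew) in Est.
  rewrite !norm2_sq by assumption.
  assert (Hr : 0 <= rho T J1 J2 N).
  { unfold rho. pose proof (pow2_ge_0 (tstep T N)).
    assert (0 <= step J1 ^ 4) by (apply pow_le; left; now apply step_pos).
    assert (0 <= step J2 ^ 4) by (apply pow_le; left; now apply step_pos). lra. }
  change (tstep T N ^ 2 + step J1 ^ 4 + step J2 ^ 4) with (rho T J1 J2 N).
  rewrite <- (sqrt_pow2 (rho T J1 J2 N)) by assumption.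
  rewrite <- sqrt_mult by (try apply pow2_ge_0; lra).
  apply sqrt_le_1_alt. exact Est.
Qed.
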